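(* Let $-\infty\leqslant a<b\leqslant\infty$, let $\mu=\mu_{(A,\nu,\gamma)}\in ID(\mathbb{R}^d)$ and let $f\in\mathbf L_{(a,b)}(X^{(\mu)})$. Then $\Phi_{f,\mathrm{sym}}(\mu)$ is definable (that is, the symmetrized improper integral on $(a,b)$ of $f$ with respect to $X^{(\mu)}$ is definable) if and only if $$\int_a^b f(s)^2\,\mathrm{tr}A\,ds<\infty\qquad\text{and}\qquad \int_a^b ds\int_{\mathbb{R}^d}(|f(s)x|^2\wedge 1)\,\nu(dx)<\infty.$$
   Context: $ID(\mathbb{R}^d)$ is the class of infinitely divisible distributions on $\mathbb{R}^d$. For $\mu\in ID(\mathbb{R}^d)$, the cumulant function $C_\mu$ is the unique complex-valued continuous function on $\mathbb{R}^d$ with $C_\mu(0)=0$ and $\widehat\mu(z)=e^{C_\mu(z)}$. We write $\mu=\mu_{(A,\nu,\gamma)}$ if $\mu$ has Lévy–Khintchine triplet $(A,\nu,\gamma)$ in the form $$C_\mu(z)=-\tfrac12\langle z,Az\rangle+\int_{\mathbb{R}^d}\Big(e^{i\langle z,x\rangle}-1-\frac{i\langle z,x\rangle}{1+|x|^2}\Big)\nu(dx)+i\langle\gamma,z\rangle,$$ with $A$ symmetric nonnegative-definite, $\nu(\{0\})=0$, $\int(|x|^2\wedge1)\nu(dx)<\infty$, $\gamma\in\mathbb{R}^d$. Random measure. $X^{(\mu)}=\{X^{(\mu)}(B)\colon B\text{ bounded Borel in }\mathbb{R}\}$ is the (unique in law) $\mathbb{R}^d$-valued homogeneous independently scattered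 random measure on $\mathbb{R}$ such that $X^{(\mu)}((t,t+1])$ has distribution $\mu$ for all $t$. That is: (1) for disjoint bounded Borel sets $B_1,B_2,\dots$ with bounded union, $\sum_n X^{(\mu)}(B_n)$ converges a.s. and equals $X^{(\mu)}(\bigcup_n B_n)$ a.s.; (2) values on finitely many disjoint sets are independent; (3) $X^{(\mu)}(\{t\})=0$ a.s. for each $t$; and the law of $X^{(\mu)}(B+t)$ equals that of $X^{(\mu)}(B)$. Integrals. Let $\mathcal B^0_{(a,b)}$ be the class of Borel sets $B\subset(a,b)$ with $\inf B>a$ and $\sup B<b$. For a simple function $f=\sum_{j=1}^n r_j1_{B_j}$ ($B_j$ disjoint Borel in $(a,b)$, $r_j\in\mathbb{R}$), $\int_B f\,dX^{(\mu)}=\sum_j r_jX^{(\mu)}(B\cap B_j)$ for $B\in\mathcal B^0_{(a,b)}$. A measurable $f\colon(a,b)\to\mathbb{R}$ is locally $X^{(\mu)}$-integrable on $(a,b)$, written $f\in\mathbf L_{(a,b)}(X^{(\mu)})$, if there are simple functions $f_n\to f$ Lebesgue-a.e. on $(a,b)$ such that $\int_B f_n\,dX^{(\mu)}$ converges in probability for every $B\in\mathcal B^0_{(a,b)}$; the limit is $\int_B f(s)X^{(\mu)}(ds)$. For $a<p<q<b$, $\int_p^q f(s)X^{(\mu)}(ds)$ is the integral over $(p,q]$. Symmetrized improper integral. Let $X^{(\mu)\sharp}$ be an independent copy of $X^{(\mu)}$. For $f\in\mathbf L_{(a,b)}(X^{(\mu)})$, the symmetrized improper integral on $(a,b)$ of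 $f$ with respect to $X^{(\mu)}$ is definable if $\int_p^q f(s)(X^{(\mu)}(ds)-X^{(\mu)\sharp}(ds))$ converges in probability as $p\downarrow a$ and $q\uparrow b$. *)

(* Defs.v *)
From HB Require Import structures.
From mathcomp Require Import all_boot all_order all_algebra.
From mathcomp Require Import all_classical all_reals all_analysis.
From mathcomp Require Import complex.
Set Implicit Arguments.
Unset Strict Implicit.
Unset Printing Implicit Defensive.
Import Order.TTheory GRing.Theory Num.Theory numFieldNormedType.Exports.
Local Open Scope classical_set_scope.
Local Open Scope ring_scope.

(* The sigma-algebra on matrices generated by the entries, exactly as the
   library does for tuples; on 'rV[R]_d it is the Borel sigma-algebra. *)
Section measurable_matrix.
Context {disp : measure_display} {T : measurableType disp} {m n : nat}.

Definition mx_measurable : set_system 'M[T]_(m, n) :=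
  <<s [set U | exists i j (B : set T),
        measurable B /\ U = (fun M : 'M[T]_(m, n) => M i j) @^-1` B] >>.

Let mx_set0 : mx_measurable set0.
Proof. exact: sigma_algebra0. Qed.

Let mx_setC U : mx_measurable U -> mx_measurable (~` U).
Proof. exact: sigma_algebraC. Qed.

Let mx_bigcup (F : (set 'M[T]_(m, n))^nat) : (forall i, mx_measurable (F i)) ->
  mx_measurable (\bigcup_i F i).
Proof. exact: sigma_algebra_bigcup. Qed.

HB.instance Definition _ := @isMeasurable.Build default_measure_display
  'M[T]_(m, n) mx_measurable mx_set0 mx_setC mx_bigcup.

End measurable_matrix.

(* The library norm on 'rV[R]_d is the sup norm, hence the Euclidean one. *)
Section euclidean.
Context {R : realType} {d : nat}.
Implicit Types x y z : 'rV[R]_d.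

Definition inner x y : R := \sum_(i < d) x 0 i * y 0 i.

Definition enorm x : R := Num.sqrt (inner x x).

(* <z, A z>, with z a row vector *)
Definition quad (A : 'M[R]_d) z : R := inner z (z *m A^T).

End euclidean.

Section triplet.
Context {R : realType} {d : nat}.
Local Open Scope complex_scope.

Definition cexp (w : R[i]) : R[i] :=
  (expR (complex.Re w))%:C *
    (cos (complex.Im w) +i* sin (complex.Im w)).

Definition cintegral (m : {measure set 'rV[R]_d -> \bar R})
    (g : 'rV[R]_d -> R[i]) : R[i] :=
  Rintegral m setT (fun x => complex.Re (g x)) +i*
  Rintegral m setT (fun x => complex.Im (g x)).

Definition char_fun (mu : probability 'rV[R]_d R) (z : 'rV[R]_d) : R[i] :=
  cintegral mu (fun x => cexp (0 +i* inner z x)).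

(* C is the cumulant function of mu; continuity of a complex-valued function
   is continuity of its real and imaginary parts. *)
Definition is_cumulant (mu : probability 'rV[R]_d R) (C : 'rV[R]_d -> R[i]) :=
  [/\ continuous (fun z => complex.Re (C z)),
      continuous (fun z => complex.Im (C z)),
      C 0 = 0
    & forall z, char_fun mu z = cexp (C z)].

Definition LK_exponent (A : 'M[R]_d) (nu : {measure set 'rV[R]_d -> \bar R})
    (gam : 'rV[R]_d) (z : 'rV[R]_d) : R[i] :=
  (- (quad A z / 2))%:C
  + cintegral nu (fun x => cexp (0 +i* inner z x) - 1
                     - (0 +i* (inner z x / (1 + enorm x ^+ 2))))
  + (0 +i* inner gam z).

Definition has_triplet (mu : probability 'rV[R]_d R) (A : 'M[R]_d)
    (nu : {measure set 'rV[R]_d -> \bar R}) (gam : 'rV[R]_d) :=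
  [/\ A^T = A,
      forall z, 0 <= quad A z,
      nu [set 0] = 0%E,
      (\int[nu]_x (Num.min (enorm x ^+ 2) 1)%:E < +oo)%E
    & is_cumulant mu (LK_exponent A nu gam)].

(* (rho * rho^{n*})(B) = \int rho^{n*}(B - x) rho(dx) *)
Fixpoint conv_pow (rho : probability 'rV[R]_d R) (n : nat) (B : set 'rV[R]_d) :
    \bar R :=
  if n is n'.+1 then \int[rho]_x conv_pow rho n' [set y | B (x + y)%R]
  else \d_(0 : 'rV[R]_d) B.

Definition infinitely_divisible (mu : probability 'rV[R]_d R) :=
  forall n, (0 < n)%N -> exists rho : probability 'rV[R]_d R,
    forall B, measurable B -> mu B = conv_pow rho n B.

End triplet.

Section random_measure.
Context {R : realType} {d : nat} {disp : measure_display}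
  {Omega : measurableType disp} (P : probability Omega R).

Definition bounded_Borel (B : set R) := measurable B /\ bounded_set B.

(* X is a version of the random measure X^(mu); only its values on bounded
   Borel sets matter. *)
Record is_random_measure (mu : probability 'rV[R]_d R)
    (X : set R -> Omega -> 'rV[R]_d) : Prop := {
  rm_measurable : forall B, bounded_Borel B -> measurable_fun setT (X B);
  rm_additive : forall B : nat -> set R,
    (forall n, bounded_Borel (B n)) -> trivIset setT B ->
    bounded_set (\bigcup_n B n) ->
    {ae P, forall w, (fun n => \sum_(k < n) X (B k) w) @ \oo
                       --> X (\bigcup_n B n) w};
  rm_independent : forall (n : nat) (B : 'I_n -> set R)
      (E : 'I_n -> set 'rV[R]_d),
    (forall i, bounded_Borel (B i)) -> trivIset setT B ->
    (forall i, measurable (E i)) ->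
    P (\bigcap_i (X (B i) @^-1` E i)) = (\prod_i P (X (B i) @^-1` E i))%E;
  rm_atomless : forall t : R, {ae P, forall w, X [set t] w = 0};
  rm_homogeneous : forall B (t : R) (E : set 'rV[R]_d),
    bounded_Borel B -> measurable E ->
    P (X [set s + t | s in B] @^-1` E) = P (X B @^-1` E);
  rm_law : forall (t : R) (E : set 'rV[R]_d), measurable E ->
    P (X `]t, t + 1]%classic @^-1` E) = mu E }.

Definition rm_sigma (X : set R -> Omega -> 'rV[R]_d) : set_system Omega :=
  <<s [set U | exists B (E : set 'rV[R]_d),
         [/\ bounded_Borel B, measurable E & U = X B @^-1` E]] >>.

Definition rm_indep (X Y : set R -> Omega -> 'rV[R]_d) :=
  forall U V, rm_sigma X U -> rm_sigma Y V ->
    P (U `&` V) = (P U * P V)%E.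

Definition cvg_in_prob {I : Type} (F : set_system I)
    (Y : I -> Omega -> 'rV[R]_d) (Z : Omega -> 'rV[R]_d) :=
  forall eps : R, 0 < eps ->
    P [set w | eps < enorm (Y i w - Z w)] @[i --> F] --> 0%E.

End random_measure.

Section integral.
Context {R : realType} {d : nat} {disp : measure_display}
  {Omega : measurableType disp} (P : probability Omega R) (a b : \bar R).

Definition oitv : set R := [set s | (a < s%:E < b)%E].

(* inf and sup are taken in [-oo, +oo] *)
Definition inner_Borel (B : set R) :=
  [/\ measurable B, B `<=` oitv, (a < ereal_inf (EFin @` B))%E
    & (ereal_sup (EFin @` B) < b)%E].

(* A simple function, given by one of its representations \sum_j r_j 1_{B_j};
   the integrals of two representations are a.s. equal. *)
Record simple_fun := SimpleFun {
  sf_size : nat;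
  sf_coef : 'I_sf_size -> R;
  sf_set : 'I_sf_size -> set R;
  sf_measurable : forall j, measurable (sf_set j);
  sf_sub : forall j, sf_set j `<=` oitv;
  sf_disjoint : trivIset setT sf_set }.

Arguments sf_coef : clear implicits.
Arguments sf_set : clear implicits.

Definition sf_eval (g : simple_fun) (s : R) : R :=
  \sum_j sf_coef g j * \1_(sf_set g j) s.

Definition sf_integral (X : set R -> Omega -> 'rV[R]_d) (g : simple_fun)
    (B : set R) (w : Omega) : 'rV[R]_d :=
  \sum_j sf_coef g j *: X (B `&` sf_set g j) w.

(* the sequence g defines the integral of f with respect to X *)
Definition approximates (X : set R -> Omega -> 'rV[R]_d) (f : R -> R)
    (g : nat -> simple_fun) :=
  {ae lebesgue_measure, forall s : R, oitv s ->
     (fun n => sf_eval (g n) s) @ \oo --> f s} /\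
  forall B, inner_Borel B -> exists Y : Omega -> 'rV[R]_d,
    measurable_fun setT Y /\
    cvg_in_prob P \oo (fun n => sf_integral X (g n) B) Y.

Definition loc_integrable (X : set R -> Omega -> 'rV[R]_d) (f : R -> R) :=
  measurable_fun oitv f /\ exists g, approximates X f g.

(* Y is a version of \int_B f(s) X(ds) *)
Definition is_integral (X : set R -> Omega -> 'rV[R]_d) (f : R -> R)
    (B : set R) (Y : Omega -> 'rV[R]_d) :=
  measurable_fun setT Y /\
  exists2 g, approximates X f g
    & cvg_in_prob P \oo (fun n => sf_integral X (g n) B) Y.

(* the filter "p decreases to a and q increases to b" on pairs (p, q) with
   a < p < q < b *)
Definition to_ends : set_system (R * R) :=
  filter_from [set pq0 : R * R | (a < pq0.1%:E)%E /\ (pq0.2%:E < b)%E]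
    (fun pq0 => [set pq | [/\ (a < pq.1%:E)%E, (pq.2%:E < b)%E, pq.1 < pq.2,
                              pq.1 <= pq0.1 & pq0.2 <= pq.2]]).

Definition sym_definable (X Xs : set R -> Omega -> 'rV[R]_d) (f : R -> R) :=
  exists (Y : R * R -> Omega -> 'rV[R]_d) (Z : Omega -> 'rV[R]_d),
    [/\ forall p q : R, (a < p%:E)%E -> p < q -> (q%:E < b)%E ->
          is_integral (fun B w => X B w - Xs B w) f `]p, q]%classic (Y (p, q)),
        measurable_fun setT Z
      & cvg_in_prob P to_ends Y Z].

End integral.

Arguments sf_coef {R a b} s i.
Arguments sf_set {R a b} s i.

Lemma to_ends_proper (R : realType) (a b : \bar R) :
  (a < b)%E -> ProperFilter (to_ends a b).
Proof.
have dens (x y : \bar R) : (x < y)%E -> exists r : R, (x < r%:E < y)%E.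
  case: x => [x| |]; case: y => [y| |] //=; rewrite ?lte_fin => xy.
  - by exists ((x + y) / 2); rewrite !lte_fin !(midf_lt xy).
  - by exists (x + 1); rewrite lte_fin ltrDl ltr01 ltry.
  - by exists (y - 1); rewrite ltNyr lte_fin gtrDl ltrN10.
  - by exists 0; rewrite ltNyr ltry.
move=> ab; apply: filter_from_proper; first apply: filter_from_filter.
- have [r /andP[ar rb]] := dens _ _ ab.
  by exists (r, r).
- move=> [p0 q0] [p1 q1] /= [ap0 q0b] [ap1 q1b].
  exists (Num.min p0 p1, Num.max q0 q1) => /=.
    by split; rewrite ?(fun_if, minEle, maxEle); case: ifP.
  by move=> [p q] /= [ap qb pq]; rewrite le_min ge_max
    => /andP[? ?] /andP[? ?].
- move=> [p0 q0] /= [ap0 q0b].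
  have [r /andP[ar rb]] := dens _ _ ab.
  have [r' /andP[ar' r'r]] := dens _ _ ar.
  exists (Num.min p0 r', Num.max q0 r) => /=; split.
  + by rewrite minEle; case: ifP.
  + by rewrite maxEle; case: ifP.
  + by rewrite gt_min !lt_max -!lte_fin r'r !orbT.
  + by rewrite ge_min lexx.
  + by rewrite le_max lexx.
Qed.

(* Main.v *)
From HB Require Import structures.
From mathcomp Require Import all_boot all_order all_algebra.
From mathcomp Require Import all_classical all_reals all_analysis.
From mathcomp Require Import measurable_realfun complex ring lra.
Require Import Defs.
Set Implicit Arguments.
Unset Strict Implicit.
Unset Printing Implicit Defensive.
Import Order.TTheory GRing.Theory Num.Theory numFieldNormedType.Exports.
Local Open Scope classical_set_scope.
Local Open Scope ring_scope.
Local Open Scope complex_scope.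

(** Write [S B] for the difference of the two independent copies [X B] and
    [Xs B], [C] for the cumulant function of [mu] and [psi] for minus the real
    part of [C].

    Independence over disjoint sets and homogeneity force the characteristic
    function of [X B] to be exp (|B| C z), see [chf_rm].  Subtracting an
    independent copy squares the modulus and kills the phase, so a real step
    function [g] satisfies
      E cos <z, int g dS> = exp (- 2 int psi (g s z) ds),
    which is [Ex_cos_sym].  By the Levy-Khintchine formula [psi z] is the
    nonnegative quantity <z, A z> / 2 + int (1 - cos <z, x>) nu(dx).

    Two facts tie this identity to the criterion.  The average of 1 - cos (t u)
    over t in [0, 1] is at least min (u^2, 1) / 24; hence the integrals of
    psi (t f z) over small vectors [z] on the axes control the integral of the
    energy
      e r = r^2 tr A + int min (|r x|^2, 1) nu(dx)
    at [r = f s], see [iterated_min_sqr_lty].  Conversely psi (r z) is at most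
    a multiple of [e r], see [psi_axis_le].  The criterion says that [e (f s)]
    is integrable over the interval.

    If the integral converges, E cos <z, int_p^q f dS> stays above 1/2 near the
    ends for small [z], because a single limit variable has a characteristic
    function close to 1 near the origin.  The identity bounds int psi (g_n z)
    for the simple functions that define the integral, and Fatou's lemma, used
    once from [g_n] to [f] between [p] and [q] and once for [p] and [q] tending to
    the ends, bounds int psi (f z) ([definable_psi_le], [definable_finite]).

    If the energy of [f] is integrable, the same averaging with the probability
    as the measure turns the identity into
      E min (|int g dS|^2, 1) <= 96 d int e (g s) ds
    ([gap_step_le]).  Simple functions [g_n] dominated by [f] and converging to
    [f] have e (g_n - f) integrable with integral tending to 0, so their
    integrals over every Borel set are Cauchy for the truncated mean square
    distance, which is complete.  The limits between [p] and [q] and over the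
    whole interval differ by at most a multiple of the energy of [f] elsewhere,
    which tends to 0 at the ends ([finite_definable]). *)

(** * Recovering truncated second moments from averages of one minus cosine *)

Section trigonometric_bounds.
Context {R : realType}.
Implicit Types u v x : R.

Lemma sin_le x : 0 <= x -> sin x <= x.
Proof.
move=> x0.
have [|c _] := @MVT_segment R sin cos 0 x x0.
- by apply: continuous_subspaceT => y; exact: continuous_sin.
rewrite sin0 !subr0 => ->.
by rewrite -[leRHS]mul1r ler_wpM2r// cos_le1.
Qed.

Lemma normr_sin_le x : `|sin x| <= `|x|.
Proof.
wlog x0 : x / 0 <= x.
  move=> h; have [/h//|x0] := leP 0 x.
  by rewrite -normrN -sinN -(normrN x) h// oppr_ge0 ltW.
rewrite (ger0_norm x0) ler_norml sin_le// andbT.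
have [x1|x1] := leP 1 x.
  by rewrite (le_trans _ (sin_geN1 _))// lerN2.
rewrite (le_trans (_ : - x <= 0)) ?oppr_le0//.
apply: sin_ge0_pi; rewrite x0/= (le_trans (ltW x1))//.
by rewrite (le_trans _ (@pi_ge2 _))// ler1n.
Qed.

Lemma one_sub_cosE v : 1 - cos v = 2 * sin (v / 2) ^+ 2.
Proof.
have {1}-> : v = (v / 2) *+ 2 by rewrite -mulr_natr divfK// pnatr_eq0.
by rewrite cos_mulr2n cos2sin2 -mulr_natr; lra.
Qed.

Lemma one_sub_cos_ge0 v : 0 <= 1 - cos v.
Proof. by rewrite subr_ge0 cos_le1. Qed.

Lemma one_sub_cos_le2 v : 1 - cos v <= 2.
Proof. by have := cos_geN1 v; lra. Qed.

Lemma one_sub_cos_le_sqr v : 1 - cos v <= v ^+ 2 / 2.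
Proof.
rewrite one_sub_cosE.
have : sin (v / 2) ^+ 2 <= (v / 2) ^+ 2.
  by rewrite -(@real_normK _ (sin _)) ?num_real// -(@real_normK _ (v / 2)) ?num_real// lerXn2r ?nnegrE// normr_sin_le.
by move=> h; apply: (le_trans (ler_wpM2l _ h)) => //; rewrite le_eqVlt; apply/orP; left; apply/eqP; field.
Qed.

Lemma one_sub_cos_le_min v : 1 - cos v <= 2 * Num.min (v ^+ 2) 1.
Proof.
rewrite minEle; case: ifP => _.
  by rewrite (le_trans (one_sub_cos_le_sqr _))//; have := sqr_ge0 v; lra.
by rewrite mulr1 one_sub_cos_le2.
Qed.

(** The mean value theorem bounds [sin (v / 2)] below by [v / 4] here, as the
    cosine is at least 1/2 on the unit interval. *)
Lemma one_sub_cos_ge_sqr v : `|v| <= 2 -> v ^+ 2 / 8 <= 1 - cos v.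
Proof.
wlog v0 : v / 0 <= v.
  move=> h; have [/h//|v0] := leP 0 v.
  by rewrite -normrN => /h; rewrite cosN sqrrN; apply; rewrite oppr_ge0 ltW.
rewrite ger0_norm// => v2; rewrite one_sub_cosE.
have : v / 4 <= sin (v / 2).
  have w0 : 0 <= v / 2 by lra.
  have [|c] := @MVT_segment R sin cos 0 (v / 2) w0.
  - by apply: continuous_subspaceT => y; exact: continuous_sin.
  rewrite in_itv/= => /andP[c0 cv]; rewrite sin0 !subr0 => ->.
  have c1 : 1 / 2 <= cos c.
    have := one_sub_cos_le_sqr c.
    have : c ^+ 2 <= 1 by rewrite expr_le1//; lra.
    lra.
  by nra.
move=> h.
have : (v / 4) ^+ 2 <= sin (v / 2) ^+ 2 by rewrite lerXn2r ?nnegrE//; lra.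
by rewrite !expr2; lra.
Qed.

Lemma normr_cosB_le u v : `|cos u - cos v| <= `|u - v|.
Proof.
wlog uv : u v / v <= u.
  move=> h; have [/h//|/ltW/h] := leP v u.
  by rewrite distrC (distrC v).
have [|c _ ->] := @MVT_segment R cos (fun x => - sin x) v u uv.
- by apply: continuous_subspaceT => y; exact: continuous_cos.
by rewrite normrM normrN -[leRHS]mul1r ler_wpM2r// sin_max.
Qed.

Lemma normr_cosB_le2 u v : `|cos u - cos v| <= 2.
Proof.
by rewrite (le_trans (ler_normB _ _))// -[2]/(1 + 1) lerD// cos_max.
Qed.

Local Notation leb := (@lebesgue_measure R).
Local Notation unif := (uniform_prob (@ltr01 R)).

(** The average over [t] is 1 - sin u / u.  A single value of 1 - cos (t u) may
    vanish for large [u], while the average stays bounded below. *)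
Lemma average_one_sub_cos u :
  ((Num.min (u ^+ 2) 1)%:E <= 24%:E * \int[unif]_t (1 - cos (t * u))%:E)%E.
Proof.
have mf : measurable_fun [set: R] (fun t => (1 - cos (t * u))%:E).
  apply/measurable_EFinP/measurable_funB => //.
  apply: (measurableT_comp (f := @cos R)); last exact: measurable_funM.
  exact: continuous_measurable_fun (@continuous_cos R).
rewrite integral_uniform => [| |]; last 2 first.
  - exact: mf.
  - by move=> t; rewrite lee_fin one_sub_cos_ge0.
rewrite subr0 invr1 mul1e.
have [u2|u2] := leP `|u| 2.
 (* The integral of t^2 u^2 / 8 is u^2 / 24, whence the constant. *)
  apply: (@le_trans _ _ (24%:E * \int[leb]_(t in `[0%R, 1%R]) (t ^+ 2 * (u ^+ 2 / 8))%:E)%E).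
    have dF (t : R) : is_derive t 1 (fun t : R => t ^+ 3 * (u ^+ 2 / 24)) (t ^+ 2 * (u ^+ 2 / 8)).
      by apply: is_derive_eq; rewrite /GRing.scale/=; field.
    have cF : continuous (fun t : R => t ^+ 3 * (u ^+ 2 / 24)).
      by move=> t; apply: differentiable_continuous; apply/derivable1_diffP; exact: ex_derive.
    rewrite (@continuous_FTC2 _ _ (fun t : R => t ^+ 3 * (u ^+ 2 / 24)))//.
    - rewrite -EFinB -EFinM lee_fin ge_min; apply/orP; left.
      by rewrite expr1n expr0n/=; lra.
    - apply: continuous_subspaceT => t; apply: differentiable_continuous.
      by apply/derivable1_diffP; exact: ex_derive.
    - split; [by move=> t _; exact: ex_derive|exact/cvg_at_right_filter/cF|exact/cvg_at_left_filter/cF].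
    - by move=> t _; rewrite derive1E derive_val.
  rewrite lee_wpmul2l ?lee_fin//; apply: ge0_le_integral => //.
  - move=> t _; rewrite lee_fin mulr_ge0 ?sqr_ge0// divr_ge0 ?sqr_ge0//.
  - apply/measurable_EFinP; apply: measurable_funM => //; exact: measurable_funX.
  - by apply: measurable_funTS.
  - move=> t /=; rewrite in_itv/= => /andP[t0 t1]; rewrite lee_fin.
    rewrite mulrA -exprMn; apply: one_sub_cos_ge_sqr.
    by rewrite normrM (ger0_norm t0) (le_trans _ u2)// ler_piMl.
(* For |u| > 2 the average is at least 1/2. *)
have u0 : u != 0 by rewrite -normr_gt0; lra.
have dF (t : R) : is_derive t 1 (fun t : R => t - sin (t * u) * u^-1) (1 - cos (t * u)).
  by apply: is_derive_eq; rewrite /GRing.scale/=; field.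
have cF : continuous (fun t : R => t - sin (t * u) * u^-1).
  by move=> t; apply: differentiable_continuous; apply/derivable1_diffP; exact: ex_derive.
rewrite (@continuous_FTC2 _ _ (fun t : R => t - sin (t * u) * u^-1))//.
- rewrite -EFinB -EFinM lee_fin.
  rewrite mul0r sin0 mul0r subr0 subr0 mul1r.
  rewrite (le_trans (_ : _ <= 1)) ?ge_min ?lexx ?orbT//.
  have : sin u / u <= 1 / 2.
    rewrite (le_trans (ler_norm _))// normrM normfV ler_pdivrMr; last by lra.
    by rewrite (le_trans (sin_max _))//; lra.
  lra.
- apply: continuous_subspaceT => t; apply: differentiable_continuous.
  by apply/derivable1_diffP; exact: ex_derive.
- split; [by move=> t _; exact: ex_derive|exact/cvg_at_right_filter/cF|exact/cvg_at_left_filter/cF].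
- by move=> t _; rewrite derive1E derive_val.
Qed.

End trigonometric_bounds.

Section truncated_moment.
Context {R : realType}.
Local Open Scope ereal_scope.
Local Notation unif := (uniform_prob (@ltr01 R)).

Lemma integral_unif_le (g : R -> \bar R) (C : \bar R) :
  measurable_fun [set: R] g -> (forall t, 0 <= g t) ->
  (forall t : R, (0 <= t <= 1)%R -> g t <= C) -> \int[unif]_t g t <= C.
Proof.
move=> mg g0 gC; rewrite integral_uniform// subr0 invr1 mul1e.
apply: (@le_trans _ _ (\int[lebesgue_measure]_(t in `[0%R, 1%R]) C)).
  by apply: ge0_le_integral => //; exact: measurable_funTS mg.
rewrite integral_cst//= lebesgue_measure_itv/= lte_fin ltr01 -EFinB subr0 mule1.
exact: lexx.
Qed.

Let one_sub_cos_fin_ge0 (x : R) : 0 <= (1 - cos x)%:E.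
Proof. by rewrite lee_fin one_sub_cos_ge0. Qed.

Lemma measurable_one_sub_cos_comp d (T : measurableType d) (v : T -> R) :
  measurable_fun [set: T] v ->
  measurable_fun [set: T] (fun x => (1 - cos (v x))%:E).
Proof.
move=> mv; apply/measurable_EFinP/measurable_funB => //.
apply: (measurableT_comp (f := @cos R)) => //.
exact: continuous_measurable_fun (@continuous_cos R).
Qed.

Lemma measurable_min_sqr d (T : measurableType d) (v : T -> R) :
  measurable_fun [set: T] v ->
  measurable_fun [set: T] (fun x => (Num.min (v x ^+ 2) 1)%:E).
Proof.
move=> mv; apply/measurable_EFinP; apply: measurable_minr => //.
exact: measurable_funX.
Qed.

Lemma integral_min_sqr_le_average d (T : measurableType d)
    (m : {sigma_finite_measure set T -> \bar R}) (u : T -> R) :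
  measurable_fun [set: T] u ->
  \int[m]_x (Num.min (u x ^+ 2) 1)%:E <=
  24%:E * \int[unif]_t \int[m]_x (1 - cos (t * u x))%:E.
Proof.
move=> mu.
have mf : measurable_fun [set: T * R] (fun p : T * R => (1 - cos (p.2 * u p.1))%:E).
  apply: measurable_one_sub_cos_comp; apply: measurable_funM => //.
  exact: (measurableT_comp mu).
have f0 (p : T * R) : 0 <= (1 - cos (p.2 * u p.1))%:E by [].
have mF := measurable_fun_fubini_tonelli_F (m2 := unif) _ mf f0.
apply: (@le_trans _ _ (\int[m]_x (24%:E * \int[unif]_t (1 - cos (t * u x))%:E))).
  apply: ge0_le_integral => //.
  - by move=> x _; rewrite lee_fin le_min sqr_ge0 ler01.
  - exact: measurable_min_sqr.
  - exact: measurable_funeM.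
  - by move=> x _; exact: average_one_sub_cos.
rewrite ge0_integralZl//; last first.
  by move=> x _; apply: integral_ge0 => t _; exact: f0 (x, t).
by rewrite (fubini_tonelli (m1 := m) (m2 := unif) _ mf f0).
Qed.

(** Values of a characteristic function near the origin control a truncated
    second moment: Tonelli's theorem exchanges [m] with the average over [t]. *)
Lemma integral_min_sqr_le d (T : measurableType d)
    (m : {sigma_finite_measure set T -> \bar R}) (u : T -> R) (C : \bar R) :
  measurable_fun [set: T] u ->
  (forall t : R, (0 <= t <= 1)%R -> \int[m]_x (1 - cos (t * u x))%:E <= C) ->
  \int[m]_x (Num.min (u x ^+ 2) 1)%:E <= 24%:E * C.
Proof.
move=> mu hC; apply: (le_trans (integral_min_sqr_le_average m mu)).
rewrite lee_wpmul2l ?lee_fin//; apply: integral_unif_le => //.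
- apply: (measurable_fun_fubini_tonelli_G (m1 := m)
    (fun p : T * R => (1 - cos (p.2 * u p.1))%:E)) => //.
  apply: measurable_one_sub_cos_comp; apply: measurable_funM => //.
  exact: (measurableT_comp mu).
- by move=> t; exact: integral_ge0.
Qed.

(** The average over [t] has to cross two integrals here.  The iterated form
    serves Lebesgue measure in time followed by a Levy measure in space. *)
Lemma iterated_integral_min_sqr_le d1 d2 (T1 : measurableType d1) (T2 : measurableType d2)
    (m1 : {sigma_finite_measure set T1 -> \bar R})
    (m2 : {sigma_finite_measure set T2 -> \bar R}) (u : T1 * T2 -> R) (C : \bar R) :
  measurable_fun [set: T1 * T2] u ->
  (forall t : R, (0 <= t <= 1)%R ->
    \int[m1]_x \int[m2]_y (1 - cos (t * u (x, y)))%:E <= C) ->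
  \int[m1]_x \int[m2]_y (Num.min (u (x, y) ^+ 2) 1)%:E <= 24%:E * C.
Proof.
move=> mu hC.
pose G (p : T1 * R) := \int[m2]_y (1 - cos (p.2 * u (p.1, y)))%:E.
have G0 p : 0 <= G p by exact: integral_ge0.
have mG : measurable_fun [set: T1 * R] G.
  apply: (measurable_fun_fubini_tonelli_F (m2 := m2)
    (fun q : T1 * R * T2 => (1 - cos (q.1.2 * u (q.1.1, q.2)))%:E)) => //.
  apply: measurable_one_sub_cos_comp; apply: measurable_funM.
    exact: (measurableT_comp measurable_snd).
  have m11 : measurable_fun [set: T1 * R * T2] (fun q : T1 * R * T2 => q.1.1).
    by apply: (measurableT_comp measurable_fst); exact: measurable_fst.
  apply: (measurableT_comp mu).
  by apply/measurable_fun_pairP; split; [exact: m11|exact: measurable_snd].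
have mGx x : measurable_fun [set: R] (fun t => G (x, t)) by exact: measurableT_comp.
apply: (@le_trans _ _ (\int[m1]_x (24%:E * \int[unif]_t G (x, t)))).
  apply: ge0_le_integral => //.
  - by move=> x _; apply: integral_ge0 => y _; rewrite lee_fin le_min sqr_ge0 ler01.
  - apply: (measurable_fun_fubini_tonelli_F (m2 := m2)
      (fun p => (Num.min (u p ^+ 2) 1)%:E)); first exact: measurable_min_sqr.
    by move=> p; rewrite lee_fin le_min sqr_ge0 ler01.
  - by apply: measurable_funeM; exact: (measurable_fun_fubini_tonelli_F (m2 := unif)).
  - move=> x _; apply: (integral_min_sqr_le_average m2 (u := fun y => u (x, y))).
    exact: measurableT_comp.
rewrite ge0_integralZl//; last 2 first.
- exact: (measurable_fun_fubini_tonelli_F (m2 := unif)).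
- by move=> x _; exact: integral_ge0.
rewrite lee_wpmul2l ?lee_fin// (fubini_tonelli (m1 := m1) (m2 := unif) _ mG G0).
apply: integral_unif_le => //.
- exact: (measurable_fun_fubini_tonelli_G (m1 := m1)).
- by move=> t; exact: integral_ge0.
Qed.

End truncated_moment.

(** * Characteristic functions and independence *)

Lemma measurable_cos {R : realType} : measurable_fun [set: R] (@cos R).
Proof. exact: continuous_measurable_fun (@continuous_cos R). Qed.

Lemma measurable_sin {R : realType} : measurable_fun [set: R] (@sin R).
Proof. exact: continuous_measurable_fun (@continuous_sin R). Qed.

Section expectation.
Context {R : realType} {disp : measure_display} {Omega : measurableType disp}
  (P : probability Omega R).
Implicit Types U V W : Omega -> R.

Definition Ex (f : Omega -> R) : R := Rintegral P setT f.

Lemma bounded_integrable (f : Omega -> R) (M : R) :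
  measurable_fun [set: Omega] f -> (forall w, `|f w| <= M) ->
  P.-integrable setT (EFin \o f).
Proof.
move=> mf fM; apply: measurable_bounded_integrable => //.
  by rewrite (le_lt_trans (probability_le1 P measurableT))// ltry.
exists M; split; first exact: num_real.
by move=> x Mx w _ /=; rewrite (le_trans (fM w))// ltW.
Qed.

Lemma Ex_EFin (f : Omega -> R) : P.-integrable setT (EFin \o f) ->
  (\int[P]_w (f w)%:E)%E = (Ex f)%:E.
Proof. by move=> fi; rewrite /Ex /Rintegral fineK//; exact: integrable_fin_num. Qed.

Lemma integrable_cos U : measurable_fun [set: Omega] U ->
  P.-integrable setT (EFin \o (fun w => cos (U w))).
Proof.
move=> mU; apply: (bounded_integrable (M := 1)).
  exact: (measurableT_comp measurable_cos).
by move=> w; exact: cos_max.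
Qed.

Lemma Ex_one_sub_cos U : measurable_fun [set: Omega] U ->
  (\int[P]_w (1 - cos (U w))%:E)%E = (1 - Ex (fun w => cos (U w)))%:E.
Proof.
move=> mU; under eq_integral do rewrite EFinB.
rewrite integralB_EFin//; last exact: integrable_cos.
- rewrite integral_cst//=; set p := (P _); rewrite (_ : p = 1%E) ?mule1 ?EFinB; last exact: probability_setT; congr (_ - _)%E.
  by rewrite Ex_EFin//; exact: integrable_cos.
- by apply: (bounded_integrable (M := 1)) => // w; rewrite normr1.
Qed.

Definition independent U V := forall E F : set R, measurable E -> measurable F ->
  P (U @^-1` E `&` V @^-1` F) = (P (U @^-1` E) * P (V @^-1` F))%E.

(** The joint law is the product of the marginal laws, since the two agree on
    rectangles; Fubini's theorem then factors the integral. *)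
Lemma Ex_mul_independent U V (h k : R -> R) :
  measurable_fun [set: Omega] U -> measurable_fun [set: Omega] V ->
  measurable_fun [set: R] h -> measurable_fun [set: R] k ->
  (forall x, `|h x| <= 1) -> (forall x, `|k x| <= 1) ->
  independent U V ->
  Ex (fun w => h (U w) * k (V w)) = Ex (fun w => h (U w)) * Ex (fun w => k (V w)).
Proof.
move=> mU mV mh mk h1 k1 UV.
pose U' : {mfun Omega >-> R} := HB.pack U (isMeasurableFun.Build _ _ _ _ _ mU).
pose V' : {mfun Omega >-> R} := HB.pack V (isMeasurableFun.Build _ _ _ _ _ mV).
have mW : measurable_fun [set: Omega] (fun w => (U w, V w)).
  exact/measurable_fun_pairP.
pose W' : {mfun Omega >-> (R * R)%type} := HB.pack (fun w => (U w, V w)) (isMeasurableFun.Build _ _ _ _ _ mW).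
have hk1 x y : `|h x * k y| <= 1 by rewrite normrM mulr_ile1.
have mhk : measurable_fun [set: R * R] (fun p : R * R => h p.1 * k p.2).
  by apply: measurable_funM; apply: measurableT_comp.
have ih : P.-integrable setT (EFin \o (fun w => h (U w))).
  by apply: (bounded_integrable (M := 1)) => //; exact: measurableT_comp.
have ik : P.-integrable setT (EFin \o (fun w => k (V w))).
  by apply: (bounded_integrable (M := 1)) => //; exact: measurableT_comp.
have ihk : P.-integrable setT (EFin \o (fun w => h (U w) * k (V w))).
  apply: (bounded_integrable (M := 1)) => //.
  by apply: measurable_funM => //; exact: measurableT_comp.
apply: EFin_inj; rewrite -(Ex_EFin ihk) EFinM -(Ex_EFin ih) -(Ex_EFin ik).
have := integral_distribution (P := P) (X := W') (f := fun p => (h p.1 * k p.2)%:E).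
rewrite /comp/= => <- //; last exact/measurable_EFinP.
have -> : (\int[distribution P W']_p (h p.1 * k p.2)%:E =
   \int[distribution P U' \x distribution P V']_p (h p.1 * k p.2)%:E)%E.
  apply: eq_measure_integral => A mA _; apply/esym.
  exact: product_measure_unique.
have := integral_distribution (P := P) (X := U') (f := fun p => (h p)%:E).
rewrite /comp/= => <- //; last exact/measurable_EFinP.
have := integral_distribution (P := P) (X := V') (f := fun p => (k p)%:E).
rewrite /comp/= => <- //; last exact/measurable_EFinP.
have kV : (distribution P V').-integrable setT (EFin \o k).
  apply: measurable_bounded_integrable => //.
    by rewrite (le_lt_trans (probability_le1 (distribution P V') measurableT))// ltry.
  by exists 1; split => // x x1 y _ /=; rewrite (le_trans (k1 y))// ltW.
have hU : (distribution P U').-integrable setT (EFin \o h).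
  apply: measurable_bounded_integrable => //.
    by rewrite (le_lt_trans (probability_le1 (distribution P U') measurableT))// ltry.
  by exists 1; split => // x x1 y _ /=; rewrite (le_trans (h1 y))// ltW.
rewrite -integral12_prod_meas1; last first.
  apply: measurable_bounded_integrable => //.
    have : ((distribution P U' \x distribution P V') setT < +oo)%E; last by [].
    rewrite -setXTT product_measure1E//; apply: lte_mul_pinfty => //.
      by rewrite ge0_fin_numE// (le_lt_trans (probability_le1 (distribution P U') measurableT))// ltry.
    by rewrite (le_lt_trans (probability_le1 (distribution P V') measurableT))// ltry.
  by exists 1; split => // x x1 y _ /=; rewrite (le_trans (hk1 _ _))// ltW.
rewrite /fubini_F/=.
under eq_integral => x _.
  under eq_integral do rewrite EFinM.
  rewrite integralZl//.
  over.
rewrite -(fineK (integrable_fin_num measurableT kV)).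
by rewrite integralZr.
Qed.

(** As functions of [A] both sides are finite measures, and they agree on a
    generating pi-system. *)
Lemma independent_sigma (G : set_system Omega) (V : set Omega) :
  G `<=` measurable -> setI_closed G -> G setT -> measurable V ->
  (forall A, G A -> P (A `&` V) = (P A * P V)%E) ->
  forall A, <<s G >> A -> P (A `&` V) = (P A * P V)%E.
Proof.
move=> Gm GI GT mV PG A GA.
have PV0 : 0 <= fine (P V) by rewrite fine_ge0.
(* The constant P V as a nonnegative multiple of P, a measure in A. *)
pose m2 := mscale (NngNum PV0) P.
have m2E B : m2 B = (P B * P V)%E.
  by rewrite /m2 /mscale/= fineK ?fin_num_measure// muleC.
have := @g_sigma_algebra_measure_unique _ _ _ G Gm (fun=> setT) (fun=> GT) _ (mrestr P mV) m2.
rewrite bigcup_const//= => h; rewrite -m2E; apply: h => //.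
- by move=> B GB; rewrite -/m2 m2E; exact: PG.
- by move=> _; rewrite /mrestr setTI (le_lt_trans (probability_le1 _ _))// ltry.
Qed.

Definition mutually_independent n (U : 'I_n -> Omega -> R) :=
  forall E : 'I_n -> set R, (forall i, measurable (E i)) ->
  P (\bigcap_i (U i @^-1` E i)) = (\prod_i P (U i @^-1` E i))%E.

Lemma mutually_independent_recr n (U : 'I_n.+1 -> Omega -> R) :
  mutually_independent U ->
  forall (E : 'I_n -> set R) (F : set R),
  (forall i, measurable (E i)) -> measurable F ->
  P (\bigcap_i (U (widen_ord (leqnSn n) i) @^-1` E i) `&` U ord_max @^-1` F) =
  ((\prod_(i < n) P (U (widen_ord (leqnSn n) i) @^-1` E i)) *
   P (U ord_max @^-1` F))%E.
Proof.
move=> Uind E F mE mF.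
(* The conditions on the first n variables, completed by F for the last. *)
pose E' (i : 'I_n.+1) := if unlift ord_max i is Some j then E j else F.
have lw (j : 'I_n) : lift ord_max j = widen_ord (leqnSn n) j.
  by apply: val_inj; rewrite /= /bump leqNgt ltn_ord.
have E'w j : E' (widen_ord (leqnSn n) j) = E j by rewrite /E' -lw liftK.
have E'm : E' ord_max = F by rewrite /E' unlift_none.
have := Uind E'; rewrite big_ord_recr/= E'm.
under eq_bigr do rewrite E'w.
move=> <-; last by move=> i; rewrite /E'; case: unliftP.
congr (P _); rewrite eqEsubset; split => w.
- move=> [wE wF] i _; rewrite /= /E'; case: unliftP => [j ->|->//].
  by rewrite lw; exact: wE.
- move=> h; split; last by have := h ord_max Logic.I; rewrite /= E'm.
  by move=> j _; have := h (widen_ord (leqnSn n) j) Logic.I; rewrite /= E'w.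
Qed.

Lemma mutually_independent_widen n (U : 'I_n.+1 -> Omega -> R) :
  mutually_independent U ->
  mutually_independent (fun i : 'I_n => U (widen_ord (leqnSn n) i)).
Proof.
move=> /mutually_independent_recr Uind E mE.
have := Uind E setT mE measurableT.
by rewrite preimage_setT setIT probability_setT mule1.
Qed.

(** The partial sum is measurable for the sigma-algebra generated by the events
    that fix a range for each of the first [n] variables, and those events form
    a pi-system independent of the last variable. *)
Lemma mutually_independent_sum n (U : 'I_n.+1 -> Omega -> R) :
  (forall i, measurable_fun [set: Omega] (U i)) -> mutually_independent U ->
  independent (fun w => \sum_(i < n) U (widen_ord (leqnSn n) i) w) (U ord_max).
Proof.
move=> mU Uind E F mE mF.
pose W (i : 'I_n) := U (widen_ord (leqnSn n) i).
pose G : set_system Omega := [set A | exists2 E : 'I_n -> set R,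
  (forall i, measurable (E i)) & A = \bigcap_i (W i @^-1` E i)].
have mpre (V : Omega -> R) (B : set R) :
    measurable_fun setT V -> measurable B -> measurable (V @^-1` B).
  by move=> mV mB; rewrite -[X in measurable X]setTI; exact: mV.
have Gm : G `<=` measurable.
  move=> _ [E' mE' ->]; apply: fin_bigcap_measurable => // i _.
  by apply: mpre => //; exact: mU.
apply: (independent_sigma (G := G)) => //.
- move=> _ _ [E1 mE1 ->] [E2 mE2 ->]; exists (fun i => E1 i `&` E2 i).
    by move=> i; exact: measurableI.
  by rewrite -bigcapI; apply: eq_bigcapr => i _; rewrite preimage_setI.
- exists (fun=> setT) => //.
  by rewrite [RHS](_ : _ = \bigcap_(i : 'I_n) setT) ?bigcapT// ; apply: eq_bigcapr => i _; rewrite preimage_setT.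
- exact: mpre.
- move=> _ [E' mE' ->]; rewrite (mutually_independent_recr Uind)//.
  by have /(_ E' mE') -> := mutually_independent_widen Uind.
- have : measurable_fun [set: g_sigma_algebraType G]
      (fun w => \sum_(i < n) W i w).
    apply: measurable_sum => i _ B mB; rewrite setTI.
    apply: sub_sigma_algebra; exists (fun j => if j == i then B else setT).
      by move=> j; case: ifP.
    rewrite eqEsubset; split => w.
      by move=> /= wB j _ /=; case: ifPn => // /eqP ->.
    by move=> /(_ i Logic.I)/=; rewrite eqxx.
  by move=> /(_ measurableT E mE); rewrite setTI.
Qed.

Lemma Ex_ae U V : measurable_fun [set: Omega] U -> measurable_fun [set: Omega] V ->
  {ae P, forall w, U w = V w} -> Ex U = Ex V.
Proof.
move=> mU mV UV; rewrite /Ex /Rintegral; congr fine; apply: ae_eq_integral => //.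
- exact/measurable_EFinP.
- exact/measurable_EFinP.
- by apply: filterS UV => w /= -> _.
Qed.

(** The characteristic function at 1 of a real variable; its other values are
    those of the multiples of the variable. *)
Definition chf U : R[i] := Ex (fun w => cos (U w)) +i* Ex (fun w => sin (U w)).

Lemma chf_ae U V : measurable_fun [set: Omega] U -> measurable_fun [set: Omega] V ->
  {ae P, forall w, U w = V w} -> chf U = chf V.
Proof.
move=> mU mV UV; rewrite /chf (@Ex_ae (cos \o U) (cos \o V)); last 3 first.
- exact: (measurableT_comp measurable_cos).
- exact: (measurableT_comp measurable_cos).
- by apply: filterS UV => w /= ->.
rewrite (@Ex_ae (sin \o U) (sin \o V))//.
- exact: (measurableT_comp measurable_sin).
- exact: (measurableT_comp measurable_sin).
- by apply: filterS UV => w /= ->.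
Qed.

Lemma chf0 : chf (fun=> 0) = 1.
Proof.
rewrite /chf /Ex !Rintegral_cst//= sin0 cos0 mul0r mul1r.
by set p := (P _); rewrite (_ : p = 1%E)//; exact: probability_setT.
Qed.

Section product_formulas.
Variables U V : Omega -> R.
Hypotheses (mU : measurable_fun [set: Omega] U) (mV : measurable_fun [set: Omega] V).
Hypothesis UV : independent U V.
Let mcos := @measurable_cos R.
Let msin := @measurable_sin R.

Let imul (h k : R -> R) : measurable_fun [set: R] h -> measurable_fun [set: R] k ->
  (forall x, `|h x| <= 1) -> (forall x, `|k x| <= 1) ->
  P.-integrable setT (EFin \o (fun w => h (U w) * k (V w))).
Proof.
move=> mh mk h1 k1; apply: (bounded_integrable (M := 1)).
  by apply: measurable_funM; apply: measurableT_comp.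
by move=> w; rewrite normrM mulr_ile1.
Qed.

Lemma Ex_cosB : Ex (fun w => cos (U w - V w)) =
  Ex (fun w => cos (U w)) * Ex (fun w => cos (V w)) +
  Ex (fun w => sin (U w)) * Ex (fun w => sin (V w)).
Proof.
under [in LHS]eq_fun do rewrite cosB.
rewrite -!Ex_mul_independent//; try by move=> x; rewrite ?cos_max ?sin_max.
by rewrite /Ex RintegralD//; apply: imul => // x; rewrite ?cos_max ?sin_max.
Qed.

Lemma chf_add : chf (fun w => U w + V w) = chf U * chf V.
Proof.
have b1 (x : R) := cos_max x; have b2 (x : R) := sin_max x.
apply/eqP; rewrite eq_complex /=; apply/andP; split; apply/eqP.
- under [in LHS]eq_fun do rewrite cosD.
  rewrite -!Ex_mul_independent//.
  by rewrite /Ex RintegralB//; apply: imul.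
- under [in LHS]eq_fun do rewrite sinD.
  rewrite -!Ex_mul_independent// addrC.
  by rewrite /Ex -RintegralD//; apply: imul.
Qed.

End product_formulas.

(** Subtracting an independent variable with the same characteristic function
    leaves the squared modulus: the phases cancel. *)
Lemma Ex_cosB_same U V : measurable_fun [set: Omega] U -> measurable_fun [set: Omega] V ->
  independent U V -> chf U = chf V ->
  Ex (fun w => cos (U w - V w)) = complex.Re (chf U) ^+ 2 + complex.Im (chf U) ^+ 2.
Proof. by move=> mU mV UV [e1 e2]; rewrite Ex_cosB// -e1 -e2 !expr2. Qed.

Lemma chf_sum n (U : 'I_n -> Omega -> R) :
  (forall i, measurable_fun [set: Omega] (U i)) -> mutually_independent U ->
  chf (fun w => \sum_(i < n) U i w) = \prod_(i < n) chf (U i).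
Proof.
elim: n U => [|n IH] U mU Uind.
  by rewrite big_ord0 -chf0; congr chf; apply/funext => w; rewrite big_ord0.
rewrite big_ord_recr/= -IH//; last exact: mutually_independent_widen.
rewrite -chf_add//; last 2 first.
- by apply: measurable_sum => i; exact: mU.
- exact: mutually_independent_sum.
by congr chf; apply/funext => w; rewrite big_ord_recr.
Qed.

Lemma cvg_Ex (f_ : nat -> Omega -> R) (f : Omega -> R) M :
  (forall n, measurable_fun [set: Omega] (f_ n)) -> measurable_fun [set: Omega] f ->
  (forall n w, `|f_ n w| <= M) ->
  {ae P, forall w, f_ ^~ w @ \oo --> f w} ->
  Ex (f_ n) @[n --> \oo] --> Ex f.
Proof.
move=> mf_ mf fM f_f.
have [|||||int_f _ h] := @dominated_convergence _ _ _ P setT measurableT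
  (fun n w => (f_ n w)%:E) (fun w => (f w)%:E) (fun=> M%:E).
- by move=> n; exact/measurable_EFinP.
- exact/measurable_EFinP.
- by apply: filterS f_f => w /= fw _; exact/cvg_EFin/fw/nearW.
- by apply: (bounded_integrable (M := `|M|)).
- by apply: aeW => w n _; rewrite lee_fin.
apply: fine_cvg; rewrite -(Ex_EFin int_f); exact: h.
Qed.

Lemma cvg_Ex_cos (U_ : nat -> Omega -> R) (U : Omega -> R) :
  (forall n, measurable_fun [set: Omega] (U_ n)) -> measurable_fun [set: Omega] U ->
  {ae P, forall w, U_ ^~ w @ \oo --> U w} ->
  Ex (fun w => cos (U_ n w)) @[n --> \oo] --> Ex (fun w => cos (U w)).
Proof.
move=> mU_ mU UU; apply: (cvg_Ex (M := 1)).
- by move=> n; exact: (measurableT_comp measurable_cos).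
- exact: (measurableT_comp measurable_cos).
- by move=> n w; exact: cos_max.
- by apply: filterS UU => w h; apply: (cvg_comp _ _ h); exact: continuous_cos.
Qed.

Lemma cvg_Ex_sin (U_ : nat -> Omega -> R) (U : Omega -> R) :
  (forall n, measurable_fun [set: Omega] (U_ n)) -> measurable_fun [set: Omega] U ->
  {ae P, forall w, U_ ^~ w @ \oo --> U w} ->
  Ex (fun w => sin (U_ n w)) @[n --> \oo] --> Ex (fun w => sin (U w)).
Proof.
move=> mU_ mU UU; apply: (cvg_Ex (M := 1)).
- by move=> n; exact: (measurableT_comp measurable_sin).
- exact: (measurableT_comp measurable_sin).
- by move=> n w; exact: sin_max.
- by apply: filterS UU => w h; apply: (cvg_comp _ _ h); exact: continuous_sin.
Qed.

(** The cosine is bounded and 1-Lipschitz, so closeness in probability is enough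
    and no moment of the variables enters. *)
Lemma Ex_cos_dist U V (e : R) : measurable_fun [set: Omega] U ->
  measurable_fun [set: Omega] V -> 0 <= e ->
  `|Ex (fun w => cos (U w)) - Ex (fun w => cos (V w))| <=
    e + 2 * fine (P [set w | e < `|U w - V w|]).
Proof.
move=> mU mV e0; set A := [set w | _].
have mUV : measurable_fun [set: Omega] (fun w => `|U w - V w|).
  by apply: measurableT_comp => //; exact: measurable_funB.
have mA : measurable A.
  rewrite -[A]setTI; apply: (@measurable_fun_ltr _ _ _ setT (cst e) _) => //.
have iU := integrable_cos mU; have iV := integrable_cos mV.
have iUV : P.-integrable setT (EFin \o (fun w => cos (U w) - cos (V w))).
  apply: (bounded_integrable (M := 2)); last by move=> w; exact: normr_cosB_le2.
  by apply: measurable_funB; apply: (measurableT_comp measurable_cos).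
have iA : P.-integrable setT (EFin \o (\1_A : _ -> R)).
  by apply: integrable_indic => //; rewrite (le_lt_trans (probability_le1 P mA))// ltry.
have ie : P.-integrable setT (EFin \o (fun=> e : R)).
  exact: (bounded_integrable (M := `|e|)).
have i2A : P.-integrable setT (EFin \o (fun w => 2 * (\1_A w : R))).
  by have := integrableZl measurableT 2 iA.
rewrite /Ex -RintegralB//; apply: (le_trans (le_normr_Rintegral _ _)) => //.
apply: (@le_trans _ _ (\int[P]_w (e + 2 * \1_A w))).
  apply: le_Rintegral => //.
  - exact: (integrable_norm iUV).
  - exact: (integrableD measurableT ie i2A).
  move=> w _; have [Aw|Aw] := pselect (A w).
    rewrite indicE mem_set// mulr1 (le_trans (normr_cosB_le2 _ _))//.
    by rewrite lerDr.
  rewrite indicE memNset// mulr0 addr0 (le_trans (normr_cosB_le _ _))//.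
  by rewrite leNgt; exact/negP.
rewrite RintegralD// RintegralZl// Rintegral_cst//=.
rewrite lerD//; first by set p := (P _); rewrite (_ : p = 1%E) ?mulr1//; exact: probability_setT.
by rewrite /Rintegral integral_indic// setIT.
Qed.

End expectation.

Section complex_exponential.
Context {R : realType}.
Implicit Types v w : R[i].

Lemma cexpD v w : cexp (v + w) = cexp v * cexp w.
Proof.
case: v => a b; case: w => c e; rewrite /cexp /= expRD cosD sinD.
by apply/eqP; rewrite eq_complex /=; apply/andP; split; apply/eqP; ring.
Qed.

Lemma cexp0 : cexp 0 = 1 :> R[i].
Proof. by rewrite /cexp /= expR0 cos0 sin0 mul1r. Qed.

Lemma cexp_normE w :
  complex.Re (cexp w) ^+ 2 + complex.Im (cexp w) ^+ 2 = expR (2 * complex.Re w).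
Proof.
case: w => a b; rewrite /cexp /= !mul0r subr0 addr0.
by rewrite !exprMn -mulrDr cos2Dsin2 mulr1 expr2 -expRD mulr_natl mulr2n.
Qed.

Lemma cexp_neq0 w : cexp w != 0.
Proof.
apply/eqP => w0; have := cexp_normE w; rewrite w0 /= expr0n addr0 => /esym/eqP.
by rewrite gt_eqF// expR_gt0.
Qed.

End complex_exponential.

(** * Row vectors, and random measures as finitely additive set functions *)

Section row_vectors.
Context {R : realType} {d : nat}.
Implicit Types x y z : 'rV[R]_d.

Lemma measurable_coord i : measurable_fun [set: 'rV[R]_d] (fun x : 'rV[R]_d => x 0 i).
Proof.
move=> _ B mB; rewrite setTI; apply: sub_sigma_algebra.
by exists 0, i, B.
Qed.

Lemma measurable_rV {disp} {T : measurableType disp} (f : T -> 'rV[R]_d) :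
  (forall i, measurable_fun [set: T] (fun w => f w 0 i)) ->
  measurable_fun [set: T] f.
Proof.
move=> mf; apply: (measurability
  [set U | exists i j (B : set R),
        measurable B /\ U = (fun M : 'rV[R]_d => M i j) @^-1` B]) => //.
move=> _ [_ [i [j [B [mB ->]]]] <-]; rewrite (ord1 i).
exact: (mf j measurableT B mB).
Qed.

Lemma innerC x y : inner x y = inner y x.
Proof. by apply: eq_bigr => i _; rewrite mulrC. Qed.

Lemma innerDr z x y : inner z (x + y) = inner z x + inner z y.
Proof. by rewrite -big_split; apply: eq_bigr => i _; rewrite mxE mulrDr. Qed.

Lemma innerZr (r : R) z x : inner z (r *: x) = r * inner z x.
Proof. by rewrite [RHS]mulr_sumr; apply: eq_bigr => i _; rewrite mxE mulrCA. Qed.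

Lemma innerZl (r : R) z x : inner (r *: z) x = r * inner z x.
Proof. by rewrite innerC innerZr innerC. Qed.

Lemma innerNr z x : inner z (- x) = - inner z x.
Proof. by rewrite -scaleN1r innerZr mulN1r. Qed.

Lemma innerBr z x y : inner z (x - y) = inner z x - inner z y.
Proof. by rewrite innerDr innerNr. Qed.

Lemma inner0r z : inner z 0 = 0.
Proof. by rewrite -(scale0r 0) innerZr mul0r. Qed.

Lemma inner0l z : inner 0 z = 0.
Proof. by rewrite innerC inner0r. Qed.

Lemma inner_sumr I (s : seq I) (Q : pred I) z (F : I -> 'rV[R]_d) :
  inner z (\sum_(i <- s | Q i) F i) = \sum_(i <- s | Q i) inner z (F i).
Proof. by apply: (big_morph (inner z)); [exact: innerDr|exact: inner0r]. Qed.

Lemma inner_suml I (s : seq I) (Q : pred I) z (F : I -> 'rV[R]_d) :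
  inner (\sum_(i <- s | Q i) F i) z = \sum_(i <- s | Q i) inner (F i) z.
Proof. by rewrite innerC inner_sumr; apply: eq_bigr => i _; rewrite innerC. Qed.

Lemma inner_delta i x : inner (delta_mx 0 i) x = x 0 i.
Proof.
rewrite /inner (bigD1 i)//= !mxE !eqxx mul1r big1 ?addr0// => j ji.
by rewrite mxE (negPf ji) andbF mul0r.
Qed.

Lemma measurable_inner z : measurable_fun [set: 'rV[R]_d] (inner z).
Proof.
apply: measurable_sum => i; apply: measurable_funM => //; exact: measurable_coord.
Qed.

Lemma continuous_inner z : continuous (inner z).
Proof.
rewrite /inner.
apply: (@continuous_big R 'I_d +%R 0 xpredT _ 'rV[R]_d) => [|i _].
  by move=> [a b]; apply: cvgD; [exact: cvg_fst|exact: cvg_snd].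
move=> x; apply: (@continuous_comp _ _ _ (fun y : 'rV[R]_d => y 0 i) (fun r => z 0 i * r)).
  exact: coord_continuous.
exact: mulrl_continuous.
Qed.

Lemma enorm_sqr x : enorm x ^+ 2 = \sum_i x 0 i ^+ 2.
Proof.
rewrite /enorm sqr_sqrtr; last by apply: sumr_ge0 => i _; rewrite -expr2 sqr_ge0.
by apply: eq_bigr => i _; rewrite expr2.
Qed.

Lemma enorm_ge0 x : 0 <= enorm x. Proof. exact: sqrtr_ge0. Qed.

Lemma enormN x : enorm (- x) = enorm x.
Proof. by rewrite /enorm innerNr innerC innerNr opprK. Qed.

Lemma coord_le_enorm x i : `|x 0 i| <= enorm x.
Proof.
rewrite -(@ler_pXn2r _ 2) ?nnegrE ?enorm_ge0// real_normK ?num_real//.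
rewrite enorm_sqr (bigD1 i)//= lerDl; apply: sumr_ge0 => j _; exact: sqr_ge0.
Qed.

Lemma norm_inner_le z x : `|inner z x| <= (\sum_i `|z 0 i|) * enorm x.
Proof.
rewrite (le_trans (ler_norm_sum _ _ _))// mulr_suml; apply: ler_sum => i _.
by rewrite normrM ler_wpM2l// coord_le_enorm.
Qed.

Lemma measurable_enorm : measurable_fun [set: 'rV[R]_d] enorm.
Proof.
apply: (measurableT_comp (f := @Num.sqrt R)).
  exact: continuous_measurable_fun (@sqrt_continuous R).
by apply: measurable_sum => i; apply: measurable_funM; exact: measurable_coord.
Qed.

End row_vectors.

Section random_measures.
Context {R : realType} {d : nat} {disp : measure_display}
  {Omega : measurableType disp} (P : probability Omega R)
  (mu : probability 'rV[R]_d R) (X : set R -> Omega -> 'rV[R]_d).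
Hypothesis hX : is_random_measure P mu X.
Implicit Types A B : set R.

Lemma bounded_setP A : bounded_set A <-> exists N : nat, A `<=` `]- N%:R, N%:R].
Proof.
split=> [[M [_ MA]]|[N AN]]; last first.
  exists N%:R; split; first exact: num_real.
  move=> x Nx y /AN/=; rewrite in_itv/= => /andP[yN Ny].
  by rewrite ler_norml (le_trans Ny (ltW Nx)) andbT ltW// (le_lt_trans _ yN)// lerN2 ltW.
exists (Num.truncn (`|M| + 1)).+1 => x Ax.
have xM : `|x| <= `|M| + 1.
  by apply: (MA (`|M| + 1)) => //; rewrite ltr_pwDr// ler_norm.
have := truncnS_gt (`|M| + 1) => /(le_lt_trans xM).
by rewrite ltr_norml => /andP[xN Nx] /=; rewrite in_itv/= xN ltW.
Qed.

Lemma bounded_Borel_sub A B : measurable A -> A `<=` B -> bounded_Borel B ->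
  bounded_Borel A.
Proof.
move=> mA AB [mB /bounded_setP[N BN]]; split => //; apply/bounded_setP.
by exists N; exact: subset_trans BN.
Qed.

Lemma bounded_Borel_itv (p q : R) : bounded_Borel `]p, q]%classic.
Proof.
split => //; apply/bounded_setP.
exists (Num.truncn (`|p| + `|q|)).+1 => x /=; rewrite !in_itv/= => /andP[px xq].
have h := truncnS_gt (`|p| + `|q|).
have hp := ler_norm (- p); rewrite normrN in hp; have hq := ler_norm q.
have p0 := normr_ge0 p; have q0 := normr_ge0 q.
by apply/andP; split; lra.
Qed.

Lemma bounded_Borel_bigcup (I : finType) (A : I -> set R) :
  (forall i, bounded_Borel (A i)) -> bounded_Borel (\bigcup_i A i).
Proof.
move=> bA; split.
  by apply: fin_bigcup_measurable => // i _; case: (bA i).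
have /choice[N AN] : forall i, exists N : nat, A i `<=` `]- N%:R, N%:R].
  by move=> i; apply/bounded_setP; case: (bA i).
apply/bounded_setP; exists (\max_i N i) => x [i _ /AN/=].
rewrite !in_itv/= => /andP[h1 h2]; have NN : (N i <= \max_i N i)%N by exact: leq_bigmax.
rewrite (le_trans h2) ?ler_nat// andbT (le_lt_trans _ h1)//.
by rewrite lerN2 ler_nat.
Qed.

Lemma bounded_Borel0 : bounded_Borel (set0 : set R).
Proof. by rewrite -(set_itvoc0 0); exact: bounded_Borel_itv. Qed.

Lemma bounded_BorelU A B : bounded_Borel A -> bounded_Borel B -> bounded_Borel (A `|` B).
Proof.
move=> [mA /bounded_setP[N AN]] [mB /bounded_setP[M BM]].
split; first exact: measurableU.
apply/bounded_setP; exists (maxn N M) => x [/AN|/BM] /=; rewrite !in_itv/= => /andP[h1 h2].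
  rewrite (le_trans h2) ?ler_nat ?leq_maxl// andbT (le_lt_trans _ h1)//.
  by rewrite lerN2 ler_nat leq_maxl.
rewrite (le_trans h2) ?ler_nat ?leq_maxr// andbT (le_lt_trans _ h1)//.
by rewrite lerN2 ler_nat leq_maxr.
Qed.

Lemma measurable_inner_rm z B : bounded_Borel B ->
  measurable_fun [set: Omega] (fun w => inner z (X B w)).
Proof.
by move=> bB; apply: (measurableT_comp (measurable_inner z)); exact: (rm_measurable hX).
Qed.

(** The empty set repeated is a disjoint family, and a sum of equal terms
    converges only if the terms vanish. *)
Lemma rm_set0 : {ae P, forall w, X set0 w = 0}.
Proof.
have triv0 : trivIset setT (fun _ : nat => (set0 : set R)) by move=> i j _ _ [? []].
have := rm_additive hX (fun _ => bounded_Borel0) triv0.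
rewrite bigcup0// => /(_ bounded_Borel0.2); apply: filterS => w hw.
have h1 : (fun n : nat => (\sum_(k < n) X set0 w) + X set0 w) @ \oo --> X set0 w + X set0 w.
  by apply: cvgD => //; exact: cvg_cst.
have h2 : (fun n : nat => (\sum_(k < n) X set0 w) + X set0 w) @ \oo --> X set0 w.
  rewrite [X in X @ _](_ : _ = (fun n => \sum_(k < n.+1) X set0 w)).
    by rewrite (cvg_shiftS (fun n => \sum_(k < n) X set0 w)).
  by apply/funext => n; rewrite big_ord_recr.
have e : X set0 w + X set0 w = X set0 w.
  exact: (cvg_unique (@norm_hausdorff _ _) h1 h2).
by apply: (addrI (X set0 w)); rewrite e addr0.
Qed.

Lemma rm_additive_nat (F : nat -> set R) n :
  (forall k, bounded_Borel (F k)) -> trivIset setT F ->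
  (forall k, (n <= k)%N -> F k = set0) -> bounded_set (\bigcup_k F k) ->
  {ae P, forall w, X (\bigcup_k F k) w = \sum_(k < n) X (F k) w}.
Proof.
move=> bF tF F0 bU.
have h0 := rm_set0; have hU := rm_additive hX bF tF bU.
apply: filterS2 h0 hU => w X0 hw.
have e k : (n <= k)%N -> \sum_(i < k) X (F i) w = \sum_(i < n) X (F i) w.
  move=> nk; rewrite -!(big_mkord predT (fun i => X (F i) w)) (big_cat_nat (leq0n n) nk)//=.
  rewrite -[RHS]addr0; congr (_ + _); rewrite big_nat_cond big1// => i /andP[/andP[ni _] _].
  by rewrite F0.
have h2 : (fun k : nat => \sum_(i < k) X (F i) w) @ \oo --> \sum_(i < n) X (F i) w.
  apply: cvg_near_cst; exists n => // k /= nk; exact: e.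
exact: (cvg_unique (@norm_hausdorff _ _) hw h2).
Qed.

(** Countable additivity applied to the family completed by empty sets. *)
Lemma rm_additive_fin (I : finType) (A : I -> set R) :
  (forall i, bounded_Borel (A i)) -> trivIset setT A ->
  {ae P, forall w, X (\bigcup_i A i) w = \sum_i X (A i) w}.
Proof.
move=> bA tA.
pose F k : set R := if insub k : option 'I_#|I| is Some j then A (enum_val j) else set0.
have FE (j : 'I_#|I|) : F j = A (enum_val j) by rewrite /F valK.
have FU : \bigcup_k F k = \bigcup_i A i.
  rewrite eqEsubset; split => x [].
    by move=> k _; rewrite /F; case: insubP => // j _ _ Ax; exists (enum_val j).
  by move=> i _ Ax; exists (enum_rank i) => //; rewrite FE enum_rankK.
have bF k : bounded_Borel (F k).
  by rewrite /F; case: insubP => [j _ _|_]; [exact: bA|exact: bounded_Borel0].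
have := @rm_additive_nat F #|I| bF; rewrite FU => h.
have {}h : {ae P, forall w, X (\bigcup_i A i) w = \sum_(k < #|I|) X (F k) w}.
  apply: h.
  - move=> k l _ _; rewrite /F; case: insubP => [k' _ <-|_]; last by case=> ? [].
    case: insubP => [l' _ <-|_]; last by case=> ? [].
    by move=> /(tA _ _ Logic.I Logic.I)/enum_val_inj ->.
  - by move=> k nk; rewrite /F insubN// -leqNgt.
  - by case: (bounded_Borel_bigcup bA).
apply: filterS h => w ->.
rewrite [RHS](reindex_onto (@enum_val I predT) enum_rank)/=; last by move=> i _; rewrite enum_rankK.
by apply: eq_big => [j|j _]; rewrite ?FE// enum_valK eqxx.
Qed.

End random_measures.

(** * The characteristic function of a random measure *)

Section characteristic_function_laws.
Context {R : realType}.

Lemma Ex_law d1 (T1 : measurableType d1) (P1 : probability T1 R)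
    d2 (T2 : measurableType d2) (P2 : probability T2 R)
    (U : T1 -> R) (V : T2 -> R) (h : R -> R) M :
  measurable_fun [set: T1] U -> measurable_fun [set: T2] V ->
  measurable_fun [set: R] h -> (forall x, `|h x| <= M) ->
  (forall E, measurable E -> P1 (U @^-1` E) = P2 (V @^-1` E)) ->
  Ex P1 (fun w => h (U w)) = Ex P2 (fun w => h (V w)).
Proof.
move=> mU mV mh hM UV; rewrite /Ex /Rintegral; congr fine.
have := integral_pushforward mU (mu := P1) (f := EFin \o h) (D := setT).
rewrite preimage_setT => <- //; last 2 first.
- exact/measurable_EFinP.
- by apply: (@bounded_integrable _ _ _ P1 _ M) => //; exact: measurableT_comp.
have := integral_pushforward mV (mu := P2) (f := EFin \o h) (D := setT).
rewrite preimage_setT => <- //; last 2 first.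
- exact/measurable_EFinP.
- by apply: (@bounded_integrable _ _ _ P2 _ M) => //; exact: measurableT_comp.
by apply: eq_measure_integral => A mA _; exact: UV.
Qed.

Lemma chf_law d1 (T1 : measurableType d1) (P1 : probability T1 R)
    d2 (T2 : measurableType d2) (P2 : probability T2 R)
    (U : T1 -> R) (V : T2 -> R) :
  measurable_fun [set: T1] U -> measurable_fun [set: T2] V ->
  (forall E, measurable E -> P1 (U @^-1` E) = P2 (V @^-1` E)) ->
  chf P1 U = chf P2 V.
Proof.
move=> mU mV UV; rewrite /chf.
rewrite (@Ex_law _ _ P1 _ _ P2 U V cos 1)//; [|exact: measurable_cos|exact: cos_max].
by rewrite (@Ex_law _ _ P1 _ _ P2 U V sin 1)//; [exact: measurable_sin|exact: sin_max].
Qed.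

Lemma continuous_chf d1 (T1 : measurableType d1) (P1 : probability T1 R) (U : T1 -> R) :
  measurable_fun [set: T1] U ->
  continuous (fun t : R => complex.Re (chf P1 (fun w => t * U w))) /\
  continuous (fun t : R => complex.Im (chf P1 (fun w => t * U w))).
Proof.
move=> mU; split=> t; apply/(@cvg_nbhsP _ R^o) => u ut /=.
  apply: cvg_Ex_cos => [n||]; [exact: measurable_funM|exact: measurable_funM|].
  by apply: aeW => w; apply: cvgM => //; exact: cvg_cst.
apply: cvg_Ex_sin => [n||]; [exact: measurable_funM|exact: measurable_funM|].
by apply: aeW => w; apply: cvgM => //; exact: cvg_cst.
Qed.

(** A path among the two points 1 and -1 cannot jump. *)
Lemma square_root_one (rho : R -> R[i]) :
  continuous (fun t => complex.Re (rho t)) -> rho 0 = 1 ->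
  (forall t, rho t ^+ 2 = 1) -> rho 1 = 1.
Proof.
move=> crho rho0 rho2.
have rho1 t : rho t = 1 \/ rho t = -1.
  have /eqP := rho2 t; rewrite sqrf_eq1 => /orP[/eqP ->|/eqP ->]; [by left|by right].
have [//|e] := rho1 1; exfalso.
have [||c _ c0] := @IVT R (fun t => complex.Re (rho t)) 0 1 0 ler01.
- exact: continuous_subspaceT.
- by rewrite e rho0 /= ge_min le_max ler01 lerN10 orbT.
by have [h|h] := rho1 c; move: c0; rewrite h/=; lra.
Qed.

(** Taking square roots leaves a sign undetermined.  The quotient of [phi] by
    exp (C / 2) is a continuous path of square roots of one that starts at 1,
    which settles it. *)
Lemma cexp_square_root (phi C : R -> R[i]) :
  continuous (fun t => complex.Re (phi t)) -> continuous (fun t => complex.Im (phi t)) ->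
  continuous (fun t => complex.Re (C t)) -> continuous (fun t => complex.Im (C t)) ->
  phi 0 = 1 -> C 0 = 0 -> (forall t, phi t ^+ 2 = cexp (C t)) ->
  phi 1 = cexp (2^-1%:C * C 1).
Proof.
move=> cphi1 cphi2 cC1 cC2 phi0 C0 phiC.
have h2 : (2^-1%:C + 2^-1%:C : R[i]) = 1.
  rewrite -rmorphD/=; have -> : 2^-1 + 2^-1 = 1 :> R by lra.
  by [].
(* The path of square roots of one. *)
pose rho t := phi t * cexp (- (2^-1%:C * C t)).
have : rho 1 = 1.
  apply: square_root_one.
  - have -> : (fun t => complex.Re (rho t)) = (fun t =>
      complex.Re (phi t) * (expR (- (2^-1 * complex.Re (C t))) * cos (- (2^-1 * complex.Im (C t))))
      - complex.Im (phi t) * (expR (- (2^-1 * complex.Re (C t))) * sin (- (2^-1 * complex.Im (C t))))).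
      apply/funext => t; rewrite /rho /cexp; case: (phi t) => p q; case: (C t) => a b /=.
      by rewrite !mul0r !subr0 !addr0.
    have c1 : continuous (fun t => expR (- (2^-1 * complex.Re (C t)))).
      move=> t; apply: (@continuous_comp _ _ _ (fun t => - (2^-1 * complex.Re (C t))) expR); last exact: continuous_expR.
      by apply: cvgN; apply: cvgM; [exact: cvg_cst|exact: cC1].
    have c2 : continuous (fun t => - (2^-1 * complex.Im (C t))).
      by move=> t; apply: cvgN; apply: cvgM; [exact: cvg_cst|exact: cC2].
    move=> t; apply: cvgB; apply: cvgM; [exact: cphi1| |exact: cphi2|].
      apply: cvgM; first exact: c1.
      by apply: continuous_comp; [exact: c2|exact: continuous_cos].
    apply: cvgM; first exact: c1.
    by apply: continuous_comp; [exact: c2|exact: continuous_sin].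
  - by rewrite /rho phi0 C0 mulr0 oppr0 cexp0 mulr1.
  - move=> t; rewrite /rho exprMn phiC expr2 -!cexpD -opprD -mulrDl h2 mul1r subrr.
    exact: cexp0.
rewrite /rho => e; rewrite -[LHS]mulr1 -cexp0 -(subrr (2^-1%:C * C 1)) addrC cexpD.
by rewrite mulrA e mul1r.
Qed.

End characteristic_function_laws.

Section random_measure_law.
Context {R : realType} {d : nat} {disp : measure_display}
  {Omega : measurableType disp} (P : probability Omega R)
  (mu : probability 'rV[R]_d R) (X : set R -> Omega -> 'rV[R]_d).
Hypothesis hX : is_random_measure P mu X.
Implicit Types (A B : set R) (z : 'rV[R]_d).

Local Notation leb := (@lebesgue_measure R).
Local Notation phi B z := (chf P (fun w => inner z (X B w))).

Lemma chf_rm_sum (I : finType) (A : I -> set R) (z : I -> 'rV[R]_d) :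
  (forall i, bounded_Borel (A i)) -> trivIset setT A ->
  chf P (fun w => \sum_i inner (z i) (X (A i) w)) = \prod_i phi (A i) (z i).
Proof.
move=> bA tA.
have ebij := onW_bij predT (@enum_val_bij I).
rewrite (reindex _ ebij)/=.
rewrite -(chf_sum (P := P) (U := fun j w => inner (z (enum_val j)) (X (A (enum_val j)) w))).
- by congr chf; apply/funext => w; rewrite (reindex _ ebij).
- by move=> j; exact: (measurable_inner_rm hX).
- move=> E mE.
  apply: (rm_independent hX (B := fun j => A (enum_val j))
            (E := fun j => inner (z (enum_val j)) @^-1` E j)) => //.
  + by move=> i j _ _ /(tA _ _ Logic.I Logic.I)/enum_val_inj.
  + by move=> i; rewrite -[X in measurable X]setTI; exact: measurable_inner.
Qed.

Lemma chf_rm_setU A B z : bounded_Borel A -> bounded_Borel B -> A `&` B = set0 ->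
  phi (A `|` B) z = phi A z * phi B z.
Proof.
move=> bA bB AB0.
pose F (b : bool) := if b then A else B.
have bF b : bounded_Borel (F b) by case: b.
have tF : trivIset setT F.
  by move=> [] [] _ _ //= [x]; rewrite ?AB0 1?setIC ?AB0.
have FU : \bigcup_b F b = A `|` B.
  rewrite eqEsubset; split => x [].
  - by move=> [] _ ?; [left|right].
  - by move=> Ax; exists true.
  - by move=> Bx; exists false.
have := chf_rm_sum (fun=> z) bF tF; rewrite big_bool/= => <-.
have hU := rm_additive_fin hX bF tF; rewrite FU in hU.
apply: chf_ae.
- exact/(measurable_inner_rm hX)/bounded_BorelU.
- by apply: measurable_sum => b; exact: (measurable_inner_rm hX).
- by apply: filterS hU => w ->; rewrite inner_sumr.
Qed.

Lemma bounded_Borel_shift B (t : R) : bounded_Borel B ->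
  bounded_Borel [set s + t | s in B].
Proof.
move=> [mB /bounded_setP[N BN]].
have -> : [set s + t | s in B] = (fun s => s - t) @^-1` B.
  rewrite eqEsubset; split => s; first by move=> [u Bu <-] /=; rewrite addrK.
  by move=> /= Bs; exists (s - t) => //; rewrite subrK.
split.
  rewrite -[X in measurable X]setTI.
  by apply: (@measurable_funB _ _ _ setT id (cst t)).
apply/bounded_setP; exists (N + (Num.truncn `|t|).+1)%N => s /BN/=.
rewrite !in_itv/= natrD; have := truncnS_gt `|t|.
have := ler_norm t; have := ler_norm (- t); rewrite normrN => h1 h2 h3 /andP[h4 h5].
by apply/andP; split; lra.
Qed.

Lemma chf_rm_shift B (t : R) z : bounded_Borel B ->
  phi [set s + t | s in B] z = phi B z.
Proof.
move=> bB; apply: chf_law.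
- exact/(measurable_inner_rm hX)/bounded_Borel_shift.
- exact: (measurable_inner_rm hX).
- move=> E mE; apply: (rm_homogeneous hX t (E := inner z @^-1` E) bB).
  by rewrite -[X in measurable X]setTI; exact: measurable_inner.
Qed.

Lemma shift_itv (p q t : R) :
  [set s + t | s in `]p, q]%classic] = `]p + t, q + t]%classic.
Proof.
rewrite eqEsubset; split => s.
  by move=> [u /=] + <-; rewrite !in_itv/= ltrD2r lerD2r.
rewrite /= in_itv/= => h; exists (s - t); last by rewrite subrK.
by rewrite /= in_itv/= ltrBrDr lerBlDr.
Qed.

Lemma chf_rm_itv_shift (p q t : R) z :
  phi `]p + t, q + t]%classic z = phi `]p, q]%classic z.
Proof. by rewrite -shift_itv chf_rm_shift//; exact: bounded_Borel_itv. Qed.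

Lemma chf_rm_itv_split (p q r : R) z : p <= q -> q <= r ->
  phi `]p, r]%classic z = phi `]p, q]%classic z * phi `]q, r]%classic z.
Proof.
move=> pq qr; rewrite -chf_rm_setU; [|exact: bounded_Borel_itv|exact: bounded_Borel_itv|].
  congr chf; apply/funext => w; congr (inner z (X _ w)).
  by rewrite -itv_bndbnd_setU// bnd_simp.
apply/seteqP; split => // s [] /=; rewrite !in_itv/= => /andP[_ sq] /andP[qs _].
by move: qs; rewrite ltNge sq.
Qed.

Lemma chf_rm_unit z : phi `]0, 1]%classic z = char_fun mu z.
Proof.
have -> : char_fun mu z = chf mu (inner z).
  rewrite /char_fun /cintegral /chf /Ex; congr (_ +i* _); apply: eq_Rintegral => x _ /=.
    by rewrite expR0 !mul1r mul0r subr0.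
  by rewrite expR0 !mul1r mul0r addr0.
apply: chf_law.
- exact/(measurable_inner_rm hX)/bounded_Borel_itv.
- exact: measurable_inner.
- move=> E mE; have := rm_law hX 0 (E := inner z @^-1` E); rewrite add0r; apply.
  by rewrite -[X in measurable X]setTI; exact: measurable_inner.
Qed.

Variable C : 'rV[R]_d -> R[i].
Hypothesis hC : is_cumulant mu C.

(** The interval is the union of two halves with equal laws, so the value at one
    half is a square root of the known value; moving along the ray of [z] from
    the origin selects the root. *)
Lemma chf_rm_dyadic n z : phi `]0, 2^-1 ^+ n]%classic z = cexp ((2^-1 ^+ n)%:C * C z).
Proof.
elim: n z => [|n IH] z.
  by rewrite expr0 mul1r chf_rm_unit; case: hC.
have [cRe cIm C0 _] := hC.
pose h : R := 2^-1 ^+ n.+1.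
have hh : h + h = 2^-1 ^+ n by rewrite /h exprS; lra.
have h0 : 0 <= h by rewrite exprn_ge0.
have mU : measurable_fun [set: Omega] (fun w => inner z (X `]0, h]%classic w)).
  exact/(measurable_inner_rm hX)/bounded_Borel_itv.
have [c1 c2] := continuous_chf P mU.
have cz : continuous (fun t : R => t *: z) by exact: scalel_continuous.
have cC1 : continuous (fun t : R => complex.Re (C (t *: z))).
  move=> t; apply: (@cvg_comp _ _ _ (fun t : R => t *: z) (fun x => complex.Re (C x)) _ (nbhs (t *: z))).
    exact: cz.
  exact: cRe.
have cC2 : continuous (fun t : R => complex.Im (C (t *: z))).
  move=> t; apply: (@cvg_comp _ _ _ (fun t : R => t *: z) (fun x => complex.Im (C x)) _ (nbhs (t *: z))).
    exact: cz.
  exact: cIm.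
have := @cexp_square_root R (fun t => chf P (fun w => t * inner z (X `]0, h]%classic w)))
  (fun t => (2^-1 ^+ n)%:C * C (t *: z)) c1 c2.
rewrite scale1r mulrA -rmorphM/= -exprS => <-.
- by congr chf; apply/funext => w; rewrite mul1r.
- move=> t.
  have -> : (fun t => complex.Re ((2^-1 ^+ n)%:C * C (t *: z))) = (fun t => 2^-1 ^+ n * complex.Re (C (t *: z))).
    by apply/funext => s; case: (C _) => a b /=; rewrite mul0r subr0.
  apply: cvgM; first exact: cvg_cst.
  exact: cC1.
- move=> t.
  have -> : (fun t => complex.Im ((2^-1 ^+ n)%:C * C (t *: z))) = (fun t => 2^-1 ^+ n * complex.Im (C (t *: z))).
    by apply/funext => s; case: (C _) => a b /=; rewrite mul0r addr0.
  apply: cvgM; first exact: cvg_cst.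
  exact: cC2.
- by rewrite -(chf0 P); congr chf; apply/funext => w; rewrite mul0r.
- by rewrite scale0r C0 mulr0.
- move=> t; have {1}-> : (fun w => t * inner z (X `]0, h]%classic w)) = (fun w => inner (t *: z) (X `]0, h]%classic w)).
    by apply/funext => w; rewrite innerZl.
  rewrite -IH -hh (@chf_rm_itv_split 0 h (h + h)) ?lerDl// expr2; congr (_ * _).
  by rewrite -{2}(add0r h) chf_rm_itv_shift.
Qed.

Lemma chf_rm_itv_dyadic (x : R) (k n : nat) z :
  phi `]x, x + k%:R * 2^-1 ^+ n]%classic z = cexp ((k%:R * 2^-1 ^+ n)%:C * C z).
Proof.
have h0 : (0 : R) <= 2^-1 ^+ n by rewrite exprn_ge0.
elim: k => [|k IH].
  rewrite mul0r addr0 mul0r cexp0 -(chf0 P); apply: chf_ae => //.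
  - exact/(measurable_inner_rm hX)/bounded_Borel_itv.
  - by rewrite set_itvoc0; apply: filterS (rm_set0 hX) => w ->; rewrite inner0r.
rewrite (@chf_rm_itv_split x (x + k%:R * 2^-1 ^+ n)); last 2 first.
- by rewrite lerDl mulr_ge0.
- by rewrite lerD2l ler_wpM2r// ler_nat.
have e : k.+1%:R * 2^-1 ^+ n = k%:R * 2^-1 ^+ n + 2^-1 ^+ n :> R.
  by rewrite -natr1 mulrDl mul1r.
rewrite IH e rmorphD [in RHS]mulrDl cexpD -chf_rm_dyadic; congr (_ * _).
by rewrite addrA -{1}(add0r (x + _)) [X in `]_, X]]addrC chf_rm_itv_shift.
Qed.

Let half_lt1 : (2^-1 : R) < 1. Proof. lra. Qed.

(** Their traces on an interval with integer end points are the intervals on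
    which halving and adding determine the law of [X]. *)
Definition dyadic_rays : set_system R :=
  [set B | exists (m : int) (n : nat), B = `]-oo, m%:~R * 2^-1 ^+ n]%classic].

Lemma dyadic_rays_setI : setI_closed dyadic_rays.
Proof.
move=> _ _ [m1 [n1 ->]] [m2 [n2 ->]].
have e (x y : R) : `]-oo, x]%classic `&` `]-oo, y]%classic = `]-oo, Num.min x y]%classic.
  by apply/seteqP; split => s /=; rewrite !in_itv/= le_min => // /andP.
rewrite e minEle; case: ifP => _; [by exists m1, n1|by exists m2, n2].
Qed.

(** A closed ray is the intersection of the dyadic closed rays that contain it. *)
Lemma measurable_dyadic_rays : @measurable _ R = <<s dyadic_rays >>.
Proof.
rewrite eqEsubset; split; last first.
  by apply: smallest_sub; [exact: sigma_algebra_measurable|move=> _ [m [n ->]]].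
move=> B mB; have {mB} : <<s (@RGenOInfty.G R) >> B.
  by have /seteqP[h _] := RGenOInfty.measurableE R; exact: h mB.
move: B.
apply: smallest_sub; first exact: smallest_sigma_algebra.
move=> _ [x ->]; rewrite -setCitvl; apply: sigma_algebraC.
(* The least dyadic number of level n above x. *)
pose q n : R := (Num.floor (x * 2 ^+ n) + 1)%:~R * 2^-1 ^+ n.
have n0 n : (0 : R) < 2 ^+ n by rewrite exprn_gt0.
have xq n : x <= q n.
  by rewrite /q exprVn ler_pdivlMr// ltW// floorD1_gt.
have qx n : q n <= x + 2^-1 ^+ n.
  rewrite /q exprVn ler_pdivrMr// mulrDl mulVf ?gt_eqF// intrD lerD2r.
  exact: floor_le.
have -> : `]-oo, x]%classic = \bigcap_n `]-oo, q n]%classic.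
  apply/seteqP; split => y /=.
    by rewrite in_itv/= => yx n _ /=; rewrite in_itv/= (le_trans yx).
  move=> h; rewrite in_itv/=; apply/ler_addgt0Pr => e e0.
  have [n _ ne] : exists2 n, True & 2^-1 ^+ n < e.
    have : (fun n => 2^-1 ^+ n : R) @ \oo --> 0 by apply: cvg_expr; rewrite gtr0_norm.
    move=> /cvgr0Pnorm_lt/(_ _ e0)[n _ /(_ n (leqnn _))]; rewrite ger0_norm ?exprn_ge0// => ?.
    by exists n.
  have := h n Logic.I; rewrite /= in_itv/= => yq.
  by rewrite (le_trans yq)// (le_trans (qx n))// lerD2l ltW.
rewrite -[X in smallest _ _ X]setCK setC_bigcap; apply: sigma_algebraC.
apply: sigma_algebra_bigcup => n; apply: sigma_algebraC; apply: sub_sigma_algebra.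
by exists (Num.floor (x * 2 ^+ n) + 1), n.
Qed.

Lemma lebesgue_itv (p q : R) : p <= q -> leb `]p, q]%classic = (q - p)%:E.
Proof.
rewrite le_eqVlt => /predU1P[->|pq]; first by rewrite set_itvoc0 measure0 subrr.
by rewrite lebesgue_measure_itv/= lte_fin pq EFinB.
Qed.

Definition expected_chf B z : R[i] := cexp ((fine (leb B))%:C * C z).

Lemma lebesgue_bounded_fin B : bounded_Borel B -> leb B \is a fin_num.
Proof.
move=> [mB /bounded_setP[N BN]]; rewrite ge0_fin_numE//.
apply: (@le_lt_trans _ _ (leb `]- N%:R, N%:R]%classic)).
  by apply: le_measure => //; rewrite inE//.
by rewrite lebesgue_itv ?ltry// lerNl (le_trans (_ : _ <= 0)) ?oppr_le0.
Qed.

Lemma expected_chf_setU A B z : bounded_Borel A -> bounded_Borel B -> A `&` B = set0 ->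
  expected_chf (A `|` B) z = expected_chf A z * expected_chf B z.
Proof.
move=> bA bB AB; rewrite /expected_chf measureU//; [|by case: bA|by case: bB].
by rewrite fineD ?lebesgue_bounded_fin// rmorphD mulrDl cexpD.
Qed.

Section window.
Variables (N : nat) (z : 'rV[R]_d).
Let W : set R := `]- N%:R, N%:R]%classic.

Let N0 : (- N%:R : R) <= N%:R.
Proof. by rewrite (le_trans (_ : _ <= 0)) ?oppr_le0. Qed.

Let bW : bounded_Borel W. Proof. exact: bounded_Borel_itv. Qed.

Let bI B : measurable B -> bounded_Borel (B `&` W).
Proof. by move=> mB; apply: (bounded_Borel_sub _ _ bW); [exact: (measurableI _ _ mB bW.1)|exact: subIsetr]. Qed.

Let window_itv (m : int) (n : nat) : - N%:R <= m%:~R * 2^-1 ^+ n :> R ->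
  phi `]- N%:R, m%:~R * 2^-1 ^+ n]%classic z =
  expected_chf `]- N%:R, m%:~R * 2^-1 ^+ n]%classic z.
Proof.
move=> Nq; set q : R := _ * _ in Nq *.
have n0 : (0 : R) < 2^-1 ^+ n by rewrite exprn_gt0.
pose k := m + (N * 2 ^ n)%N%:Z.
have qk : q = - N%:R + k%:~R * 2^-1 ^+ n.
  rewrite /k intrD mulrDl -/q.
  have -> : ((N * 2 ^ n)%N%:Z)%:~R = N%:R * 2 ^+ n :> R by rewrite -pmulrn natrM natrX.
  by rewrite exprVn mulfK ?gt_eqF ?exprn_gt0// addrCA addNr addr0.
have k0 : 0 <= k.
  by have := Nq; rewrite qk lerDl pmulr_lge0// ler0z.
case: k k0 qk => // k _ qk.
rewrite /expected_chf lebesgue_itv// qk -pmulrn chf_rm_itv_dyadic.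
by rewrite addrAC subrr add0r.
Qed.

Let window_set0 : phi set0 z = expected_chf set0 z.
Proof.
rewrite /expected_chf measure0 mul0r cexp0 -(chf0 P); apply: chf_ae => //.
- exact/(measurable_inner_rm hX)/bounded_Borel0.
- by apply: filterS (rm_set0 hX) => w ->; rewrite inner0r.
Qed.

Let window_W : phi W z = expected_chf W z.
Proof.
have := @window_itv N%:Z 0; rewrite expr0 mulr1 -pmulrn; exact.
Qed.

Let window_bigcup (F : nat -> set R) : (forall n, measurable (F n)) ->
  trivIset setT F -> (forall n, phi (F n `&` W) z = expected_chf (F n `&` W) z) ->
  phi (\bigcup_n F n `&` W) z = expected_chf (\bigcup_n F n `&` W) z.
Proof.
move=> mF tF hF.
pose G n := F n `&` W.
have bG n : bounded_Borel (G n) by exact: bI.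
have tG : trivIset setT G by exact: trivIset_setIr.
have GU : \bigcup_n F n `&` W = \bigcup_n G n by rewrite setI_bigcupl.
have bU : bounded_Borel (\bigcup_n G n).
  by rewrite -GU; apply: bI; exact: bigcupT_measurable.
rewrite GU.
pose S n w : R := \sum_(k < n) inner z (X (G k) w).
have mS n : measurable_fun [set: Omega] (S n).
  by apply: measurable_sum => k; exact: (measurable_inner_rm hX).
have hU : {ae P, forall w, S ^~ w @ \oo --> inner z (X (\bigcup_n G n) w)}.
  apply: filterS (rm_additive hX bG tG bU.2) => w hw.
  rewrite [X in X @ _ --> _](_ : _ = inner z \o (fun n => \sum_(k < n) X (G k) w)).
    by apply: (cvg_comp _ _ hw); exact: continuous_inner.
  by apply/funext => n; rewrite /= inner_sumr.
pose s n := \sum_(k < n) fine (leb (G k)).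
have chS n : chf P (S n) = cexp ((s n)%:C * C z).
  have tGn : trivIset setT (fun k : 'I_n => G k).
    by move=> i j _ _ /(tG _ _ Logic.I Logic.I)/ord_inj.
  rewrite (chf_rm_sum (fun=> z) (fun k : 'I_n => bG k) tGn).
  rewrite /s rmorph_sum mulr_suml.
  rewrite (big_morph _ cexpD cexp0); apply: eq_bigr => k _; exact: hF.
have hs : s @ \oo --> fine (leb (\bigcup_n G n)).
  have h := (@measure_semi_sigma_additive _ _ _ leb) _ (fun n => (bG n).1) tG bU.1.
  rewrite (_ : s = fine \o (fun n => \sum_(0 <= i < n) leb (G i))%E).
    by apply: fine_cvg; rewrite fineK ?lebesgue_bounded_fin.
  apply/funext => n /=.
  rewrite big_mkord -sum_fine// => k _; exact: lebesgue_bounded_fin.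
have mU := measurable_inner_rm hX z bU.
have hRe := cvg_Ex_cos mS mU hU; have hIm := cvg_Ex_sin mS mU hU.
have hE : (fun n => expR (s n * complex.Re (C z))) @ \oo --> expR (fine (leb (\bigcup_n G n)) * complex.Re (C z)).
  apply: (@cvg_comp _ _ _ (fun n => s n * complex.Re (C z)) expR _ (nbhs (fine (leb (\bigcup_n G n)) * complex.Re (C z)))); last exact: continuous_expR.
  by apply: cvgM => //; exact: cvg_cst.
have hA : (fun n => s n * complex.Im (C z)) @ \oo --> fine (leb (\bigcup_n G n)) * complex.Im (C z).
  by apply: cvgM => //; exact: cvg_cst.
have hc : (fun n => expR (s n * complex.Re (C z)) * cos (s n * complex.Im (C z))) @ \oo -->
  expR (fine (leb (\bigcup_n G n)) * complex.Re (C z)) * cos (fine (leb (\bigcup_n G n)) * complex.Im (C z)).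
  by apply: cvgM => //; apply: (cvg_comp _ _ hA); exact: continuous_cos.
have hsn : (fun n => expR (s n * complex.Re (C z)) * sin (s n * complex.Im (C z))) @ \oo -->
  expR (fine (leb (\bigcup_n G n)) * complex.Re (C z)) * sin (fine (leb (\bigcup_n G n)) * complex.Im (C z)).
  by apply: cvgM => //; apply: (cvg_comp _ _ hA); exact: continuous_sin.
have cE (r : R) : cexp (r%:C * C z) = (expR (r * complex.Re (C z)) * cos (r * complex.Im (C z))) +i*
    (expR (r * complex.Re (C z)) * sin (r * complex.Im (C z))).
  by rewrite /cexp; case: (C z) => a b /=; rewrite !mul0r !subr0 !addr0; apply/eqP; rewrite eq_complex/= !mul0r subr0 addr0 !eqxx.
rewrite /expected_chf cE; apply/eqP; rewrite eq_complex /=; apply/andP; split; apply/eqP.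
- apply: (cvg_unique (@norm_hausdorff _ _) hRe); move: hc; apply: cvg_trans.
  apply: near_eq_cvg; apply: nearW => n; by have := chS n; rewrite cE => -[].
- apply: (cvg_unique (@norm_hausdorff _ _) hIm); move: hsn; apply: cvg_trans.
  apply: near_eq_cvg; apply: nearW => n; by have := chS n; rewrite cE => -[].
Qed.

(** Only bounded sets carry a value of [X], so Dynkin's argument is run on traces
    on a fixed interval.  Complements pass because the value on the interval is
    an exponential, hence invertible; disjoint unions pass because almost sure
    convergence of the partial sums carries over to characteristic functions. *)
Lemma chf_rm_window B : measurable B -> phi (B `&` W) z = expected_chf (B `&` W) z.
Proof.
move=> mB.
apply: (dynkin_induction (G := dyadic_rays) (P := fun B => phi (B `&` W) z = expected_chf (B `&` W) z)).
- exact: measurable_dyadic_rays.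
- exact: dyadic_rays_setI.
- by rewrite setTI.
- move=> _ [m [n ->]]; set q : R := _ * _.
  have [Nq|qN] := leP (- N%:R) q; last first.
    rewrite (_ : _ `&` W = set0)//; apply/seteqP; split => // s [] /=.
    rewrite !in_itv/= => sq /andP[Ns _].
    by have := lt_trans Ns (le_lt_trans sq qN); rewrite ltxx.
  have [qN|Nq'] := leP q N%:R.
    rewrite (_ : _ `&` W = `]- N%:R, q]%classic); first exact: window_itv.
    apply/seteqP; split => s; rewrite /W /= !in_itv/=.
      by move=> [-> /andP[->]].
    by move=> /andP[-> sq]; rewrite sq (le_trans sq).
  rewrite (_ : _ `&` W = W)//; apply/seteqP; split => s; rewrite /W /= !in_itv/=.
    by case.
  by move=> /andP[Ns sN]; rewrite Ns sN (le_trans sN) ?(ltW Nq').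
- move=> A mA hA.
  have e : W = (A `&` W) `|` (~` A `&` W) by rewrite -setIUl setUv setTI.
  have AA0 : (A `&` W) `&` (~` A `&` W) = set0.
    by rewrite setIACA setICr set0I.
  have := window_W; rewrite {1 2}e.
  rewrite chf_rm_setU ?expected_chf_setU ?hA//; [|exact: bI|exact/bI/measurableC|exact: bI|exact/bI/measurableC].
  by apply: mulfI; exact: cexp_neq0.
- exact: window_bigcup.
- by rewrite -measurable_dyadic_rays.
Qed.

End window.

(** The law of [X B] depends on [B] only through its length, and the cumulant is
    linear in the length. *)
Lemma chf_rm B z : bounded_Borel B ->
  phi B z = cexp ((fine (leb B))%:C * C z).
Proof.
move=> [mB /bounded_setP[N BN]].
by have := chf_rm_window N z mB; rewrite setIidl.
Qed.

End random_measure_law.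

(** * Step integrals against the difference of two random measures *)

Section atoms.
Context {R : realType} (J : finType) (B : J -> set R).
Hypothesis bB : forall j, bounded_Borel (B j).

(** Intersecting with the union leaves nothing for the empty set of indices, so
    that every atom is bounded. *)
Definition atom (K : {set J}) : set R :=
  \bigcup_j B j `&` \bigcap_j (if j \in K then B j else ~` B j).

Lemma atomP K s : atom K s ->
  (exists j, B j s) /\ forall j, B j s <-> j \in K.
Proof.
move=> [[j _ Bs] h]; split; first by exists j.
move=> i; have := h i Logic.I; case: ifP => // _ nB; by split.
Qed.

Lemma atom_exists j s : B j s -> exists2 K : {set J}, j \in K & atom K s.
Proof.
move=> Bs; exists (finset (fun i => `[< B i s >])); first by rewrite inE; exact/asboolP.
split; first by exists j.
by move=> i _; rewrite inE; case: asboolP.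
Qed.

Lemma measurable_atom K : measurable (atom K).
Proof.
apply: measurableI; first by case: (bounded_Borel_bigcup bB).
apply: fin_bigcap_measurable => // j _; case: ifP => _; first by case: (bB j).
by apply: measurableC; case: (bB j).
Qed.

Lemma bounded_Borel_atom K : bounded_Borel (atom K).
Proof.
apply: (bounded_Borel_sub (measurable_atom K) _ (bounded_Borel_bigcup bB)).
exact: subIsetl.
Qed.

Lemma trivIset_atom : trivIset setT atom.
Proof.
move=> K L _ _ [s [/atomP[_ hK] /atomP[_ hL]]].
apply/setP => j; apply/idP/idP.
  by move=> /hK/hL.
by move=> /hL/hK.
Qed.

Lemma atom_cover j : B j = \bigcup_(K : {set J}) (if j \in K then atom K else set0).
Proof.
apply/seteqP; split => s.
  by move=> /atom_exists[K jK Ks]; exists K => //; rewrite jK.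
by move=> [K _]; case: ifP => // jK /atomP[_ h]; apply/h.
Qed.

Lemma step_atomE {V : lmodType R} (z : J -> V) (s : R) K : atom K s ->
  \sum_j (\1_(B j) s : R) *: z j = \sum_(j in K) z j.
Proof.
move=> /atomP[_ h]; rewrite [RHS]big_mkcond/=; apply: eq_bigr => j _.
rewrite indicE; case: ifPn => jK.
  by rewrite mem_set ?scale1r//; apply/h.
by rewrite memNset ?scale0r// => /h; apply/negP.
Qed.

End atoms.

Section symmetrized.
Context {R : realType} {d : nat} {disp : measure_display}
  {Omega : measurableType disp} (P : probability Omega R)
  (mu : probability 'rV[R]_d R).
Variable C : 'rV[R]_d -> R[i].
Hypothesis hC : is_cumulant mu C.
Local Notation leb := (@lebesgue_measure R).

(** The sets may overlap.  On an atom the vectors of all steps covering it add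
    up, and distinct atoms are disjoint, where independence applies. *)
Lemma chf_rm_step (X : set R -> Omega -> 'rV[R]_d) (hX : is_random_measure P mu X)
    (J : finType) (B : J -> set R) (z : J -> 'rV[R]_d) :
  (forall j, bounded_Borel (B j)) ->
  chf P (fun w => \sum_j inner (z j) (X (B j) w)) =
  cexp (\sum_(K : {set J}) (fine (leb (atom B K)))%:C * C (\sum_(j in K) z j)).
Proof.
move=> bB; have bA := bounded_Borel_atom bB.
transitivity (chf P (fun w => \sum_(K : {set J}) inner (\sum_(j in K) z j) (X (atom B K) w))).
  apply: chf_ae.
  - by apply: measurable_sum => j; exact: (measurable_inner_rm hX).
  - by apply: measurable_sum => j; exact: (measurable_inner_rm hX).
  have hj j : {ae P, forall w, X (B j) w = \sum_(K : {set J}) X (if j \in K then atom B K else set0) w}.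
    pose F (K : {set J}) := if j \in K then atom B K else set0.
    have BE : B j = \bigcup_K F K by exact: atom_cover.
    have bF K : bounded_Borel (F K).
      by rewrite /F; case: ifP => // _; exact: bounded_Borel0.
    have tF : trivIset setT F.
      move=> K L _ _; rewrite /F; case: ifP => _; last by case=> ? [].
      by case: ifP => _; [exact: trivIset_atom|case=> ? []].
    have := rm_additive_fin hX bF tF; rewrite -BE; exact.
  have {}hj : {ae P, forall w j, X (B j) w = \sum_(K : {set J}) X (if j \in K then atom B K else set0) w}.
    exact: filter_forall.
  apply: filterS2 (rm_set0 hX) hj => w X0 hw.
  under eq_bigr do rewrite hw inner_sumr.
  rewrite exchange_big/=; apply: eq_bigr => K _.
  rewrite inner_suml [RHS]big_mkcond/=; apply: eq_bigr => j _.
  by case: ifP => //; rewrite X0 inner0r.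
rewrite (chf_rm_sum hX _ bA (@trivIset_atom R J B)) (big_morph _ cexpD cexp0).
by apply: eq_bigr => K _; rewrite (chf_rm hX hC).
Qed.

Variables X Xs : set R -> Omega -> 'rV[R]_d.
Hypotheses (hX : is_random_measure P mu X) (hXs : is_random_measure P mu Xs).
Hypothesis hindep : rm_indep P X Xs.

Lemma rm_sigma_step (Y : set R -> Omega -> 'rV[R]_d) (J : finType) (B : J -> set R)
    (z : J -> 'rV[R]_d) (E : set R) :
  (forall j, bounded_Borel (B j)) -> measurable E ->
  rm_sigma Y ((fun w => \sum_j inner (z j) (Y (B j) w)) @^-1` E).
Proof.
move=> bB mE.
pose G := [set U | exists B (E : set 'rV[R]_d),
         [/\ bounded_Borel B, measurable E & U = Y B @^-1` E]].
have : measurable_fun [set: g_sigma_algebraType G]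
      (fun w => \sum_j inner (z j) (Y (B j) w)).
  apply: measurable_sum => j; apply: (measurableT_comp (measurable_inner (z j))).
  move=> _ F mF; rewrite setTI; apply: sub_sigma_algebra.
  by exists (B j), F.
by move=> /(_ measurableT E mE); rewrite setTI.
Qed.

Lemma independent_step (J : finType) (B : J -> set R) (z : J -> 'rV[R]_d) :
  (forall j, bounded_Borel (B j)) ->
  independent P (fun w => \sum_j inner (z j) (X (B j) w))
    (fun w => \sum_j inner (z j) (Xs (B j) w)).
Proof. by move=> bB E F mE mF; apply: hindep; exact: rm_sigma_step. Qed.

(** The two step integrals are independent with the same characteristic function,
    so phases cancel and only the real part of [C] remains. *)
Lemma Ex_cos_step (J : finType) (B : J -> set R) (z : J -> 'rV[R]_d) :
  (forall j, bounded_Borel (B j)) ->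
  Ex P (fun w => cos (\sum_j inner (z j) (X (B j) w - Xs (B j) w))) =
  expR (2 * \sum_(K : {set J}) fine (leb (atom B K)) * complex.Re (C (\sum_(j in K) z j))).
Proof.
move=> bB.
have -> : (fun w => cos (\sum_j inner (z j) (X (B j) w - Xs (B j) w))) =
  (fun w => cos (\sum_j inner (z j) (X (B j) w) - \sum_j inner (z j) (Xs (B j) w))).
  apply/funext => w; rewrite -sumrB; congr cos.
  by apply: eq_bigr => j _; rewrite innerBr.
rewrite Ex_cosB_same.
- rewrite (chf_rm_step hX)// cexp_normE raddf_sum/=; congr (expR (2 * _)).
  apply: eq_bigr => K _; case: (C _) => p q /=; by rewrite mul0r subr0.
- by apply: measurable_sum => j; exact: (measurable_inner_rm hX).
- by apply: measurable_sum => j; exact: (measurable_inner_rm hXs).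
- exact: independent_step.
- by rewrite (chf_rm_step hX)// (chf_rm_step hXs).
Qed.

(** A step function is constant on each atom, and [h 0 = 0] makes the integrand
    vanish off the union of the atoms. *)
Lemma integral_step (J : finType) (B : J -> set R) (z : J -> 'rV[R]_d) (h : 'rV[R]_d -> R) :
  (forall j, bounded_Borel (B j)) -> (forall x, 0 <= h x) -> h 0 = 0 ->
  (\int[leb]_s (h (\sum_j (\1_(B j) s : R) *: z j))%:E)%E =
  (\sum_(K : {set J}) fine (leb (atom B K)) * h (\sum_(j in K) z j))%:E.
Proof.
move=> bB h0 hz; have bA := bounded_Borel_atom bB.
transitivity (\int[leb]_s (\sum_(K : {set J}) (h (\sum_(j in K) z j) * \1_(atom B K) s)%:E))%E.
  apply: eq_integral => s _; rewrite sumEFin; congr EFin.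
  have [[j Bs]|nB] := pselect (exists j, B j s); last first.
    rewrite big1 ?hz => [|j _]; last first.
      by rewrite indicE memNset ?scale0r// => Bs; apply: nB; exists j.
    rewrite big1// => K _; rewrite indicE memNset ?mulr0//.
    by move=> /atomP[].
  have [K jK Ks] := atom_exists Bs.
  rewrite (step_atomE z Ks) (bigD1 K)//= indicE mem_set// mulr1 [X in _ + X]big1 ?addr0//.
  move=> L LK; rewrite indicE memNset ?mulr0// => Ls; move/eqP: LK; apply.
  by apply: (@trivIset_atom R J B) => //; exists s.
rewrite ge0_integral_sum//; last 2 first.
- move=> K; apply/measurable_EFinP; apply: measurable_funM => //.
  by apply: measurable_indic; case: (bA K).
- by move=> K s _; rewrite lee_fin mulr_ge0.
rewrite -sumEFin; apply: eq_bigr => K _.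
have mK : measurable (atom B K) by case: (bA K).
under eq_integral do rewrite EFinM.
rewrite ge0_integralZl ?lee_fin//; last first.
  by apply/measurable_EFinP; exact: measurable_indic.
rewrite integral_indic// setIT EFinM fineK; first exact: muleC.
exact: lebesgue_bounded_fin.
Qed.

End symmetrized.

(** * The energy and the decay exponent of a Levy triplet *)

Section truncation.
Context {R : realType}.
Implicit Types x y c : R.

Lemma min1_ge0 y : 0 <= y -> 0 <= Num.min y 1.
Proof. by move=> y0; rewrite le_min y0 ler01. Qed.

Lemma min1_le x y : x <= y -> Num.min x 1 <= Num.min y 1.
Proof. by move=> xy; rewrite le_min !ge_min xy lexx orbT. Qed.

Lemma min1_scale c y : 0 <= y -> Num.min (c * y) 1 <= Num.max 1 c * Num.min y 1.
Proof.
move=> y0; have [y1|y1] := leP y 1.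
  rewrite ge_min; apply/orP; left.
  by rewrite ler_wpM2r// le_max lexx orbT.
by rewrite mulr1 ge_min; apply/orP; right; rewrite le_max lexx.
Qed.

Lemma min1_sum (I : finType) (y : I -> R) : (forall i, 0 <= y i) ->
  Num.min (\sum_i y i) 1 <= \sum_i Num.min (y i) 1.
Proof.
move=> y0.
have h i : 0 <= Num.min (y i) 1 by exact: min1_ge0.
have [[i yi]|ny] := pselect (exists i, 1 <= y i).
  rewrite [leRHS](bigD1 i)//= [X in _ <= X + _]min_r//.
  by rewrite ge_min [X in _ || X]lerDl sumr_ge0 ?orbT.
rewrite ge_min ler_sum// => i _; rewrite le_min lexx/=.
by rewrite leNgt; apply/negP => /ltW yi; apply: ny; exists i.
Qed.

End truncation.

Section with_sigma_finite.
Context {disp} {T : measurableType disp} {R : realType}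
  {m : {measure set T -> \bar R}}.

(** Tonelli's theorem takes sigma-finiteness as a structure on the measure; the
    alias carries the proof to where that structure is looked up. *)
Definition with_sigma_finite of sigma_finite setT m : set T -> \bar R := m.

Variable mT : sigma_finite setT m.

HB.instance Definition _ := Measure.on (with_sigma_finite mT).

HB.instance Definition _ :=
  Measure_isSigmaFinite.Build _ _ _ (with_sigma_finite mT) mT.

End with_sigma_finite.

Section levy_khintchine.
Context {R : realType} {d : nat}.
Variables (A : 'M[R]_d) (nu : {measure set 'rV[R]_d -> \bar R}) (gam : 'rV[R]_d).
Hypothesis qA : forall z, 0 <= quad A z.
Hypothesis nu0 : nu [set 0] = 0%E.
Hypothesis nuI : (\int[nu]_x (Num.min (enorm x ^+ 2) 1)%:E < +oo)%E.
Implicit Types (z x : 'rV[R]_d) (r c : R).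

Lemma enormZ_sqr r x : enorm (r *: x) ^+ 2 = r ^+ 2 * enorm x ^+ 2.
Proof. by rewrite !enorm_sqr mulr_sumr; apply: eq_bigr => i _; rewrite mxE exprMn. Qed.

Lemma coord_sqr_le_enorm x i : x 0 i ^+ 2 <= enorm x ^+ 2.
Proof. by rewrite enorm_sqr (bigD1 i)//= lerDl sumr_ge0// => j _; exact: sqr_ge0. Qed.

Lemma quad_delta c i : quad A (c *: delta_mx 0 i) = c ^+ 2 * A i i.
Proof.
rewrite /quad -scalemxAl innerZl innerZr mulrA -expr2 inner_delta.
by rewrite -rowE !mxE.
Qed.

Lemma diag_ge0 i : 0 <= A i i.
Proof. by have := qA (1 *: delta_mx 0 i); rewrite quad_delta expr1n mul1r. Qed.

Lemma diag_le_tr i : A i i <= \tr A.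
Proof. by rewrite /mxtrace (bigD1 i)//= lerDl sumr_ge0// => j _; exact: diag_ge0. Qed.

Lemma tr_ge0 : 0 <= \tr A.
Proof. by apply: sumr_ge0 => i _; exact: diag_ge0. Qed.

Lemma measurable_min1 d1 (T : measurableType d1) (u : T -> R) :
  measurable_fun [set: T] u ->
  measurable_fun [set: T] (fun w => (Num.min (u w) 1)%:E).
Proof. by move=> mu; apply/measurable_EFinP; apply: measurable_minr. Qed.

Lemma measurable_enorm_sqr : measurable_fun [set: 'rV[R]_d] (fun x => enorm x ^+ 2).
Proof. by apply: measurable_funX; exact: measurable_enorm. Qed.

(** The truncated second moment bounds the mass of the complement of each ball
    around the origin, and the origin itself has no mass. *)
Lemma sigma_finite_nu : sigma_finite setT nu.
Proof.
have e0 n : (0 : R) < n.+1%:R^-1 by rewrite invr_gt0.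
(* The origin is kept in every set of the cover. *)
pose F (n : nat) : set 'rV[R]_d := [set x | enorm x = 0] `|` [set x | n.+1%:R^-1 <= Num.min (enorm x ^+ 2) 1].
have z0 : [set x : 'rV[R]_d | enorm x = 0] = [set 0].
  apply/seteqP; split => x /=; last by move=> ->; rewrite /enorm inner0r sqrtr0.
  move=> x0; apply/rowP => i; rewrite mxE; apply/eqP; rewrite -normr_le0 -x0.
  exact: coord_le_enorm.
have mz : measurable [set x : 'rV[R]_d | enorm x = 0].
  rewrite (_ : [set x | _] = enorm @^-1` [set 0])//.
  by rewrite -[X in measurable X]setTI; exact: measurable_enorm.
have mm : measurable_fun [set: 'rV[R]_d] (fun x => (Num.min (enorm x ^+ 2) 1)%:E).
  by apply: measurable_min1; exact: measurable_enorm_sqr.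
have mF2 n : measurable [set x : 'rV[R]_d | n.+1%:R^-1 <= Num.min (enorm x ^+ 2) 1].
  rewrite -[X in measurable X]setTI.
  have := emeasurable_fun_c_infty measurableT mm n.+1%:R^-1%:E.
  by under eq_set do rewrite lee_fin.
exists F.
  apply/seteqP; split => // x _.
  have [x0|x0] := eqVneq (enorm x) 0; first by exists 0%N => //; left.
  have m0 : 0 < Num.min (enorm x ^+ 2) 1.
    by rewrite lt_min ltr01 andbT exprn_even_gt0//= x0.
  exists (Num.truncn (Num.min (enorm x ^+ 2) 1)^-1) => //; right => /=.
  by rewrite -[leRHS]invrK lef_pV2 ?posrE ?invr_gt0// ltW// truncnS_gt.
move=> n; split; first exact: measurableU.
apply: (le_lt_trans (measureU2 _ _ _)) => //.
rewrite [X in (X + _)%E](_ : _ = 0%E) ?add0e; last by rewrite z0.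
set S := [set x | _ <= _].
have mS : measurable S by exact: mF2.
have SI : (n.+1%:R^-1%:E * nu S <= \int[nu]_x (Num.min (enorm x ^+ 2) 1)%:E)%E.
  rewrite -integral_cst//.
  apply: (@le_trans _ _ (\int[nu]_(x in S) (Num.min (enorm x ^+ 2) 1)%:E)%E).
    apply: ge0_le_integral => //.
    - by move=> x _; rewrite /= lee_fin ltW.
    - exact: measurable_funTS.
  apply: ge0_subset_integral => // x _.
  by rewrite lee_fin min1_ge0 ?sqr_ge0.
rewrite -[X in (X < _)%E]mul1e -(_ : (n.+1%:R%:E * n.+1%:R^-1%:E = 1)%E); last first.
  by rewrite -EFinM mulfV.
by rewrite -muleA lte_mul_pinfty// (le_lt_trans SI).
Qed.

(** The two integrands of the criterion, added, as a function of the value [r]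
    of the integrated function. *)
Definition levy_energy r : \bar R :=
  ((r ^+ 2 * \tr A)%:E + \int[nu]_x (Num.min (enorm (r *: x) ^+ 2) 1)%:E)%E.

Lemma levy_energy_ge0 r : (0 <= levy_energy r)%E.
Proof.
apply: adde_ge0; first by rewrite lee_fin mulr_ge0 ?sqr_ge0 ?tr_ge0.
by apply: integral_ge0 => x _; rewrite lee_fin min1_ge0 ?sqr_ge0.
Qed.

Lemma measurable_jump r : measurable_fun [set: 'rV[R]_d]
  (fun x => (Num.min (enorm (r *: x) ^+ 2) 1)%:E).
Proof.
apply: measurable_min1; under eq_fun do rewrite enormZ_sqr.
by apply: measurable_funM => //; exact: measurable_enorm_sqr.
Qed.

Lemma jumpZ r k : 0 <= k ->
  (\int[nu]_x (k%:E * (Num.min (enorm (r *: x) ^+ 2) 1)%:E) =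
   k%:E * \int[nu]_x (Num.min (enorm (r *: x) ^+ 2) 1)%:E)%E.
Proof.
move=> k0; apply: ge0_integralZl => //; first exact: measurable_jump.
by move=> x _; rewrite lee_fin min1_ge0 ?sqr_ge0.
Qed.

Lemma jump_scale r c : (\int[nu]_x (Num.min (enorm ((c * r) *: x) ^+ 2) 1)%:E <=
  (Num.max 1 (c ^+ 2))%:E * \int[nu]_x (Num.min (enorm (r *: x) ^+ 2) 1)%:E)%E.
Proof.
rewrite -jumpZ; last by rewrite le_max ler01.
apply: ge0_le_integral => //.
- by move=> x _; rewrite lee_fin min1_ge0 ?sqr_ge0.
- exact: measurable_jump.
- by apply: measurable_funeM; exact: measurable_jump.
- move=> x _; rewrite -EFinM lee_fin -scalerA enormZ_sqr.
  by rewrite min1_scale// sqr_ge0.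
Qed.

Lemma levy_energy_scale r c :
  (levy_energy (c * r) <= (Num.max 1 (c ^+ 2))%:E * levy_energy r)%E.
Proof.
rewrite /levy_energy ge0_muleDr; last 2 first.
- by rewrite lee_fin mulr_ge0 ?sqr_ge0 ?tr_ge0.
- by apply: integral_ge0 => x _; rewrite lee_fin min1_ge0 ?sqr_ge0.
apply: leeD; last exact: jump_scale.
rewrite -EFinM lee_fin exprMn -mulrA ler_wpM2r ?(mulr_ge0 (sqr_ge0 _) tr_ge0)//.
by rewrite le_max lexx orbT.
Qed.

Lemma levy_energy_fin r : (levy_energy r < +oo)%E.
Proof.
rewrite -[r]mulr1; apply: (le_lt_trans (levy_energy_scale 1 r)).
rewrite lte_mul_pinfty//; first by rewrite lee_fin le_max ler01.
rewrite /levy_energy lte_add_pinfty ?ltry//.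
by under eq_integral do rewrite scale1r.
Qed.

Lemma levy_energy_le r1 r2 : `|r1| <= `|r2| -> (levy_energy r1 <= levy_energy r2)%E.
Proof.
move=> r12.
have s12 : r1 ^+ 2 <= r2 ^+ 2.
  by rewrite -(@real_normK _ r1) ?num_real// -(@real_normK _ r2) ?num_real// lerXn2r ?nnegrE.
apply: leeD; first by rewrite lee_fin ler_wpM2r ?tr_ge0.
apply: ge0_le_integral => //.
- by move=> x _; rewrite lee_fin min1_ge0 ?sqr_ge0.
- exact: measurable_jump.
- exact: measurable_jump.
- by move=> x _; rewrite lee_fin min1_le// !enormZ_sqr ler_wpM2r ?sqr_ge0.
Qed.

(** The square is not subadditive; monotonicity in the modulus and scaling by 2
    give the bound up to a factor. *)
Lemma levy_energyD r1 r2 :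
  (levy_energy (r1 + r2) <= 4%:E * (levy_energy r1 + levy_energy r2))%E.
Proof.
have h r s : `|s| <= `|r| -> (levy_energy (r + s) <= 4%:E * levy_energy r)%E.
  move=> sr; apply: (@le_trans _ _ (levy_energy (2 * r))).
    apply: levy_energy_le; rewrite normrM ger0_norm// mulr_natl mulr2n.
    by rewrite (le_trans (ler_normD _ _))// lerD2l.
  apply: (le_trans (levy_energy_scale r 2)).
  by rewrite (max_idPr _) -natrX// ler1n.
have [r12|r21] := leP `|r1| `|r2|.
  rewrite addrC (le_trans (h _ _ r12))// lee_pmul2l// leeDr//.
  exact: levy_energy_ge0.
rewrite (le_trans (h _ _ (ltW r21)))// lee_pmul2l// leeDl//.
exact: levy_energy_ge0.
Qed.

Lemma measurable_jump_energy : measurable_fun [set: R]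
  (fun r => \int[nu]_x (Num.min (enorm (r *: x) ^+ 2) 1)%:E)%E.
Proof.
have h := @measurable_fun_fubini_tonelli_F _ _ _ _ R (with_sigma_finite sigma_finite_nu)
  (fun p : R * 'rV[R]_d => (Num.min (enorm (p.1 *: p.2) ^+ 2) 1)%:E).
apply: h.
- apply: measurable_min1; under eq_fun do rewrite enormZ_sqr.
  apply: measurable_funM; first exact: measurable_funX.
  exact: (measurableT_comp measurable_enorm_sqr).
- by move=> p; rewrite lee_fin min1_ge0 ?sqr_ge0.
Qed.

Lemma measurable_levy_energy : measurable_fun [set: R] levy_energy.
Proof.
apply: emeasurable_funD; last exact: measurable_jump_energy.
apply/measurable_EFinP; apply: measurable_funM => //; exact: measurable_funX.
Qed.

Lemma cvg_levy_energy (r : nat -> R) (M : R) : (forall n, `|r n| <= `|M|) ->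
  r @ \oo --> 0 -> levy_energy (r n) @[n --> \oo] --> 0%E.
Proof.
move=> rM r0; have r20 : (fun n => r n ^+ 2) @ \oo --> (0 : R).
  by rewrite -(mulr0 (0 : R)); exact: cvgM.
rewrite -[0%E]adde0; apply: cvgeD => //.
  apply: cvg_EFin; first exact: nearW.
  by rewrite -(mul0r (\tr A)); apply: cvgMl.
have [|||||_ _ h] := @dominated_convergence _ _ _ nu setT measurableT
  (fun n x => (Num.min (enorm (r n *: x) ^+ 2) 1)%:E) (cst 0%E)
  (fun x => (Num.min (enorm (M *: x) ^+ 2) 1)%:E).
- by move=> n; exact: measurable_jump.
- exact: measurable_cst.
- apply: aeW => x _; apply: cvg_EFin; first exact: nearW.
  apply: (@squeeze_cvgr _ _ _ _ (cst 0) (fun n => r n ^+ 2 * enorm x ^+ 2)).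
  + apply: nearW => n /=; rewrite min1_ge0 ?sqr_ge0//= enormZ_sqr.
    by rewrite ge_min lexx.
  + exact: cvg_cst.
  + by rewrite -(mul0r (enorm x ^+ 2)); apply: cvgMl.
- apply/integrableP; split; first exact: measurable_jump.
  under eq_integral do rewrite gee0_abs ?lee_fin ?min1_ge0 ?sqr_ge0//.
  apply: le_lt_trans (levy_energy_fin M).
  by rewrite /levy_energy leeDr// lee_fin mulr_ge0 ?sqr_ge0 ?tr_ge0.
- apply: aeW => x n _; rewrite gee0_abs ?lee_fin ?min1_ge0 ?sqr_ge0//.
  rewrite min1_le// !enormZ_sqr ler_wpM2r ?sqr_ge0//.
  rewrite -(@real_normK _ (r n)) ?num_real// -(@real_normK _ M) ?num_real//.
  by rewrite lerXn2r ?nnegrE.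
by move: h; rewrite integral_cst// mul0e; apply.
Qed.

(** The modulus of the characteristic function of [X B] at [z] is
    exp (- |B| psi z). *)
Definition psi z : R := - complex.Re (LK_exponent A nu gam z).

Lemma measurable_one_sub_cos z : measurable_fun [set: 'rV[R]_d]
  (fun x => (1 - cos (inner z x))%:E).
Proof.
apply/measurable_EFinP/measurable_funB => //.
by apply: (measurableT_comp measurable_cos); exact: measurable_inner.
Qed.

Lemma integral_one_sub_cos_lty z : (\int[nu]_x (1 - cos (inner z x))%:E < +oo)%E.
Proof.
pose c := \sum_i `|z 0 i|.
apply: (@le_lt_trans _ _ (\int[nu]_x (2%:E * (Num.min (enorm (c *: x) ^+ 2) 1)%:E))%E).
  apply: ge0_le_integral => //.
  - exact: measurable_one_sub_cos.
  - by apply: measurable_funeM; exact: measurable_jump.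
  - move=> x _; rewrite -EFinM lee_fin (le_trans (one_sub_cos_le_min _))//.
    rewrite ler_wpM2l// min1_le// enormZ_sqr -exprMn -real_normK ?num_real//.
    rewrite lerXn2r ?nnegrE ?norm_inner_le// mulr_ge0 ?enorm_ge0//.
    exact: sumr_ge0.
rewrite jumpZ//.
rewrite lte_mul_pinfty//; apply: le_lt_trans (levy_energy_fin c).
by rewrite /levy_energy leeDr// lee_fin mulr_ge0 ?sqr_ge0 ?tr_ge0.
Qed.

(** The compensating term of the Levy-Khintchine formula is purely imaginary. *)
Lemma psiE z : ((psi z)%:E = (quad A z / 2)%:E + \int[nu]_x (1 - cos (inner z x))%:E)%E.
Proof.
rewrite /psi /LK_exponent /= addr0 opprD opprK EFinD; congr (_ + _)%E.
rewrite /Rintegral -[in RHS](@fineK _ (\int[nu]_x (1 - cos (inner z x))%:E)%E); last first.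
  rewrite ge0_fin_numE ?integral_one_sub_cos_lty//.
  by apply: integral_ge0 => x _; rewrite lee_fin one_sub_cos_ge0.
congr EFin; rewrite -fineN; congr fine.
rewrite -[RHS]oppeK; congr (- _)%E.
rewrite -integral_ge0N; last by move=> x _; rewrite lee_fin one_sub_cos_ge0.
by apply: eq_integral => x _ /=; rewrite expR0 mul1r mul0r !subr0 -?EFinN opprB.
Qed.

Lemma psi_ge0 z : 0 <= psi z.
Proof.
rewrite -lee_fin psiE adde_ge0//; first by rewrite lee_fin divr_ge0.
by apply: integral_ge0 => x _; rewrite lee_fin one_sub_cos_ge0.
Qed.

Lemma psi0 : psi 0 = 0.
Proof.
apply: EFin_inj; rewrite psiE /quad inner0l mul0r add0e.
by apply: integral0_eq => x _; rewrite inner0l cos0 subrr.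
Qed.

(** Vectors on the axes suffice later on, because the coordinates control the
    Euclidean norm. *)
Lemma psi_axis_le r c i :
  ((psi (r *: (c *: delta_mx 0 i)))%:E <= (2 * Num.max 1 (c ^+ 2))%:E * levy_energy r)%E.
Proof.
rewrite psiE /levy_energy ge0_muleDr; last 2 first.
- by rewrite lee_fin mulr_ge0 ?sqr_ge0 ?tr_ge0.
- by apply: integral_ge0 => x _; rewrite lee_fin min1_ge0 ?sqr_ge0.
have m1 : c ^+ 2 <= Num.max 1 (c ^+ 2) by rewrite le_max lexx orbT.
have m0 : 0 <= Num.max 1 (c ^+ 2) by rewrite le_max ler01.
apply: leeD.
  rewrite scalerA quad_delta -EFinM lee_fin exprMn.
  have h1 := diag_le_tr i; have h2 := diag_ge0 i.
  have r20 := sqr_ge0 r; have c20 := sqr_ge0 c.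
  have e1 : r ^+ 2 * A i i <= r ^+ 2 * \tr A by rewrite ler_wpM2l.
  have e2 : c ^+ 2 * (r ^+ 2 * A i i) <= Num.max 1 (c ^+ 2) * (r ^+ 2 * \tr A).
    by apply: ler_pM => //; apply: mulr_ge0.
  have e3 : 0 <= c ^+ 2 * (r ^+ 2 * A i i) by apply: mulr_ge0 => //; apply: mulr_ge0.
  rewrite mulrAC -mulrA mulrCA; lra.
rewrite EFinM -muleA.
apply: (@le_trans _ _ (2%:E * \int[nu]_x (Num.min (enorm ((c * r) *: x) ^+ 2) 1)%:E)%E); last first.
  by rewrite lee_pmul2l// jump_scale.
rewrite -jumpZ//.
apply: ge0_le_integral => //.
- exact: measurable_one_sub_cos.
- by apply: measurable_funeM; exact: measurable_jump.
- move=> x _; rewrite -EFinM lee_fin (le_trans (one_sub_cos_le_min _))//.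
  rewrite ler_wpM2l// min1_le// enormZ_sqr scalerA innerZl inner_delta exprMn.
  by rewrite (mulrC r c) ler_wpM2l ?sqr_ge0// coord_sqr_le_enorm.
Qed.

End levy_khintchine.

(** * From convergence to finite energy *)

Section endpoints.
Context {R : realType}.

Lemma approach_right (c : R) (b : \bar R) : (c%:E < b)%E ->
  exists q : nat -> R, [/\ forall n, c < q n, forall n, ((q n)%:E < b)%E &
    forall q0 : R, (q0%:E < b)%E -> \forall n \near \oo, q0 <= q n].
Proof.
case: b => [b| |]//; rewrite ?lte_fin => cb.
(* Halving the distance to a finite end point stays strictly inside. *)
- exists (fun n => b - (b - c) * 2^-1 ^+ n.+1); split.
  + move=> n; rewrite ltrBrDl -ltrBrDr -[ltRHS]mulr1 ltr_pM2l ?subr_gt0//.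
    by rewrite exprn_ilt1//; lra.
  + by move=> n; rewrite lte_fin ltrBlDr ltrDl mulr_gt0 ?subr_gt0// exprn_gt0.
  + move=> q0; rewrite lte_fin => q0b.
    have h : (fun n => b - (b - c) * 2^-1 ^+ n.+1) @ \oo --> b.
      suff : (fun n => b - (b - c) * 2^-1 ^+ n.+1) @ \oo --> b - (b - c) * 0 by rewrite mulr0 subr0.
      apply: cvgB; first exact: cvg_cst.
      apply: cvgM; first exact: cvg_cst.
      rewrite (cvg_shiftS (fun n => 2^-1 ^+ n : R)).
      by apply: cvg_expr; rewrite gtr0_norm//; lra.
    exact: (cvgr_ge _ h).
- exists (fun n => c + n.+1%:R); split.
  + by move=> n; rewrite ltrDl.
  + by move=> n; rewrite ltry.
  + move=> q0 _; exists (Num.truncn `|q0 - c|).+1 => // n /= nk.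
    rewrite -lerBlDl (le_trans (ler_norm _))// ltW// (lt_le_trans (truncnS_gt _))//.
    by rewrite ler_nat (leq_trans nk).
Qed.

Lemma approach_left (c : R) (a : \bar R) : (a < c%:E)%E ->
  exists p : nat -> R, [/\ forall n, p n < c, forall n, (a < (p n)%:E)%E &
    forall p0 : R, (a < p0%:E)%E -> \forall n \near \oo, p n <= p0].
Proof.
rewrite -lteN2 -EFinN => /approach_right[q [h1 h2 h3]].
exists (fun n => - q n); split.
- by move=> n; rewrite ltrNl.
- by move=> n; rewrite -lteN2 EFinN oppeK.
- move=> p0; rewrite -lteN2 -EFinN => /h3; apply: filterS => n.
  by rewrite lerNl.
Qed.

Lemma real_between (a b : \bar R) : (a < b)%E -> exists c : R, (a < c%:E)%E /\ (c%:E < b)%E.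
Proof.
case: a => [a| |]; case: b => [b| |] //=; rewrite ?lte_fin => ab.
- by exists ((a + b) / 2); rewrite !lte_fin !(midf_lt ab).
- by exists (a + 1); rewrite lte_fin ltrDl ltr01 ltry.
- by exists (b - 1); rewrite ltNyr lte_fin gtrDl ltrN10.
- by exists 0; rewrite ltNyr ltry.
Qed.

(** One sequence tends to both ends, and the convergence theorems of integration
    apply along it. *)
Lemma approach_ends (a b : \bar R) : (a < b)%E ->
  exists p q : nat -> R,
  [/\ forall n, (a < (p n)%:E)%E, forall n, ((q n)%:E < b)%E, forall n, p n < q n &
      (fun n => (p n, q n)) @ \oo --> to_ends a b].
Proof.
move=> /real_between[c [/approach_left[p [p1 p2 p3]] /approach_right[q [q1 q2 q3]]]].
have pq n : p n < q n by exact: lt_trans (p1 n) (q1 n).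
exists p, q; split => //.
move=> S [[p0 q0] /= [ap0 q0b] sub].
apply: filterS2 (p3 _ ap0) (q3 _ q0b) => n pn qn; apply: sub.
by split => /=.
Qed.

Lemma to_ends_mem (a b : \bar R) (s : R) : (a < b)%E -> oitv a b s ->
  to_ends a b [set pq | [/\ (a < pq.1%:E)%E, (pq.2%:E < b)%E, pq.1 < pq.2 & `]pq.1, pq.2]%classic s]].
Proof.
move=> ab /andP[as_ sb]; have [p0 [ap0 p0s]] := real_between as_.
exists (p0, s) => //= -[p q] /= [ap qb pq pp0 sq]; split => //.
by rewrite /= in_itv/= sq (le_lt_trans pp0).
Qed.

End endpoints.

Section fatou_bound.
Context {disp} {T : measurableType disp} {R : realType} (m : {measure set T -> \bar R}).

Lemma fatou_le (h_ : nat -> T -> R) (h : T -> R) (M : \bar R) :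
  (forall n, measurable_fun [set: T] (h_ n)) -> measurable_fun [set: T] h ->
  (forall n x, 0 <= h_ n x) -> (forall x, 0 <= h x) ->
  {ae m, forall x, h_ ^~ x @ \oo --> h x} ->
  (\forall n \near \oo, (\int[m]_x (h_ n x)%:E <= M)%E) ->
  (\int[m]_x (h x)%:E <= M)%E.
Proof.
move=> mh_ mh h_0 h0 hh [N _ hM].
have mE n : measurable_fun [set: T] (EFin \o h_ n) by exact/measurable_EFinP.
have -> : (\int[m]_x (h x)%:E = \int[m]_x limn_einf (fun n => (h_ n x)%:E))%E.
  apply: ae_eq_integral => //.
  - exact/measurable_EFinP.
  - rewrite (_ : (fun x => _) = (fun x => - limn_esup (fun n => - (h_ n x)%:E))%E).
      apply: measurableT_comp => //.
      apply: (@measurable_fun_limn_esup _ _ _ setT (fun n x => - (h_ n x)%:E)%E) => n.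
      by apply: measurableT_comp => //; exact: mE.
    by apply/funext => x; rewrite -(oppeK (limn_einf _)) -limn_esupN.
  - apply: filterS hh => x hx _; apply/esym.
    apply: (cvg_limn_einf_sup (u := fun n => (h_ n x)%:E) _).1.
    by apply: cvg_EFin => //; exact: nearW.
apply: (le_trans (fatou m measurableT mE _)).
  by move=> n x _; rewrite lee_fin.
rewrite limn_einf_lim; apply: lime_le; first exact: is_cvg_einfs.
apply: nearW => n; apply: ereal_inf_le.
exists (\int[m]_x (h_ (maxn n N) x)%:E)%E; last by apply: hM => /=; rewrite leq_maxr.
by exists (maxn n N) => //=; rewrite leq_maxl.
Qed.

End fatou_bound.

Section iterated_truncated_moment.
Context {R : realType} d1 d2 (T1 : measurableType d1) (T2 : measurableType d2)
  (m1 : {sigma_finite_measure set T1 -> \bar R})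
  (m2 : {sigma_finite_measure set T2 -> \bar R}).

(** The function [h] stands for a truncated squared norm and [u i] for multiples
    of its coordinates. *)
Lemma iterated_min_sqr_lty (n : nat) (u : 'I_n -> T1 * T2 -> R) (h : T1 * T2 -> R) (c C : R) :
  (forall i, measurable_fun [set: T1 * T2] (u i)) ->
  measurable_fun [set: T1 * T2] h -> 0 <= c -> (forall p, 0 <= h p) ->
  (forall p, h p <= \sum_(i < n) c * Num.min (u i p ^+ 2) 1) ->
  (forall t i, 0 <= t <= 1 ->
    (\int[m1]_x \int[m2]_y (1 - cos (t * u i (x, y)))%:E <= C%:E)%E) ->
  (\int[m1]_x \int[m2]_y (h (x, y))%:E < +oo)%E.
Proof.
move=> mu mh c0 h0 hu hC.
have mmin i : measurable_fun [set: T1 * T2] (fun p => (Num.min (u i p ^+ 2) 1)%:E).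
  exact: measurable_min_sqr.
have min0 i p : (0 <= (Num.min (u i p ^+ 2) 1)%:E)%E by rewrite lee_fin min1_ge0 ?sqr_ge0.
pose F i x := (\int[m2]_y (Num.min (u i (x, y) ^+ 2) 1)%:E)%E.
have mF i : measurable_fun [set: T1] (F i).
  exact: (measurable_fun_fubini_tonelli_F (m2 := m2) _ (mmin i) (min0 i)).
have F0 i x : (0 <= F i x)%E by apply: integral_ge0 => y _; exact: min0.
have hi i : (\int[m1]_x F i x <= 24%:E * C%:E)%E.
  by apply: iterated_integral_min_sqr_le => // t t01; exact: hC.
have mhx x : measurable_fun [set: T2] (fun y => (h (x, y))%:E).
  by apply/measurable_EFinP; exact: measurableT_comp.
apply: (@le_lt_trans _ _ (\int[m1]_x \sum_(i < n) (c%:E * F i x))%E).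
  apply: ge0_le_integral => //.
  - by move=> x _; apply: integral_ge0 => y _; rewrite lee_fin.
  - apply: (measurable_fun_fubini_tonelli_F (m2 := m2) (EFin \o h)).
      exact/measurable_EFinP.
    by move=> p; rewrite /= lee_fin.
  - by apply: emeasurable_sum => i; apply: measurable_funeM; exact: mF.
  - move=> x _; rewrite [leRHS](_ : _ =
        \int[m2]_y \sum_(i < n) (c%:E * (Num.min (u i (x, y) ^+ 2) 1)%:E))%E.
      apply: ge0_le_integral => //.
      + by move=> y _; rewrite lee_fin.
      + apply: emeasurable_sum => i; apply: measurable_funeM.
        exact: (measurable_fun_pair2 x (mmin i)).
      + by move=> y _; rewrite sumEFin lee_fin; exact: hu.
    rewrite ge0_integral_sum//; last 2 first.
    + move=> i; apply: measurable_funeM.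
      exact: (measurable_fun_pair2 x (mmin i)).
    + by move=> i y _; rewrite mule_ge0.
    apply: eq_bigr => i _; rewrite ge0_integralZl//.
    exact: (measurable_fun_pair2 x (mmin i)).
rewrite ge0_integral_sum//; last 2 first.
- by move=> i; apply: measurable_funeM; exact: mF.
- by move=> i x _; rewrite mule_ge0.
apply: lte_sum_pinfty => i _; rewrite ge0_integralZl// lte_mul_pinfty//.
by rewrite (le_lt_trans (hi i))// -EFinM ltry.
Qed.

End iterated_truncated_moment.

Section in_probability.
Context {R : realType} {d : nat} {disp : measure_display}
  {Omega : measurableType disp} (P : probability Omega R).
Implicit Types (Y Z : Omega -> 'rV[R]_d) (z : 'rV[R]_d).

Lemma measurable_enorm_sub Y Z : measurable_fun [set: Omega] Y -> measurable_fun [set: Omega] Z ->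
  measurable_fun [set: Omega] (fun w => enorm (Y w - Z w)).
Proof.
move=> mY mZ; apply: (measurableT_comp measurable_enorm); apply: measurable_rV => i.
under eq_fun do rewrite !mxE.
by apply: measurable_funB; apply: (measurableT_comp (measurable_coord i)).
Qed.

Lemma measurable_enorm_gt Y Z (e : R) : measurable_fun [set: Omega] Y -> measurable_fun [set: Omega] Z ->
  measurable [set w | e < enorm (Y w - Z w)].
Proof.
move=> mY mZ; rewrite -[X in measurable X]setTI.
by apply: (@measurable_fun_ltr _ _ _ setT (cst e)) => //; exact: measurable_enorm_sub.
Qed.

Lemma Ex_cos_inner_dist Y Z z (e : R) : measurable_fun [set: Omega] Y ->
  measurable_fun [set: Omega] Z -> 0 < e ->
  `|Ex P (fun w => cos (inner z (Y w))) - Ex P (fun w => cos (inner z (Z w)))| <=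
   e + 2 * fine (P [set w | e / (1 + \sum_i `|z 0 i|) < enorm (Y w - Z w)]).
Proof.
move=> mY mZ e0.
have mU : measurable_fun [set: Omega] (fun w => inner z (Y w)).
  exact: (measurableT_comp (measurable_inner z)).
have mV : measurable_fun [set: Omega] (fun w => inner z (Z w)).
  exact: (measurableT_comp (measurable_inner z)).
apply: (le_trans (Ex_cos_dist P mU mV (ltW e0))).
have z0 : 0 <= \sum_i `|z 0 i| by exact: sumr_ge0.
rewrite lerD2l ler_wpM2l// fine_le//; last 1 first.
- apply: le_measure; rewrite ?inE.
  + rewrite -[X in measurable X]setTI.
    apply: (@measurable_fun_ltr _ _ _ setT (cst e)) => //.
    by apply: measurableT_comp => //; exact: measurable_funB.
  + exact: measurable_enorm_gt.
  + move=> w /=; rewrite -innerBr => h; rewrite ltr_pdivrMr; last by rewrite ltr_wpDr.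
    apply: (lt_le_trans h); apply: (le_trans (norm_inner_le _ _)).
    by rewrite mulrC ler_wpM2l ?enorm_ge0// lerDr.
- by apply: fin_num_measure; rewrite -[X in measurable X]setTI;
    apply: (@measurable_fun_ltr _ _ _ setT (cst e)) => //;
    apply: measurableT_comp => //; exact: measurable_funB.
- by apply: fin_num_measure; exact: measurable_enorm_gt.
Qed.

Lemma Ex_cos_in_prob {I : Type} (F : set_system I) {FF : Filter F}
    (Y : I -> Omega -> 'rV[R]_d) Z z (c : R) :
  (\forall i \near F, measurable_fun [set: Omega] (Y i)) ->
  measurable_fun [set: Omega] Z -> cvg_in_prob P F Y Z ->
  c < Ex P (fun w => cos (inner z (Z w))) ->
  \forall i \near F, c < Ex P (fun w => cos (inner z (Y i w))).
Proof.
move=> mY mZ YZ cZ; set v := Ex P _ in cZ *.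
pose e := (v - c) / 4.
have e0 : 0 < e by rewrite divr_gt0// subr_gt0.
have z0 : 0 <= \sum_i `|z 0 i| by exact: sumr_ge0.
have e'0 : 0 < e / (1 + \sum_i `|z 0 i|) by rewrite divr_gt0// ltr_wpDr.
have := YZ _ e'0 => /fine_cvgP[_] /cvgrPdist_lt/(_ _ e0) h.
near=> i.
have mYi : measurable_fun [set: Omega] (Y i) by near: i.
have hi : `|0 - fine (P [set w | e / (1 + \sum_i `|z 0 i|) < enorm (Y i w - Z w)])| < e.
  by near: i.
have := Ex_cos_inner_dist z mYi mZ e0; rewrite -/v.
move: hi; rewrite sub0r normrN ger0_norm ?fine_ge0// => hi.
rewrite ler_norml => /andP[h1 _]; move: h1; rewrite /e in hi *; lra.
Unshelve. all: by end_near. Qed.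

End in_probability.

Section symmetrized_integral.
Context {R : realType} {d : nat} (a b : \bar R).
Hypothesis ab : (a < b)%E.
Variables (mu : probability 'rV[R]_d R) (A : 'M[R]_d)
  (nu : {measure set 'rV[R]_d -> \bar R}) (gam : 'rV[R]_d).
Hypothesis qA : forall z, 0 <= quad A z.
Hypothesis nu0 : nu [set 0] = 0%E.
Hypothesis nuI : (\int[nu]_x (Num.min (enorm x ^+ 2) 1)%:E < +oo)%E.
Hypothesis hC : is_cumulant mu (LK_exponent A nu gam).
Context {disp : measure_display} {Omega : measurableType disp}
  (P : probability Omega R) (X Xs : set R -> Omega -> 'rV[R]_d).
Hypotheses (hX : is_random_measure P mu X) (hXs : is_random_measure P mu Xs).
Hypothesis hindep : rm_indep P X Xs.
Local Notation leb := (@lebesgue_measure R).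
Local Notation Psi := (psi A nu gam).
Local Notation S := (fun (B : set R) w => X B w - Xs B w).

Lemma measurable_step (J : finType) (B : J -> set R) (r : J -> R) :
  (forall j, bounded_Borel (B j)) ->
  measurable_fun [set: Omega] (fun w => \sum_j r j *: S (B j) w).
Proof.
move=> bB; apply: measurable_rV => i.
under eq_fun do rewrite summxE.
apply: measurable_sum => j; under eq_fun do rewrite !mxE.
apply: measurable_funM => //; apply: measurable_funB;
  apply: (measurableT_comp (measurable_coord i)).
  exact: (rm_measurable hX).
exact: (rm_measurable hXs).
Qed.

(** The identity on which both implications rest; the integral is shown to be
    finite at the same time. *)
Lemma Ex_cos_sym (J : finType) (B : J -> set R) (r : J -> R) z :
  (forall j, bounded_Borel (B j)) ->
  exists2 I : R, (\int[leb]_s (Psi ((\sum_j r j * \1_(B j) s) *: z))%:E = I%:E)%E &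
    Ex P (fun w => cos (inner z (\sum_j r j *: S (B j) w))) = expR (- (2 * I)).
Proof.
move=> bB.
exists (\sum_(K : {set J}) fine (leb (atom B K)) * Psi (\sum_(j in K) r j *: z)).
  have psi_0 : Psi 0 = 0 by exact: psi0.
  have psi_pos x : 0 <= Psi x by exact: psi_ge0.
  have <- := integral_step (fun j => r j *: z) bB psi_pos psi_0.
  apply: eq_integral => s _; congr (Psi _)%:E.
  by rewrite scaler_suml; apply: eq_bigr => j _; rewrite scalerA mulrC.
have -> : (fun w => cos (inner z (\sum_j r j *: S (B j) w))) =
   (fun w => cos (\sum_j inner (r j *: z) (S (B j) w))).
  apply/funext => w; congr cos; rewrite inner_sumr; apply: eq_bigr => j _.
  by rewrite innerZl innerZr.
rewrite (Ex_cos_step hC hX hXs hindep)//; congr expR.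
rewrite -mulrN; congr (_ * _); rewrite -sumrN; apply: eq_bigr => K _.
by rewrite /psi mulrN opprK.
Qed.

Lemma continuous_psi : continuous Psi.
Proof.
case: hC => cRe _ _ _ z.
apply: (@cvg_comp _ _ _ (fun z => complex.Re (LK_exponent A nu gam z)) -%R _
  (nbhs (complex.Re (LK_exponent A nu gam z)))); first exact: cRe.
exact: opp_continuous.
Qed.

Lemma continuous_psiZ z : continuous (fun r : R => Psi (r *: z)).
Proof.
move=> r; apply: (@cvg_comp _ _ _ (fun r : R => r *: z) Psi _ (nbhs (r *: z))).
  exact: scalel_continuous.
exact: continuous_psi.
Qed.

Lemma measurable_psiZ d1 (T : measurableType d1) (g : T -> R) z :
  measurable_fun [set: T] g -> measurable_fun [set: T] (fun s => Psi (g s *: z)).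
Proof.
move=> mg; apply: (measurableT_comp (f := fun r : R => Psi (r *: z))) => //.
exact: continuous_measurable_fun (@continuous_psiZ z).
Qed.

Variable f : R -> R.
Hypothesis mf : measurable_fun (oitv a b) f.

Lemma measurable_oitv : measurable (oitv a b).
Proof.
have -> : oitv a b = EFin @^-1` `]a, b[%classic.
  by apply/seteqP; split => s; rewrite /= in_itv.
rewrite -[X in measurable X]setTI; apply: EFin_measurable => //.
exact: emeasurable_itv.
Qed.

Definition zero_ext s := \1_(oitv a b) s * f s.

Lemma zero_extE s : oitv a b s -> zero_ext s = f s.
Proof. by move=> ss; rewrite /zero_ext indicE mem_set// mul1r. Qed.

Lemma zero_ext0 s : ~ oitv a b s -> zero_ext s = 0.
Proof. by move=> ss; rewrite /zero_ext indicE memNset// mul0r. Qed.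

Lemma measurable_zero_ext : measurable_fun [set: R] zero_ext.
Proof.
rewrite (_ : zero_ext = f \_ (oitv a b)).
  by apply/(measurable_restrictT _ measurable_oitv).
apply/funext => s; rewrite patchE; case: ifPn => h.
  by rewrite zero_extE//; rewrite inE in h.
by rewrite zero_ext0// => h'; rewrite mem_set in h.
Qed.

Lemma itv_sub_oitv p q : (a < p%:E)%E -> (q%:E < b)%E -> `]p, q]%classic `<=` oitv a b.
Proof.
move=> ap qb s /=; rewrite in_itv/= => /andP[ps sq]; rewrite /oitv/=; apply/andP; split.
  by rewrite (lt_trans ap)// lte_fin.
by rewrite (le_lt_trans _ qb)// lee_fin.
Qed.

(** For the approximating simple functions the bound is the logarithm of
    [Ex_cos_sym]; Fatou's lemma passes it on to [f]. *)
Lemma is_integral_psi_le p q (Y : Omega -> 'rV[R]_d) z c : (a < p%:E)%E -> (q%:E < b)%E ->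
  is_integral P a b S f `]p, q]%classic Y -> 0 < c ->
  c < Ex P (fun w => cos (inner z (Y w))) ->
  (\int[leb]_s (Psi ((\1_`]p, q] s * zero_ext s) *: z))%:E <= (- ln c / 2)%:E)%E.
Proof.
move=> ap qb [mY [g [gf _] gY]] c0 cY.
have bB n j : bounded_Borel (`]p, q]%classic `&` sf_set (g n) j).
  apply: (bounded_Borel_sub _ _ (bounded_Borel_itv p q)); last exact: subIsetl.
  by apply: measurableI => //; exact: sf_measurable.
have gE n s : \sum_j sf_coef (g n) j * \1_(`]p, q] `&` sf_set (g n) j) s =
    \1_`]p, q] s * sf_eval (g n) s.
  rewrite /sf_eval mulr_sumr; apply: eq_bigr => j _.
  by rewrite indicI /= mulrCA.
have mg n : measurable_fun [set: R] (fun s => \1_`]p, q] s * sf_eval (g n) s : R).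
  apply: measurable_funM; first exact: measurable_indic.
  apply: measurable_sum => j; apply: measurable_funM => //.
  by apply: measurable_indic; exact: sf_measurable.
apply: (@fatou_le _ _ _ leb (fun n s => Psi ((\1_`]p, q] s * sf_eval (g n) s) *: z))
  (fun s => Psi ((\1_`]p, q] s * zero_ext s) *: z))).
- by move=> n; apply: measurable_psiZ; exact: mg.
- apply: measurable_psiZ; apply: measurable_funM; first exact: measurable_indic.
  exact: measurable_zero_ext.
- by move=> *; exact: psi_ge0.
- by move=> *; exact: psi_ge0.
- have FL : Filter (almost_everywhere leb) by exact: (@ae_filter_ringOfSetsType _ _ _ leb).
  apply: filterS gf => s gs.
  have [sB|sB] := pselect (`]p, q]%classic s).
    have so := itv_sub_oitv ap qb sB.
    rewrite indicE mem_set// mul1r zero_extE//.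
    under eq_fun do rewrite mul1r.
    by apply: (@cvg_comp _ _ _ (fun n => sf_eval (g n) s) (fun r => Psi (r *: z)) _ (nbhs (f s)) _ (gs so));
      exact: continuous_psiZ.
  rewrite indicE memNset// mul0r; under eq_fun do rewrite mul0r.
  exact: cvg_cst.
- have : \forall n \near \oo, c < Ex P (fun w => cos (inner z (sf_integral S (g n) `]p, q]%classic w))).
    apply: (Ex_cos_in_prob _ mY gY cY).
    by apply: nearW => n; exact: measurable_step.
  apply: filterS => n; have [I IE ->] := Ex_cos_sym (sf_coef (g n)) z (bB n).
  move=> cI; under eq_integral do rewrite -gE.
  rewrite IE lee_fin; move: cI; rewrite -{1}(lnK c0) ltr_expR; lra.
Qed.

(** Fatou's lemma a second time, now along intervals that exhaust the domain. *)
Lemma definable_psi_le (Y : R * R -> Omega -> 'rV[R]_d) Z z c :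
  (forall p q : R, (a < p%:E)%E -> p < q -> (q%:E < b)%E ->
     is_integral P a b S f `]p, q]%classic (Y (p, q))) ->
  measurable_fun setT Z -> cvg_in_prob P (to_ends a b) Y Z -> 0 < c ->
  c < Ex P (fun w => cos (inner z (Z w))) ->
  (\int[leb]_s (Psi (zero_ext s *: z))%:E <= (- ln c / 2)%:E)%E.
Proof.
move=> hY mZ YZ c0 cZ.
have [p [q [ap qb pq pqF]]] := approach_ends ab.
have FF := to_ends_proper ab.
apply: (@fatou_le _ _ _ leb (fun n s => Psi ((\1_`]p n, q n] s * zero_ext s) *: z))
  (fun s => Psi (zero_ext s *: z))).
- move=> n; apply: measurable_psiZ; apply: measurable_funM; first exact: measurable_indic.
  exact: measurable_zero_ext.
- by apply: measurable_psiZ; exact: measurable_zero_ext.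
- by move=> *; exact: psi_ge0.
- by move=> *; exact: psi_ge0.
- apply: aeW => s.
  have [so|so] := pselect (oitv a b s); last first.
    rewrite zero_ext0//; under eq_fun do rewrite mulr0.
    exact: cvg_cst.
  have h : \forall n \near \oo, `]p n, q n]%classic s.
    have h : \forall n \near \oo, [/\ (a < (p n)%:E)%E, ((q n)%:E < b)%E, p n < q n &
        `]p n, q n]%classic s] by exact: (pqF _ (to_ends_mem ab so)).
    by apply: filterS h => n [].
  apply: cvg_near_cst; apply: filterS h => n sn.
  have -> : \1_`]p n, q n] s = 1 :> R by rewrite indicE mem_set.
  by rewrite mul1r.
- have : \forall n \near \oo, c < Ex P (fun w => cos (inner z (Y (p n, q n) w))).
    have h : \forall i \near to_ends a b, c < Ex P (fun w => cos (inner z (Y i w))).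
      apply: (Ex_cos_in_prob _ mZ YZ cZ).
      have [r [ar rb]] := real_between ab.
      exists (r, r) => // -[p' q'] /= [ap' qb' pq' _ _].
      by case: (hY p' q' ap' pq' qb').
    exact: (pqF _ h).
  by apply: filterS => n; apply: is_integral_psi_le => //; exact: hY.
Qed.

(** The characteristic function of one random vector tends to 1 at the origin,
    hence is above 1/2 on a short segment of each axis. *)
Lemma Ex_cos_small (Z : Omega -> 'rV[R]_d) : measurable_fun [set: Omega] Z ->
  exists2 e : R, 0 < e & forall t i, 0 <= t <= 1 ->
    2^-1 < Ex P (fun w => cos (inner ((t * e) *: delta_mx 0 i) (Z w))).
Proof.
move=> mZ.
have mZi i : measurable_fun [set: Omega] (fun w => Z w 0 i).
  exact: (measurableT_comp (measurable_coord i)).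
pose e n : R := n.+1%:R^-1.
have e0 n : 0 < e n by rewrite invr_gt0.
have ecvg : e @ \oo --> (0 : R) by exact: cvg_harmonic.
pose g i n w : R := 2 * Num.min ((e n * Z w 0 i) ^+ 2) 1.
have mg i n : measurable_fun [set: Omega] (g i n).
  apply: measurable_funM => //; apply: measurable_minr => //.
  by apply: measurable_funX; exact: measurable_funM.
have g2 i n w : `|g i n w| <= 2.
  rewrite ger0_norm ?mulr_ge0 ?min1_ge0 ?sqr_ge0//.
  by rewrite -[leRHS]mulr1 ler_wpM2l// ge_min lexx orbT.
have gcvg i : Ex P (g i n) @[n --> \oo] --> (0 : R).
  have -> : (0 : R) = Ex P (cst 0) by rewrite /Ex Rintegral_cst// mul0r.
  apply: (cvg_Ex (M := 2)) => //; apply: aeW => w.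
  apply: (@squeeze_cvgr _ _ _ _ (cst 0) (fun n => 2 * ((e n * Z w 0 i) * (e n * Z w 0 i)))).
  - apply: nearW => n /=; rewrite mulr_ge0 ?min1_ge0 ?sqr_ge0//=.
    by rewrite ler_wpM2l// ge_min expr2 lexx.
  - exact: cvg_cst.
  - have h : (fun n => e n * Z w 0 i) @ \oo --> 0 * Z w 0 i.
      by apply: cvgM => //; exact: cvg_cst.
    have := cvgM (cvg_cst (2 : R)) (cvgM h h); rewrite !mul0r mulr0; exact.
have [n hn] : exists n, forall i, Ex P (g i n) < 2^-1.
  have : \forall n \near \oo, forall i, Ex P (g i n) < 2^-1.
    apply: filter_forall => i; apply: (cvgr_lt _ (gcvg i)); lra.
  by move=> [N _ hN]; exists N; apply: hN => /=.
exists (e n) => // t i /andP[t0 t1].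
have mU : measurable_fun [set: Omega] (fun w => inner ((t * e n) *: delta_mx 0 i) (Z w)).
  exact: (measurableT_comp (measurable_inner _)).
suff : 1 - Ex P (fun w => cos (inner ((t * e n) *: delta_mx 0 i) (Z w))) <= Ex P (g i n).
  by have := hn i; lra.
rewrite -lee_fin -(Ex_one_sub_cos P mU) -Ex_EFin; last first.
  exact: (bounded_integrable P (mg i n) (g2 i n)).
apply: ge0_le_integral => //.
- by apply/measurable_EFinP/measurable_funB => //; exact: (measurableT_comp measurable_cos).
- exact/measurable_EFinP.
- move=> w _; rewrite lee_fin (le_trans (one_sub_cos_le_min _))// ler_wpM2l// min1_le//.
  rewrite innerZl inner_delta -mulrA exprMn -[leRHS]mul1r ler_wpM2r ?sqr_ge0//.
  by rewrite expr_le1.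
Qed.

(** The diagonal entries of [A] are read off from single vectors on the axes,
    since [psi] is at least its quadratic part.  The jump part takes whole
    segments and the average over [t]. *)
Lemma definable_finite : sym_definable P a b X Xs f ->
  (\int[leb]_s (zero_ext s ^+ 2 * \tr A)%:E < +oo)%E /\
  (\int[leb]_s \int[nu]_x (Num.min (enorm (zero_ext s *: x) ^+ 2) 1)%:E < +oo)%E.
Proof.
move=> [Y [Z [hY mZ YZ]]].
have [e e0 hZ] := Ex_cos_small mZ.
(* The bound of [definable_psi_le] for the threshold 1/2. *)
pose M : R := - ln 2^-1 / 2.
have hM t i : 0 <= t <= 1 ->
    (\int[leb]_s (Psi (zero_ext s *: ((t * e) *: delta_mx 0 i)))%:E <= M%:E)%E.
  move=> t01; apply: (definable_psi_le hY mZ YZ); first by rewrite invr_gt0.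
  exact: hZ.
have mft := measurable_zero_ext.
have mpsi z : measurable_fun [set: R] (fun s => (Psi (zero_ext s *: z))%:E).
  by apply/measurable_EFinP; apply: measurable_psiZ.
split.
  have -> : (\int[leb]_s (zero_ext s ^+ 2 * \tr A)%:E =
      \sum_i \int[leb]_s (zero_ext s ^+ 2 * A i i)%:E)%E.
    rewrite -ge0_integral_sum//.
    - by apply: eq_integral => s _; rewrite sumEFin /mxtrace mulr_sumr.
    - move=> i; apply/measurable_EFinP; apply: measurable_funM => //.
      exact: measurable_funX.
    - by move=> i s _; rewrite lee_fin mulr_ge0 ?sqr_ge0// diag_ge0.
  apply: lte_sum_pinfty => i _.
  apply: (@le_lt_trans _ _ ((2 / e ^+ 2)%:E * M%:E)%E); last by rewrite -EFinM ltry.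
  apply: (@le_trans _ _ ((2 / e ^+ 2)%:E * \int[leb]_s (Psi (zero_ext s *: ((1 * e) *: delta_mx 0 i)))%:E)%E); last first.
    rewrite lee_wpmul2l ?lee_fin ?divr_ge0 ?sqr_ge0//; apply: hM.
    by rewrite ler01 lexx.
  rewrite -ge0_integralZl//; last 3 first.
  - exact: mpsi.
  - by move=> s _; rewrite lee_fin psi_ge0.
  - by rewrite lee_fin divr_ge0 ?sqr_ge0.
  apply: ge0_le_integral => //.
  - by move=> s _; rewrite lee_fin mulr_ge0 ?sqr_ge0// diag_ge0.
  - apply/measurable_EFinP; apply: measurable_funM => //; exact: measurable_funX.
  - by apply: measurable_funeM; exact: mpsi.
  - move=> s _; rewrite psiE// scalerA mul1r quad_delta.
    apply: (@le_trans _ _ ((2 / e ^+ 2)%:E * ((zero_ext s * e) ^+ 2 * A i i / 2)%:E)%E).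
      rewrite -EFinM lee_fin le_eqVlt; apply/orP; left; apply/eqP; field.
      by rewrite gt_eqF.
    rewrite lee_wpmul2l ?lee_fin ?divr_ge0 ?sqr_ge0// leeDl//.
    by apply: integral_ge0 => x _; rewrite lee_fin one_sub_cos_ge0.
pose nu' : {sigma_finite_measure set 'rV[R]_d -> \bar R} :=
  with_sigma_finite (sigma_finite_nu nu0 nuI).
have mcoord i : measurable_fun [set: R * 'rV[R]_d] (fun p : R * 'rV[R]_d => p.2 0 i).
  exact: (measurableT_comp (measurable_coord i)).
have mf1 : measurable_fun [set: R * 'rV[R]_d] (fun p : R * 'rV[R]_d => zero_ext p.1).
  exact: (measurableT_comp mft).
apply: (@iterated_min_sqr_lty R _ _ _ _ leb nu' d
  (fun i p => e * (zero_ext p.1 * p.2 0 i))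
  (fun p => Num.min (enorm (zero_ext p.1 *: p.2) ^+ 2) 1) (Num.max 1 (e^-1 ^+ 2)) M).
- move=> i; apply: measurable_funM => //; apply: measurable_funM; [exact: mf1|exact: mcoord].
- apply: measurable_minr => //; under eq_fun do rewrite enormZ_sqr.
  apply: measurable_funM; first exact: measurable_funX.
  exact: (measurableT_comp measurable_enorm_sqr).
- by rewrite le_max ler01.
- by move=> p; rewrite min1_ge0 ?sqr_ge0.
- move=> p; rewrite enorm_sqr; apply: (le_trans (min1_sum _)).
    by move=> i; exact: sqr_ge0.
  apply: ler_sum => i _; rewrite mxE.
  rewrite -[X in Num.min (X ^+ 2) 1 <= _](mulKf (_ : e != 0)) ?gt_eqF//.
  by rewrite exprMn min1_scale// sqr_ge0.
- move=> t i t01; apply: (le_trans _ (hM t i t01)); apply: ge0_le_integral => //.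
  + by move=> s _; apply: integral_ge0 => x _; rewrite lee_fin one_sub_cos_ge0.
  + apply: (measurable_fun_fubini_tonelli_F (m2 := nu')
      (fun p : R * 'rV[R]_d => (1 - cos (t * (e * (zero_ext p.1 * p.2 0 i))))%:E)).
    * apply/measurable_EFinP/measurable_funB => //; apply: (measurableT_comp measurable_cos).
      do 2 apply: measurable_funM => //; apply: measurable_funM; [exact: mf1|exact: mcoord].
    * by move=> p; rewrite lee_fin one_sub_cos_ge0.
  + exact: mpsi.
  + move=> s _; rewrite psiE//.
    rewrite [X in (X <= _)%E](_ : _ = \int[nu]_x (1 - cos (inner (zero_ext s *: ((t * e) *: delta_mx 0 i)) x))%:E)%E.
      by rewrite leeDr// lee_fin divr_ge0.
    apply: eq_integral => x _; rewrite /= !innerZl inner_delta.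
    by congr (1 - cos _)%:E; ring.
Qed.

End symmetrized_integral.

(** * From finite energy to convergence *)

Section convergence_to_zero.
Context {R : realType}.

Lemma min1_lipschitz (x y : R) : `|Num.min x 1 - Num.min y 1| <= `|x - y|.
Proof.
have h1 := ler_norm (x - y); have h2 := ler_norm (y - x).
rewrite distrC in h2; rewrite ler_norml.
by case: (leP x 1); case: (leP y 1) => *; apply/andP; split; have := normr_ge0 (x - y); lra.
Qed.

Lemma sume_const_ge0 n (x : \bar R) : (0 <= x)%E -> (\sum_(i < n) x = n%:R%:E * x)%E.
Proof.
move=> x0; elim: n => [|n IH]; first by rewrite big_ord0 mul0e.
by rewrite big_ord_recr/= IH -natr1 EFinD ge0_muleDl ?lee_fin// mul1e.
Qed.

Lemma cvge0_le {I : Type} (F : set_system I) {FF : Filter F} (u : I -> \bar R) :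
  (forall i, (0 <= u i)%E) ->
  (forall e : R, 0 < e -> \forall i \near F, (u i <= e%:E)%E) -> u @ F --> 0%E.
Proof.
move=> u0 h; apply/fine_cvgP; split.
  apply: filterS (h 1 ltr01) => i ui.
  by rewrite ge0_fin_numE// (le_lt_trans ui)// ltry.
apply/cvgrPdist_le => e e0; apply: filterS (h e e0) => i ui.
rewrite sub0r normrN ger0_norm ?fine_ge0// -lee_fin fineK//.
by rewrite ge0_fin_numE// (le_lt_trans ui)// ltry.
Qed.

(** Adding the remaining geometric sum makes the sequence nonincreasing, and
    subtracting it makes it nondecreasing. *)
Lemma cvg_geometric_steps (x : nat -> R) (N : nat) :
  (forall j, (N <= j)%N -> `|x j.+1 - x j| <= 2^-1 ^+ j) -> cvgn x.
Proof.
move=> hx; suff /cvg_ex[l hl] : cvgn (fun j => x (j + N)%N).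
  by apply/cvg_ex; exists l; rewrite -(cvg_shiftn N).
pose g (j : nat) : R := 2 * 2^-1 ^+ (j + N).
have gS j : g j.+1 = g j - 2^-1 ^+ (j + N) by rewrite /g addSn exprS; lra.
have g0 j : 0 <= g j by rewrite mulr_ge0// exprn_ge0// invr_ge0.
have step j : `|x (j.+1 + N)%N - x (j + N)%N| <= g j - g j.+1.
  by rewrite addSn gS opprB addrCA subrr addr0 hx// leq_addl.
have cg : g @ \oo --> 0.
  rewrite -(mulr0 2); apply: cvgM; first exact: cvg_cst.
  rewrite (cvg_shiftn N (fun j => 2^-1 ^+ j : R)).
  by apply: cvg_expr; rewrite gtr0_norm//; lra.
have cy : cvgn (fun j => x (j + N)%N + g j).
  apply: nonincreasing_is_cvgn.
    apply/nonincreasing_seqP => j.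
    by have := step j; rewrite ler_norml => /andP[]; lra.
  exists (x N - g 0%N) => _ [j _ <-].
  have : nondecreasing_seq (fun j => x (j + N)%N - g j).
    apply/nondecreasing_seqP => i.
    by have := step i; rewrite ler_norml => /andP[]; lra.
  by move=> /(_ 0%N j (leq0n j)); rewrite add0n; have := g0 j; lra.
have -> : (fun j => x (j + N)%N) = (fun j => (x (j + N)%N + g j) - g j).
  by apply/funext => j; rewrite addrK.
apply: is_cvgB => //; apply/cvg_ex; exists 0; exact: cg.
Qed.

End convergence_to_zero.

Section truncated_distance.
Context {R : realType} {d : nat} {disp : measure_display}
  {Omega : measurableType disp} (P : probability Omega R).
Implicit Types (Y Z V : Omega -> 'rV[R]_d).

(** Convergence in probability is convergence to 0 of this truncated mean square
    distance, which needs no moments. *)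
Definition gap Y Z : \bar R := (\int[P]_w (Num.min (enorm (Y w - Z w) ^+ 2) 1)%:E)%E.

Lemma gap_ge0 Y Z : (0 <= gap Y Z)%E.
Proof. by apply: integral_ge0 => w _; rewrite lee_fin min1_ge0 ?sqr_ge0. Qed.

Lemma enorm_sqrD (x y : 'rV[R]_d) :
  enorm (x + y) ^+ 2 <= 2 * enorm x ^+ 2 + 2 * enorm y ^+ 2.
Proof.
rewrite !enorm_sqr !mulr_sumr -big_split/=; apply: ler_sum => i _; rewrite mxE.
by have := sqr_ge0 (x 0 i - y 0 i); nra.
Qed.

Lemma min1_enorm_sqrD (x y : 'rV[R]_d) : Num.min (enorm (x + y) ^+ 2) 1 <=
  2 * Num.min (enorm x ^+ 2) 1 + 2 * Num.min (enorm y ^+ 2) 1.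
Proof.
have := enorm_sqrD x y; have := sqr_ge0 (enorm x); have := sqr_ge0 (enorm y).
by case: (leP (enorm x ^+ 2) 1); case: (leP (enorm y ^+ 2) 1);
  case: (leP (enorm (x + y) ^+ 2) 1); lra.
Qed.

Lemma measurable_gap Y Z : measurable_fun [set: Omega] Y -> measurable_fun [set: Omega] Z ->
  measurable_fun [set: Omega] (fun w => (Num.min (enorm (Y w - Z w) ^+ 2) 1)%:E).
Proof.
by move=> mY mZ; apply: measurable_min_sqr; exact: measurable_enorm_sub.
Qed.

Lemma gap_triangle V Y Z : measurable_fun [set: Omega] Y ->
  measurable_fun [set: Omega] V -> measurable_fun [set: Omega] Z ->
  (gap Y Z <= 2%:E * gap Y V + 2%:E * gap V Z)%E.
Proof.
move=> mY mV mZ; have min0 (U W : Omega -> 'rV[R]_d) w :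
    (0 <= (Num.min (enorm (U w - W w) ^+ 2) 1)%:E)%E by rewrite lee_fin min1_ge0 ?sqr_ge0.
have mYV := measurable_gap mY mV; have mVZ := measurable_gap mV mZ.
rewrite /gap -!ge0_integralZl// -ge0_integralD//; last 4 first.
- by move=> w _; rewrite mule_ge0.
- exact: measurable_funeM.
- by move=> w _; rewrite mule_ge0.
- exact: measurable_funeM.
apply: ge0_le_integral => //.
- exact: measurable_gap.
- by apply: emeasurable_funD; exact: measurable_funeM.
- move=> w _; rewrite -!EFinM -EFinD lee_fin.
  have -> : Y w - Z w = (Y w - V w) + (V w - Z w) by rewrite addrA subrK.
  exact: min1_enorm_sqrD.
Qed.

Lemma gapC Y Z : gap Y Z = gap Z Y.
Proof. by apply: eq_integral => w _; rewrite -enormN opprB. Qed.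

Lemma prob_le_gap Y Z (e : R) : measurable_fun [set: Omega] Y ->
  measurable_fun [set: Omega] Z -> 0 < e ->
  (P [set w | (e < enorm (Y w - Z w))%R] <= (Num.max 1 (e^-1 ^+ 2))%:E * gap Y Z)%E.
Proof.
move=> mY mZ e0; have mS := measurable_enorm_gt e mY mZ.
have k0 : 0 <= Num.max 1 (e^-1 ^+ 2) by rewrite le_max ler01.
rewrite -(setIT [set w | _]) -integral_indic//.
rewrite /gap -ge0_integralZl//; last 2 first.
- exact: measurable_gap.
- by move=> w _; rewrite lee_fin min1_ge0 ?sqr_ge0.
apply: ge0_le_integral => //.
- by apply/measurable_EFinP; exact: measurable_indic.
- by apply: measurable_funeM; exact: measurable_gap.
- move=> w _; rewrite -EFinM lee_fin indicE.
  have [h|_] := boolP (w \in _); last by apply: mulr_ge0; rewrite ?min1_ge0 ?sqr_ge0.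
  rewrite inE/= in h; apply: le_trans (min1_scale _ (sqr_ge0 _)).
  rewrite le_min lexx andbT -exprMn expr_ge1 ?mulr_ge0 ?invr_ge0 ?(ltW e0) ?enorm_ge0//.
  by rewrite mulrC ler_pdivlMr// mul1r ltW.
Qed.

Lemma cvg_in_prob_gap {I : Type} (F : set_system I) {FF : Filter F}
    (Y : I -> Omega -> 'rV[R]_d) Z :
  (\forall i \near F, measurable_fun [set: Omega] (Y i)) -> measurable_fun [set: Omega] Z ->
  gap (Y i) Z @[i --> F] --> 0%E -> cvg_in_prob P F Y Z.
Proof.
move=> mY mZ YZ e e0.
apply: (@squeeze_cvge _ _ _ _ (cst 0%E) _ (fun i => (Num.max 1 (e^-1 ^+ 2))%:E * gap (Y i) Z)%E).
- by apply: filterS mY => i mYi; rewrite measure_ge0 prob_le_gap.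
- exact: cvg_cst.
- by rewrite -(mule0 (Num.max 1 (e^-1 ^+ 2))%:E); apply: cvgeZl.
Qed.

(** Fatou's lemma: the truncated distance is lower semicontinuous under almost
    sure convergence. *)
Lemma gap_lim_le Y (V : nat -> Omega -> 'rV[R]_d) Z (M : \bar R) :
  measurable_fun [set: Omega] Y -> (forall n, measurable_fun [set: Omega] (V n)) ->
  measurable_fun [set: Omega] Z ->
  {ae P, forall w, forall i, (V n w 0 i) @[n --> \oo] --> Z w 0 i} ->
  (\forall n \near \oo, (gap Y (V n) <= M)%E) -> (gap Y Z <= M)%E.
Proof.
move=> mY mV mZ VZ hM.
apply: (fatou_le (h_ := fun n w => Num.min (enorm (Y w - V n w) ^+ 2) 1)
  (h := fun w => Num.min (enorm (Y w - Z w) ^+ 2) 1)) hM.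
- by move=> n; apply/measurable_EFinP; exact: measurable_gap.
- by apply/measurable_EFinP; exact: measurable_gap.
- by move=> n w; rewrite min1_ge0 ?sqr_ge0.
- by move=> w; rewrite min1_ge0 ?sqr_ge0.
- apply: filterS VZ => w hw.
  have h : (fun n => enorm (Y w - V n w) ^+ 2) @ \oo --> enorm (Y w - Z w) ^+ 2.
    rewrite enorm_sqr; under eq_fun do rewrite enorm_sqr.
    apply: cvg_big => [|i _]; first exact: add_continuous.
    rewrite !mxE; have hi : (fun n => (Y w - V n w) 0 i) @ \oo --> Y w 0 i - Z w 0 i.
      under eq_fun do rewrite !mxE.
      by apply: cvgB; [exact: cvg_cst|exact: hw].
    exact: (cvgM hi hi).
  apply/cvgrPdist_lt => e e0; move/cvgrPdist_lt : h => /(_ e e0).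
  by apply: filterS => n; apply: le_lt_trans; exact: min1_lipschitz.
Qed.

(** A subsequence with fast decreasing distances converges almost surely by the
    Borel-Cantelli lemma.  The Cauchy estimate then passes to the limit by lower
    semicontinuity. *)
Lemma gap_complete (Y : nat -> Omega -> 'rV[R]_d) :
  (forall n, measurable_fun [set: Omega] (Y n)) ->
  (forall e : R, 0 < e -> exists N, forall m n, (N <= m)%N -> (N <= n)%N ->
     (gap (Y m) (Y n) <= e%:E)%E) ->
  exists Z, measurable_fun [set: Omega] Z /\ gap (Y n) Z @[n --> \oo] --> 0%E.
Proof.
move=> mY cY.
have /choice[K hK] : forall j : nat, exists N, forall m n, (N <= m)%N -> (N <= n)%N ->
    (gap (Y m) (Y n) <= (8^-1 ^+ j)%:E)%E.
  by move=> j; apply: cY; rewrite exprn_gt0.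
(* At least j, at least K j and nondecreasing. *)
pose k j := (j + \sum_(i < j.+1) K i)%N.
have kK j : (K j <= k j)%N by rewrite /k big_ord_recr/= addnA leq_addl.
have kS j : (k j <= k j.+1)%N.
  by rewrite /k [X in (_ <= _ + X)%N]big_ord_recr/= leq_add// leq_addr.
(* Markov's inequality costs a factor 4^j, which turns 8^-j into 2^-j. *)
pose F j : set Omega := [set w | 2^-1 ^+ j < enorm (Y (k j.+1) w - Y (k j) w)].
have h0 j : 0 < (2^-1 : R) ^+ j by rewrite exprn_gt0.
have mF j : measurable (F j) by exact: measurable_enorm_gt.
have PF j : (P (F j) <= (2^-1 ^+ j)%:E)%E.
  apply: (le_trans (prob_le_gap (mY _) (mY _) (h0 j))).
  have -> : Num.max 1 ((2^-1 ^+ j)^-1 ^+ 2) = 4 ^+ j :> R.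
    rewrite max_r -exprVn invrK exprAC -natrX//.
    by rewrite exprn_ege1// ler1n.
  apply: (@le_trans _ _ ((4 ^+ j)%:E * (8^-1 ^+ j)%:E)%E).
    rewrite lee_wpmul2l ?lee_fin ?exprn_ge0//; apply: hK => //.
    exact: leq_trans (kK j) (kS j).
  by rewrite -EFinM -exprMn lee_fin (_ : 4 * 8^-1 = 2^-1)//; lra.
have sF : (\sum_(j <oo) P (F j) < +oo)%E.
  apply: (@le_lt_trans _ _ (\sum_(j <oo) (2^-1 ^+ j)%:E)%E).
    by apply: lee_nneseries => // j _.
  have := @cvg_geometric_eseries_half R 2 0 => /(cvg_lim (@ereal_hausdorff R)).
  rewrite /eseries expr0 divr1 => h; rewrite [ltLHS](_ : _ = 2%:E) ?ltry// -h.
  congr (limn _); apply/funext => n; apply: eq_bigr => j _.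
  by rewrite addn1 expnS natrM natrX invfM mulrA divff// mul1r exprVn.
have hF : {ae P, forall w, exists N, forall j, (N <= j)%N -> ~ F j w}.
  exists (lim_sup_set F); split.
  - by apply: bigcap_measurable => // n _; apply: bigcup_measurable.
  - exact: lim_sup_set_cvg0.
  - move=> w /= hw n _; apply: contrapT => hn; apply: hw; exists n => j nj Fj.
    by apply: hn; exists j.
pose Z w : 'rV[R]_d := \row_i fine (limn_esup (fun j => (Y (k j) w 0 i)%:E)).
have mZ : measurable_fun [set: Omega] Z.
  apply: measurable_rV => i; under eq_fun do rewrite mxE.
  apply: (measurableT_comp (f := fine)) => //.
  apply: measurable_fun_limn_esup => j.
  by apply/measurable_EFinP; apply: (measurableT_comp (measurable_coord i)).
have YZ : {ae P, forall w, forall i, (Y (k n) w 0 i) @[n --> \oo] --> Z w 0 i}.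
  apply: filterS hF => w [N hN] i.
  have : cvgn (fun n => Y (k n) w 0 i).
    apply: (@cvg_geometric_steps _ _ N) => j Nj.
    have := hN j Nj; rewrite /F/= => /negP; rewrite -leNgt; apply: le_trans.
    by have := coord_le_enorm (Y (k j.+1) w - Y (k j) w) i; rewrite !mxE.
  move=> /cvg_ex[l hl]; rewrite mxE.
  have -> : limn_esup (fun j => (Y (k j) w 0 i)%:E) = l%:E.
    apply: (cvg_limn_einf_sup (u := fun n => (Y (k n) w 0 i)%:E) _).2.
    by apply: cvg_EFin => //; exact: nearW.
  exact: hl.
exists Z; split => //; apply: cvge0_le => [n|e e0]; first exact: gap_ge0.
have [N hN] := cY e e0.
exists N => // n /= Nn; apply: (gap_lim_le _ _ _ YZ) => //.
have : \forall j \near \oo, (N <= k j)%N.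
  by exists N => // j /= Nj; rewrite (leq_trans Nj)// leq_addr.
by apply: filterS => j Nj; exact: hN.
Qed.

End truncated_distance.

Section simple_approximation.
Import HBSimple HBNNSimple.
Context {R : realType} (a b : \bar R).
Hypothesis ab : (a < b)%E.

Lemma simple_fun_restrict (h : {sfun R >-> R}) (p q : R) :
  `]p, q]%classic `<=` oitv a b ->
  exists g : simple_fun a b, (forall j, bounded_Borel (sf_set g j)) /\
    forall s, sf_eval g s = \1_`]p, q] s * h s.
Proof.
move=> pq; pose V : seq R := finmap.enum_fset (fset_set (h @` setT)).
have mV (j : 'I_(size V)) : measurable (`]p, q]%classic `&` h @^-1` [set V`_j]).
  by apply: measurableI => //; exact: measurable_funPTI.
have sV (j : 'I_(size V)) : `]p, q]%classic `&` h @^-1` [set V`_j] `<=` oitv a b.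
  by apply: subset_trans pq; exact: subIsetl.
have tV : trivIset [set: 'I_(size V)] (fun j : 'I_(size V) => `]p, q]%classic `&` h @^-1` [set V`_j]).
  move=> i j _ _ [s [[_ /= hi] [_ /= hj]]]; apply: val_inj.
  by apply/eqP; rewrite -(nth_uniq 0 (ltn_ord i) (ltn_ord j) (finmap.fset_uniq (fset_set (h @` setT)))) -hi -hj.
exists (@Defs.SimpleFun _ _ _ (size V) (fun j => V`_j) _ mV sV tV); split => /=.
  move=> j; apply: (bounded_Borel_sub _ _ (bounded_Borel_itv p q)); last exact: subIsetl.
  exact: mV.
move=> s; rewrite /sf_eval/= (fimfunEord h s) mulr_sumr.
by apply: eq_bigr => j _; rewrite indicI /= mulrCA.
Qed.

(** The positive and the negative part are approximated from below separately, so
    that the approximants lie between 0 and [F] and dominated convergence can use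
    the energy of [F]. *)
Lemma sfun_approximation (F : R -> R) : measurable_fun [set: R] F ->
  exists h : {sfun R >-> R}^nat, [/\ forall n s, `|h n s| <= `|F s|,
    forall n s, `|h n s - F s| <= `|F s| & forall s, h n s @[n --> \oo] --> F s].
Proof.
move=> mF.
pose Fp s : R := Num.max (F s) 0; pose Fn s : R := Num.max (- F s) 0.
have mp : measurable_fun [set: R] (EFin \o Fp).
  by apply/measurable_EFinP; exact: measurable_maxr.
have mn : measurable_fun [set: R] (EFin \o Fn).
  by apply/measurable_EFinP; apply: measurable_maxr => //; exact: measurable_funN.
pose u := nnsfun_approx measurableT mp.
pose v := nnsfun_approx measurableT mn.
have p0 s : setT s -> (0 <= (EFin \o Fp) s)%E.
  by move=> _; rewrite lee_fin le_max lexx orbT.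
have n0 s : setT s -> (0 <= (EFin \o Fn) s)%E.
  by move=> _; rewrite lee_fin le_max lexx orbT.
have uF n s : 0 <= u n s <= Num.max (F s) 0.
  rewrite fun_ge0/= -lee_fin nnsfun_approxE.
  exact: (le_approx n p0 (I : setT s)).
have vF n s : 0 <= v n s <= Num.max (- F s) 0.
  rewrite fun_ge0/= -lee_fin nnsfun_approxE.
  exact: (le_approx n n0 (I : setT s)).
have cu s : u n s @[n --> \oo] --> Num.max (F s) 0.
  by have := cvg_nnsfun_approx measurableT mp p0 (I : setT s) => /fine_cvgP[_].
have cv s : v n s @[n --> \oo] --> Num.max (- F s) 0.
  by have := cvg_nnsfun_approx measurableT mn n0 (I : setT s) => /fine_cvgP[_].
rewrite /Fp in uF cu; rewrite /Fn in vF cv.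
exists (fun n => u n \+ cst (-1) \* v n); split.
- move=> n s; rewrite /= mulN1r; have /andP[] := uF n s; have /andP[] := vF n s.
  have := ler_norm (F s); have := ler_norm (- F s); rewrite normrN ler_norml.
  case: (leP (F s) 0); case: (leP (- F s) 0) => *; apply/andP; split; lra.
- move=> n s; rewrite /= mulN1r; have /andP[] := uF n s; have /andP[] := vF n s.
  have := ler_norm (F s); have := ler_norm (- F s); rewrite normrN ler_norml.
  case: (leP (F s) 0); case: (leP (- F s) 0) => *; apply/andP; split; lra.
- move=> s; have -> : F s = Num.max (F s) 0 - Num.max (- F s) 0.
    by case: (leP (F s) 0); case: (leP (- F s) 0); lra.
  by under eq_fun do rewrite /= mulN1r; apply: cvgB.
Qed.

(** Cutting down to an interval with finite end points makes the sets of the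
    simple functions bounded, so that [X] has values on them. *)
Lemma simple_approximation (F : R -> R) : measurable_fun [set: R] F ->
  (forall s, ~ oitv a b s -> F s = 0) ->
  exists g : nat -> simple_fun a b, [/\ forall n j, bounded_Borel (sf_set (g n) j),
    forall n s, `|sf_eval (g n) s| <= `|F s|,
    forall n s, `|sf_eval (g n) s - F s| <= `|F s| &
    forall s, sf_eval (g n) s @[n --> \oo] --> F s].
Proof.
move=> mF F0.
have [h [h1 h2 h3]] := sfun_approximation mF.
have [p [q [ap qb pq pqF]]] := approach_ends ab.
have /choice[g hg] : forall n, exists g : simple_fun a b,
    (forall j, bounded_Borel (sf_set g j)) /\
    forall s, sf_eval g s = \1_`]p n, q n] s * h n s.
  by move=> n; apply: simple_fun_restrict; exact: itv_sub_oitv.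
have gE n s : sf_eval (g n) s = \1_`]p n, q n] s * h n s := (hg n).2 s.
exists g; split => [n|n s|n s|s].
- exact: (hg n).1.
- rewrite gE normrM indicE; case: (_ \in _); first by rewrite normr1 mul1r h1.
  by rewrite normr0 mul0r.
- rewrite gE indicE; case: (_ \in _); first by rewrite mul1r h2.
  by rewrite mul0r sub0r normrN.
- have [so|so] := pselect (oitv a b s); last first.
    have gs n : sf_eval (g n) s = F s.
      have := h1 n s; rewrite gE F0// normr0 normr_le0 => /eqP ->.
      by rewrite mulr0.
    by under eq_fun do rewrite gs; exact: cvg_cst.
  have hn : \forall n \near \oo, [/\ (a < (p n)%:E)%E, ((q n)%:E < b)%E, p n < q n &
        `]p n, q n]%classic s] by exact: (pqF _ (to_ends_mem ab so)).
  apply: cvg_trans (h3 s); apply: near_eq_cvg.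
  by apply: filterS hn => n [_ _ _ sn]; rewrite gE indicE mem_set// mul1r.
Qed.

End simple_approximation.

Section sufficiency.
Context {R : realType} {d : nat} (a b : \bar R).
Hypothesis ab : (a < b)%E.
Variables (mu : probability 'rV[R]_d R) (A : 'M[R]_d)
  (nu : {measure set 'rV[R]_d -> \bar R}) (gam : 'rV[R]_d).
Hypothesis qA : forall z, 0 <= quad A z.
Hypothesis nu0 : nu [set 0] = 0%E.
Hypothesis nuI : (\int[nu]_x (Num.min (enorm x ^+ 2) 1)%:E < +oo)%E.
Hypothesis hC : is_cumulant mu (LK_exponent A nu gam).
Context {disp : measure_display} {Omega : measurableType disp}
  (P : probability Omega R) (X Xs : set R -> Omega -> 'rV[R]_d).
Hypotheses (hX : is_random_measure P mu X) (hXs : is_random_measure P mu Xs).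
Hypothesis hindep : rm_indep P X Xs.
Local Notation leb := (@lebesgue_measure R).
Local Notation e := (levy_energy A nu).
Local Notation S := (fun (B : set R) w => X B w - Xs B w).

Let measurable_e d1 (T : measurableType d1) (u : T -> R) : measurable_fun [set: T] u ->
  measurable_fun [set: T] (fun s => e (u s)).
Proof. by move=> mu'; apply: measurableT_comp mu'; exact: measurable_levy_energy. Qed.

Let e_ge0 r : (0 <= e r)%E.
Proof. exact: levy_energy_ge0. Qed.

(** The bound by averages of one minus cosine is applied with the probability as
    the measure, coordinate by coordinate.  By [Ex_cos_sym] the integrand is
    1 - exp (- 2 I) <= 2 I, where [I] is an integral of [psi]. *)
Lemma gap_step_le (J : finType) (B : J -> set R) (r : J -> R) :
  (forall j, bounded_Borel (B j)) ->
  (\int[P]_w (Num.min (enorm (\sum_j r j *: S (B j) w) ^+ 2) 1)%:E <=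
   (96 * d%:R)%:E * \int[leb]_s e (\sum_j r j * \1_(B j) s))%E.
Proof.
move=> bB; pose D w := \sum_j r j *: S (B j) w; pose g s : R := \sum_j r j * \1_(B j) s.
have mD : measurable_fun [set: Omega] D by exact: (measurable_step hX hXs).
have mDi i : measurable_fun [set: Omega] (fun w => D w 0 i).
  exact: (measurableT_comp (measurable_coord i)).
have mg : measurable_fun [set: R] g.
  apply: measurable_sum => j; apply: measurable_funM => //.
  by apply: measurable_indic; exact: (bB j).1.
have mi i : measurable_fun [set: Omega] (fun w => (Num.min (D w 0 i ^+ 2) 1)%:E).
  exact: measurable_min_sqr.
have mi0 i w : (0 <= (Num.min (D w 0 i ^+ 2) 1)%:E)%E by rewrite lee_fin min1_ge0 ?sqr_ge0.
have hi i : (\int[P]_w (Num.min (D w 0 i ^+ 2) 1)%:E <= 96%:E * \int[leb]_s e (g s))%E.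
  rewrite (_ : 96 = 24 * 4 :> R) ?EFinM -?muleA; last by lra.
  apply: integral_min_sqr_le => // t /andP[t0 t1].
  have [I IE EI] := Ex_cos_sym qA nuI hC hX hXs hindep r (t *: delta_mx 0 i) bB.
  have mU : measurable_fun [set: Omega] (fun w => inner (t *: delta_mx 0 i) (D w)).
    exact: (measurableT_comp (measurable_inner _)).
  rewrite (_ : (\int[P]_w (1 - cos (t * D w 0 i))%:E =
      \int[P]_w (1 - cos (inner (t *: delta_mx 0%R i) (D w)))%:E)%E); last first.
    by apply: eq_integral => w _; rewrite innerZl inner_delta.
  rewrite Ex_one_sub_cos// EI.
  apply: (@le_trans _ _ (2%:E * I%:E)%E).
    by rewrite -EFinM lee_fin; have := expR_ge1Dx (- (2 * I)); lra.
  rewrite (_ : 4 = 2 * 2 :> R) ?EFinM -?muleA; last by lra.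
  rewrite lee_pmul2l// -IE -ge0_integralZl//; last exact: measurable_e.
  apply: ge0_le_integral => //.
  - by move=> s _; rewrite lee_fin; exact: psi_ge0.
  - by apply/measurable_EFinP; exact: (measurable_psiZ hC).
  - by apply: measurable_funeM; exact: measurable_e.
  - move=> s _; have := psi_axis_le gam qA nuI (g s) t i.
    by rewrite (max_idPl _) ?mulr1// expr_le1.
apply: (@le_trans _ _ (\int[P]_w \sum_i (Num.min (D w 0 i ^+ 2) 1)%:E)%E).
  apply: ge0_le_integral => //.
  - by move=> w _; rewrite lee_fin min1_ge0 ?sqr_ge0.
  - by apply: measurable_min_sqr; exact: (measurableT_comp measurable_enorm).
  - exact: emeasurable_sum.
  - move=> w _; rewrite sumEFin lee_fin -/(D w) enorm_sqr; apply: min1_sum => i.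
    exact: sqr_ge0.
rewrite ge0_integral_sum//.
apply: (@le_trans _ _ (\sum_(i < d) (96%:E * \int[leb]_s e (g s)))%E).
  by apply: lee_sum => i _; exact: hi.
rewrite sume_const_ge0; last by rewrite mule_ge0// integral_ge0.
by rewrite muleA -EFinM mulrC.
Qed.

(** The difference of the two integrals is one step integral, indexed by the
    disjoint sum of the two index sets, whose sets may overlap. *)
Lemma gap_integral_le (g1 g2 : simple_fun a b) (B1 B2 : set R) :
  measurable B1 -> measurable B2 ->
  (forall j, bounded_Borel (sf_set g1 j)) -> (forall j, bounded_Borel (sf_set g2 j)) ->
  (gap P (sf_integral S g1 B1) (sf_integral S g2 B2) <= (96 * d%:R)%:E *
    \int[leb]_s e (\1_B1 s * sf_eval g1 s - \1_B2 s * sf_eval g2 s))%E.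
Proof.
move=> mB1 mB2 b1 b2.
pose B (j : 'I_(sf_size g1) + 'I_(sf_size g2)) := match j with
  inl i => B1 `&` sf_set g1 i | inr i => B2 `&` sf_set g2 i end.
pose r (j : 'I_(sf_size g1) + 'I_(sf_size g2)) := match j with
  inl i => sf_coef g1 i | inr i => - sf_coef g2 i end.
have bB j : bounded_Borel (B j).
  case: j => i /=.
    apply: (bounded_Borel_sub _ _ (b1 i)); last exact: subIsetr.
    by apply: measurableI => //; exact: sf_measurable.
  apply: (bounded_Borel_sub _ _ (b2 i)); last exact: subIsetr.
  by apply: measurableI => //; exact: sf_measurable.
have -> : (gap P (sf_integral S g1 B1) (sf_integral S g2 B2) =
    \int[P]_w (Num.min (enorm (\sum_j r j *: S (B j) w) ^+ 2) 1)%:E)%E.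
  apply: eq_integral => w _; congr (Num.min (enorm _ ^+ 2) 1)%:E.
  rewrite big_sumType/= /sf_integral -sumrN; congr (_ + _).
  by apply: eq_bigr => i _; rewrite scaleNr.
have -> : (\int[leb]_s e (\1_B1 s * sf_eval g1 s - \1_B2 s * sf_eval g2 s) =
    \int[leb]_s e (\sum_j r j * \1_(B j) s)%R)%E.
  apply: eq_integral => s _; congr e.
  rewrite big_sumType/= /sf_eval !mulr_sumr -sumrN; congr (_ + _); apply: eq_bigr => i _.
    by rewrite indicI /= mulrCA.
  by rewrite indicI /= mulNr mulrCA.
exact: gap_step_le.
Qed.

Variable f : R -> R.
Hypothesis mf : measurable_fun (oitv a b) f.
Hypothesis fI : (\int[leb]_s e (zero_ext a b f s) < +oo)%E.
Local Notation F := (zero_ext a b f).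

Lemma cvg_integral_energy (u : nat -> R -> R) :
  (forall n, measurable_fun [set: R] (u n)) -> (forall n s, `|u n s| <= `|F s|) ->
  (forall s, u n s @[n --> \oo] --> 0) -> (\int[leb]_s e (u n s))%E @[n --> \oo] --> 0%E.
Proof.
move=> mu_ uF u0.
have mF : measurable_fun [set: R] F by exact: measurable_zero_ext.
have [|||||_ _ h] := @dominated_convergence _ _ _ leb setT measurableT
  (fun n s => e (u n s)) (cst 0%E) (fun s => e (F s)).
- by move=> n; apply: measurable_e; exact: mu_.
- exact: measurable_cst.
- by apply: aeW => s _; apply: (cvg_levy_energy qA nuI (M := F s)).
- apply/integrableP; split; first exact: measurable_e.
  by under eq_integral do rewrite gee0_abs//.
- by apply: aeW => s n _; rewrite gee0_abs//; exact: levy_energy_le.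
by move: h; rewrite integral_cst// mul0e; apply.
Qed.

Definition tail_energy (pq : R * R) : \bar R :=
  (\int[leb]_s e ((\1_(oitv a b) s - \1_`]pq.1, pq.2] s) * F s))%E.

(** Dominated convergence along one sequence of intervals, and then monotonicity
    for all pairs beyond a member of that sequence. *)
Lemma cvg_tail_energy : tail_energy pq @[pq --> to_ends a b] --> 0%E.
Proof.
have FF := to_ends_proper ab.
have mF : measurable_fun [set: R] F by exact: measurable_zero_ext.
have mind (p q : R) : measurable_fun [set: R] (fun s => (\1_(oitv a b) s - \1_`]p, q] s) * F s).
  apply: measurable_funM => //; apply: measurable_funB; apply: measurable_indic => //.
  exact: measurable_oitv.
have [p [q [ap qb pq pqF]]] := approach_ends ab.
have ind1 (p' q' : R) s : `|\1_(oitv a b) s - \1_`]p', q'] s| <= 1 :> R.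
  rewrite !indicE.
  by case: (s \in _); case: (s \in _); rewrite ?subrr ?subr0 ?sub0r ?normrN ?normr0 ?normr1.
have cT : tail_energy (p n, q n) @[n --> \oo] --> 0%E.
  apply: cvg_integral_energy => [n|n s|s]; first exact: mind.
    by rewrite normrM -[leRHS]mul1r; apply: ler_wpM2r => //; exact: ind1.
  have [so|so] := pselect (oitv a b s); last first.
    by under eq_fun do rewrite (zero_ext0 f so) mulr0; exact: cvg_cst.
  have hn : \forall n \near \oo, [/\ (a < (p n)%:E)%E, ((q n)%:E < b)%E, p n < q n &
        `]p n, q n]%classic s] by exact: (pqF _ (to_ends_mem ab so)).
  apply: cvg_near_cst; apply: filterS hn => n [_ _ _ sn].
  by rewrite !indicE !mem_set//= subrr mul0r.
apply: cvge0_le => [pq'|eps eps0]; first exact: integral_ge0.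
have [n hn] : exists n, (tail_energy (p n, q n) <= eps%:E)%E.
  move: cT => /fine_cvgP[[N1 _ h1] /cvgrPdist_le/(_ eps eps0)[N2 _ h2]].
  exists (maxn N1 N2); rewrite -[leLHS]fineK ?h1//= ?leq_maxl// lee_fin.
  by have := h2 (maxn N1 N2) (leq_maxr _ _); rewrite sub0r normrN; apply: le_trans; exact: ler_norm.
exists (p n, q n); first by split; [exact: ap|exact: qb].
move=> [p' q'] [/= ap' qb' _ pp qq].
apply: le_trans hn; apply: ge0_le_integral => //.
- by apply: measurable_e; exact: mind.
- by apply: measurable_e; exact: mind.
- move=> s _; apply: levy_energy_le => //; rewrite !normrM ler_wpM2r//.
  rewrite !indicE.
  have [so|so] := boolP (s \in oitv a b); last first.
    have h (p0 q0 : R) : (a < p0%:E)%E -> (q0%:E < b)%E -> (s \in `]p0, q0]%classic) = false.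
      move=> ap0 qb0; apply/negbTE; apply: contra so; rewrite !inE; exact: itv_sub_oitv.
    by rewrite /= !h.
  have [sn|sn] := boolP (s \in `]p n, q n]%classic); last first.
    by rewrite subr0 normr1; case: (s \in _); rewrite ?subrr ?subr0 ?normr0 ?normr1.
  rewrite mem_set ?subrr//; move: sn; rewrite inE/= !in_itv/= => /andP[s1 s2].
  by rewrite (le_lt_trans pp s1) (le_trans s2 qq).
Qed.

(** One sequence of simple functions serves all Borel sets, so that the limits
    over an interval and over the whole domain can be compared through their
    approximants, uniformly in [n]. *)
Lemma finite_definable : sym_definable P a b X Xs f.
Proof.
have mF : measurable_fun [set: R] F by exact: measurable_zero_ext.
have FF := to_ends_proper ab.
have moi : measurable (oitv a b) by exact: measurable_oitv.
have [g [bg gF gFF cg]] := simple_approximation ab mF (@zero_ext0 _ a b f).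
have mg n : measurable_fun [set: R] (sf_eval (g n)).
  apply: measurable_sum => j; apply: measurable_funM => //.
  by apply: measurable_indic; exact: sf_measurable.
have mind (B : set R) : measurable B -> measurable_fun [set: R] (\1_B : R -> R).
  by move=> mB; exact: measurable_indic.
have mgB n (B : set R) : measurable B ->
    measurable_fun [set: R] (fun s => \1_B s * sf_eval (g n) s : R).
  by move=> mB; apply: measurable_funM; [exact: mind|exact: mg].
have mgF n : measurable_fun [set: R] (fun s => sf_eval (g n) s - F s).
  by apply: measurable_funB; [exact: mg|exact: mF].
pose c : R := 96 * d%:R; have c0 : 0 <= c by rewrite mulr_ge0.
pose D n := (\int[leb]_s e (sf_eval (g n) s - F s))%E.
have D0 n : (0 <= D n)%E by exact: integral_ge0.
have cD : D n @[n --> \oo] --> 0%E.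
  apply: cvg_integral_energy => [n|n s|s]; [exact: mgF|exact: gFF|].
  by rewrite -(subrr (F s)); apply: cvgB => //; exact: cvg_cst.
(* Restriction to B only decreases the energy, so one bound serves all B. *)
have gapD B m n : measurable B -> (gap P (sf_integral S (g m) B) (sf_integral S (g n) B) <=
    c%:E * (4%:E * (D m + D n)))%E.
  move=> mB; apply: (le_trans (gap_integral_le mB mB (bg m) (bg n))).
  rewrite lee_wpmul2l ?lee_fin// -ge0_integralD//; last 2 first.
  - by apply: measurable_e; exact: mgF.
  - by apply: measurable_e; exact: mgF.
  rewrite -ge0_integralZl//; last 2 first.
  - by apply: emeasurable_funD; apply: measurable_e; exact: mgF.
  - by move=> s _; exact: adde_ge0.
  apply: ge0_le_integral => //.
  - by apply: measurable_e; apply: measurable_funB; exact: mgB.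
  - by apply: measurable_funeM; apply: emeasurable_funD; apply: measurable_e; exact: mgF.
  - move=> s _; apply: (@le_trans _ _ (e (sf_eval (g m) s - F s + (F s - sf_eval (g n) s)))).
      apply: levy_energy_le => //; rewrite addrA subrK -mulrBr normrM ler_piMl//.
      by rewrite indicE; case: (s \in B); rewrite ?normr1 ?normr0.
    apply: (le_trans (levy_energyD nu qA _ _)).
    rewrite lee_pmul2l// leeD2l//; apply: levy_energy_le => //.
    by rewrite distrC.
have mI n B : measurable B -> measurable_fun [set: Omega] (sf_integral S (g n) B).
  move=> mB; apply: (measurable_step hX hXs) => j.
  apply: (bounded_Borel_sub _ _ (bg n j)); last exact: subIsetr.
  by apply: measurableI => //; exact: sf_measurable.
have /choice[Y hY] : forall B : set R, exists Y, measurable B -> measurable_fun [set: Omega] Y /\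
    gap P (sf_integral S (g n) B) Y @[n --> \oo] --> 0%E.
  move=> B; have [mB|nB] := pselect (measurable B); last by exists (cst 0).
  have [|e' e'0|Y hY] := @gap_complete _ _ _ _ P (fun n => sf_integral S (g n) B).
  - by move=> n; exact: mI.
  - pose k := 8 * c + 1; have k0 : 0 < k by rewrite ltr_wpDl// mulr_ge0.
    move: cD => /fine_cvgP[[N1 _ h1] /cvgrPdist_le/(_ (e' / k) (divr_gt0 e'0 k0))[N2 _ h2]].
    have h n : (maxn N1 N2 <= n)%N -> (D n <= (e' / k)%:E)%E.
      rewrite geq_max => /andP[n1 n2]; rewrite -[leLHS]fineK ?h1//= lee_fin.
      by have := h2 n n2; rewrite sub0r normrN; apply: le_trans; exact: ler_norm.
    exists (maxn N1 N2) => m n Nm Nn; apply: (le_trans (gapD B m n mB)).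
    apply: (@le_trans _ _ (c%:E * (4%:E * ((e' / k)%:E + (e' / k)%:E)))%E).
      by rewrite lee_wpmul2l ?lee_fin// lee_pmul2l// leeD// h.
    rewrite -EFinD -!EFinM lee_fin.
    have -> : c * (4 * (e' / k + e' / k)) = e' * ((8 * c) / k) by field; rewrite gt_eqF.
    by rewrite -[leRHS]mulr1 ler_pM2l// ler_pdivrMr// mul1r lerDl.
  - by exists Y.
have gapY B : measurable B -> cvg_in_prob P \oo (fun n => sf_integral S (g n) B) (Y B).
  move=> mB; have [mY cY] := hY B mB.
  by apply: cvg_in_prob_gap => //; apply: nearW => n; exact: mI.
have apx : approximates P S f g.
  split.
    apply: aeW => s so; rewrite -(zero_extE f so); exact: cg.
  move=> B [mB _ _ _]; exists (Y B); split; first by have [] := hY B mB.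
  exact: gapY.
exists (fun pq => Y `]pq.1, pq.2]%classic), (Y (oitv a b)); split.
- move=> p q ap pq qb; split; first by have [] := hY `]p, q]%classic (measurable_itv _).
  by exists g => //; apply: gapY.
- by have [] := hY _ moi.
- apply: cvg_in_prob_gap => [|//|].
    by apply: nearW => pq; have [] := hY `]pq.1, pq.2]%classic (measurable_itv _).
    by have [] := hY _ moi.
  (* The bound holds for the n-th approximants up to errors that vanish in n. *)
  have tailY pq : (a < pq.1%:E)%E -> (pq.2%:E < b)%E ->
      (gap P (Y `]pq.1, pq.2]%classic) (Y (oitv a b)) <= 4%:E * (c%:E * tail_energy pq))%E.
    move=> ap qb; have mp : measurable `]pq.1, pq.2]%classic by exact: measurable_itv.
    have [mY1 cY1] := hY _ mp; have [mY2 cY2] := hY _ moi.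
    pose L1 n := sf_integral S (g n) `]pq.1, pq.2]%classic.
    pose L2 n := sf_integral S (g n) (oitv a b).
    have L12 n : (gap P (L1 n) (L2 n) <= c%:E * tail_energy pq)%E.
      apply: (le_trans (gap_integral_le mp moi (bg n) (bg n))).
      rewrite /tail_energy; apply: lee_wpmul2l; first by rewrite lee_fin.
      apply: ge0_le_integral => //.
      + by apply: measurable_e; apply: measurable_funB; exact: mgB.
      + apply: measurable_e; apply: measurable_funM; last exact: mF.
        by apply: measurable_funB; exact: mind.
      + move=> s _; apply: levy_energy_le => //; rewrite -mulrBl normrM [leRHS]normrM distrC.
        by apply: ler_wpM2l => //; exact: gF.
    have h n : (gap P (Y `]pq.1, pq.2]%classic) (Y (oitv a b)) <=
        2%:E * gap P (L1 n) (Y `]pq.1, pq.2]%classic) + 4%:E * gap P (L2 n) (Y (oitv a b)) +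
        4%:E * (c%:E * tail_energy pq))%E.
      apply: (le_trans (gap_triangle P mY1 (mI n _ mp) mY2)); rewrite gapC -addeA leeD2l//.
      rewrite (_ : 4%:E = 2%:E * 2%:E :> \bar R)%E; last by rewrite -EFinM; congr EFin; lra.
      rewrite -!muleA -ge0_muleDr ?mule_ge0 ?gap_ge0 ?lee_fin//; last 1 first.
        exact: integral_ge0.
      rewrite lee_pmul2l//; apply: (le_trans (gap_triangle P (mI n _ mp) (mI n _ moi) mY2)).
      rewrite addeC; apply: leeD; first exact: lexx.
      by apply: lee_wpmul2l; [rewrite lee_fin|exact: L12].
    suff cu : (2%:E * gap P (L1 n) (Y `]pq.1, pq.2]%classic) +
        4%:E * gap P (L2 n) (Y (oitv a b)) + 4%:E * (c%:E * tail_energy pq))%E @[n --> \oo] -->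
        (2%:E * 0 + 4%:E * 0 + 4%:E * (c%:E * tail_energy pq))%E.
      move: cu; rewrite !mule0 !add0e => cu.
      by apply: (cvge_ge _ cu); exact: nearW.
    apply: cvgeD; [by rewrite !mule0 adde0| |exact: cvg_cst].
    have f2 : (2%:E : \bar R) \is a fin_num by [].
    have f4 : (4%:E : \bar R) \is a fin_num by [].
    by apply: cvgeD; [rewrite !mule0|exact: (cvgeZl f2 cY1)|exact: (cvgeZl f4 cY2)].
  apply: (@squeeze_cvge _ _ _ _ (cst 0%E) _ (fun pq => 4%:E * (c%:E * tail_energy pq))%E).
  + have [r [ar rb]] := real_between ab.
    exists (r, r) => // -[p q] /= [ap qb _ _ _].
    by rewrite gap_ge0 (tailY (p, q)).
  + exact: cvg_cst.
  + have -> : 0%E = (4%:E * (c%:E * 0))%E :> \bar R by rewrite !mule0.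
    have f4 : (4%:E : \bar R) \is a fin_num by [].
    have fc : (c%:E : \bar R) \is a fin_num by [].
    exact: (cvgeZl f4 (cvgeZl fc cvg_tail_energy)).
Qed.

End sufficiency.

(** * The equivalence *)

Lemma integral_zero_ext (R : realType) (a b : \bar R) (f : R -> R) (h : R -> \bar R) :
  h 0 = 0%E -> (\int[lebesgue_measure]_(s in oitv a b) h (f s) =
    \int[lebesgue_measure]_s h (zero_ext a b f s))%E.
Proof.
move=> h0; rewrite integral_mkcond; apply: eq_integral => s _.
rewrite patchE; case: ifPn => [|]; first by rewrite inE => so; rewrite zero_extE.
by rewrite notin_setE => so; rewrite zero_ext0.
Qed.

Theorem theorem3p9 (R : realType) (d : nat) (hd : (0 < d)%N)
  (a b : \bar R) (hab : (a < b)%E)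
  (mu : probability 'rV[R]_d R) (hmu : infinitely_divisible mu)
  (A : 'M[R]_d) (nu : {measure set 'rV[R]_d -> \bar R}) (gam : 'rV[R]_d)
  (htriplet : has_triplet mu A nu gam)
  (disp : measure_display) (Omega : measurableType disp)
  (P : probability Omega R)
  (X Xs : set R -> Omega -> 'rV[R]_d)
  (hX : is_random_measure P mu X) (hXs : is_random_measure P mu Xs)
  (hindep : rm_indep P X Xs)
  (f : R -> R) (hf : loc_integrable P a b X f) :
  sym_definable P a b X Xs f <->
  (\int[lebesgue_measure]_(s in oitv a b) (f s ^+ 2 * \tr A)%:E < +oo)%E /\
  (\int[lebesgue_measure]_(s in oitv a b)
     \int[nu]_x (Num.min (enorm (f s *: x) ^+ 2) 1)%:E < +oo)%E.
Proof.
have [_ qA nu0 nuI hC] := htriplet; have [mf _] := hf.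
have mF : measurable_fun [set: R] (zero_ext a b f) by exact: measurable_zero_ext.
rewrite (@integral_zero_ext R a b f (fun r => (r ^+ 2 * \tr A)%:E)); last first.
  by rewrite expr0n mul0r.
rewrite (@integral_zero_ext R a b f
  (fun r => \int[nu]_x (Num.min (enorm (r *: x) ^+ 2) 1)%:E)%E); last first.
  apply: integral0_eq => x _; rewrite enormZ_sqr expr0n mul0r.
  by rewrite min_l.
split; first exact: (definable_finite hab qA nu0 nuI hC hX hXs hindep mf).
move=> [gI jI]; apply: (finite_definable hab qA nu0 nuI hC hX hXs hindep mf).
rewrite ge0_integralD//.
- exact: lte_add_pinfty.
- by move=> s _; rewrite lee_fin mulr_ge0 ?sqr_ge0 ?tr_ge0.
- by apply/measurable_EFinP; apply: measurable_funM => //; exact: measurable_funX.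
- by move=> s _; apply: integral_ge0 => x _; rewrite lee_fin min1_ge0 ?sqr_ge0.
- exact: (measurableT_comp (measurable_jump_energy nu0 nuI) mF).
Qed.
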